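(* Suppose that $\{v_n\}$ and $\{w_m\}$ are $\gamma$-uniformly distributed sequences of points on $[0,1]^d$, $d\ge2$. Let $$\Omega_{a,b}=\{(x,y)\in[0,1]^d\times[0,1]^d: a\le x\cdot y\le b\},\qquad a\ge\tfrac1{100}.$$ Let $\psi$ be a smooth, non-negative function with support contained in the open cube $(0,1)^d$. Then $$\sum_{\{(n,m)\in[1,N]^2:\ a\le v_n\cdot w_m\le b\}}\psi(v_n)\psi(w_m)=N^2\iint_{\Omega_{a,b}}\psi(x)\psi(y)\,dx\,dy+R(a,b,N),$$ where for any $\epsilon>0$ there exists $C_\epsilon>0$ such that $$|R(a,b,N)|\le C_\epsilon N^{2-\gamma+\epsilon}.$$ In particular, if $b-a\ge cN^{-\gamma+\epsilon}$ for a fixed constant $c>0$ and $\epsilon>0$, then the number of incidences between $N$ points of $\{w_m\}$ and $N$ thin slabs with normals $\{v_n\}$, that is, $\#\{(n,m)\in[1,N]^2: a\le v_n\cdot w_m\le b\}$, is comparable (above and below) to $N^2(b-a)$ for sufficiently large $N$, since $|\Omega_{a,b}|\approx b-a$.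
   Context: Here $x\cdot y$ is the Euclidean dot product of points of $[0,1]^d\subset\mathbb{R}^d$, $|S|$ denotes the Lebesgue measure of a set $S$, $N$ is a positive integer, and $n,m$ in $[1,N]$ are integers. ''Comparable (above and below)'', also written $\approx$, means bounded above and below by positive constant multiples. The thin slab with normal $v_n$ is $\{y: a\le v_n\cdot y\le b\}$. For $\gamma\in(0,\frac12]$, a sequence of points $\{v_n\}$ is $\gamma$-uniformly distributed in $[0,1]^d$ if for every $\epsilon>0$ there exists a uniform constant $C_\epsilon$ (independent of $k$ and $N$) such that for every $k\in\mathbb{Z}^d\setminus\{0\}$, $$\left|\frac1N\sum_{n=1}^N e^{2\pi i k\cdot v_n}\right|\le C_\epsilon|k|^\epsilon N^{-\gamma}.$$
   Formalization: The comparability of |Ω_{a,b}| with b−a and of the incidence count with N²(b−a) is stated for 1/100≤a≤A<d and b≤B (A, B arbitrary, constants depending on them), since it fails otherwise: e.g. for a>d there are no incidences and |Ω_{a,b}|=0. *)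

(* Defs.v *)
From HB Require Import structures.
From mathcomp Require Import all_boot all_order all_algebra.
From mathcomp Require Import complex.
From mathcomp Require Import all_classical all_reals all_analysis.

Set Implicit Arguments.
Unset Strict Implicit.
Unset Printing Implicit Defensive.

Import Order.TTheory GRing.Theory Num.Theory.
Import numFieldNormedType.Exports.

Local Open Scope classical_set_scope.
Local Open Scope ring_scope.

(* The product sigma-algebra on row vectors, as for n.-tuple. *)
Section measurable_rV.
Context {d : measure_display} {T : measurableType d}.
Variable n : nat.

Let coords : 'I_n -> 'rV[T]_n -> T := fun i x => x ord0 i.

Let rV_set0 : g_sigma_preimage coords set0.
Proof. exact: sigma_algebra0. Qed.

Let rV_setC A : g_sigma_preimage coords A -> g_sigma_preimage coords (~` A).
Proof. exact: sigma_algebraC. Qed.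

Let rV_bigcup (F : (set _)^nat) : (forall i, g_sigma_preimage coords (F i)) ->
  g_sigma_preimage coords (\bigcup_i (F i)).
Proof. exact: sigma_algebra_bigcup. Qed.

HB.instance Definition _ := @isMeasurable.Build (measure_tuple_display d)
  'rV[T]_n (g_sigma_preimage coords) rV_set0 rV_setC rV_bigcup.

Lemma measurable_coord_rV (i : 'I_n) :
  measurable_fun [set: 'rV[T]_n] (fun x : 'rV[T]_n => x ord0 i).
Proof.
move=> _ Y mY; rewrite setTI; apply: sub_sigma_algebra => /=.
rewrite -bigcup_seq/=; exists i => /=; first by rewrite mem_index_enum.
by exists Y => //; rewrite setTI.
Qed.

Lemma measurable_fun_rV d1 (T1 : measurableType d1) (f : T1 -> 'rV[T]_n) :
  (forall i, measurable_fun [set: T1] (fun x => f x ord0 i)) ->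
  measurable_fun [set: T1] f.
Proof.
move=> mf _ Y mY; rewrite setTI; move: Y mY.
suff: g_sigma_preimage coords `<=` [set Y | measurable (f @^-1` Y)] by [].
apply: smallest_sub.
  split => [|A|F mF] /=.
  - by rewrite preimage_set0.
  - by rewrite setTD preimage_setC; exact: measurableC.
  - by rewrite preimage_bigcup; exact: bigcupT_measurable.
rewrite -bigcup_seq => _ [i _] [A mA <-] /=.
by rewrite setTI; have := mf i measurableT A mA; rewrite setTI.
Qed.

End measurable_rV.

Section cons_rV.
Context {R : realType} {n : nat}.

Definition cons_rV (z : R * 'rV[R]_n) : 'rV[R]_n.+1 :=
  \row_i oapp (z.2 ord0) z.1 (unlift ord0 i).

Lemma measurable_cons_rV :
  measurable_fun [set: measurableTypeR R * 'rV[R]_n] cons_rV.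
Proof.
apply: measurable_fun_rV => i; case: (unliftP ord0 i) => [j|] ->{i}.
  rewrite (_ : (fun _ => _) = (fun x : 'rV[R]_n => x ord0 j) \o snd).
    by apply: measurableT_comp => //; exact: measurable_coord_rV.
  by apply/funext => z; rewrite /= mxE liftK.
rewrite (_ : (fun _ => _) = fst); first exact: measurable_fst.
by apply/funext => z; rewrite mxE unlift_none.
Qed.

Variable mu : {sigma_finite_measure set 'rV[R]_n -> \bar R}.

Definition cons_measure : set 'rV[R]_n.+1 -> \bar R :=
  pushforward (lebesgue_measure \x mu)%E cons_rV.

Let cons_measure0 : cons_measure set0 = 0%E.
Proof. by rewrite /cons_measure /pushforward preimage_set0 measure0. Qed.

Let cons_measure_ge0 A : (0 <= cons_measure A)%E.
Proof. exact: (measure_ge0 (lebesgue_measure \x mu)%E). Qed.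

Let cons_measure_sigma_additive : semi_sigma_additive cons_measure.
Proof.
have mpre A : measurable A -> measurable (cons_rV @^-1` A).
  by move=> mA; rewrite -[X in measurable X]setTI; exact: measurable_cons_rV.
move=> F mF tF mUF; rewrite /cons_measure /pushforward preimage_bigcup.
apply: (@measure_semi_sigma_additive _ _ _ (lebesgue_measure \x mu)%E).
- by move=> k; exact: mpre.
- apply/trivIsetP => /= i j _ _ ij; rewrite -preimage_setI.
  by move/trivIsetP : tF => /(_ _ _ _ _ ij) ->//; rewrite preimage_set0.
- by rewrite -preimage_bigcup; exact: mpre.
Qed.

HB.instance Definition _ := isMeasure.Build _ _ _ cons_measure
  cons_measure0 cons_measure_ge0 cons_measure_sigma_additive.

Let cons_measure_sigma_finite : sigma_finite setT cons_measure.
Proof.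
have /sigma_finiteP[F [TF ndF Foo]] := sigma_finiteT (@lebesgue_measure R).
have /sigma_finiteP[G [TG ndG Goo]] := sigma_finiteT mu.
pose tl (x : 'rV[R]_n.+1) : 'rV[R]_n := \row_i x ord0 (lift ord0 i).
have mtl : measurable_fun setT tl.
  apply: measurable_fun_rV => i.
  rewrite (_ : (fun _ => _) = (fun x : 'rV[R]_n.+1 => x ord0 (lift ord0 i))).
    exact: measurable_coord_rV.
  by apply/funext => x; rewrite /= mxE.
exists (fun k => [set x : 'rV[R]_n.+1 | F k (x ord0 ord0)] `&` tl @^-1` G k).
  apply/seteqP; split=> // x _.
  have [i _ Fi] : (\bigcup_i F i) (x ord0 ord0) by rewrite -TF.
  have [j _ Gj] : (\bigcup_i G i) (tl x) by rewrite -TG.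
  exists (maxn i j) => //; split => /=.
  - by move: Fi; exact/subsetPset/ndF/leq_maxl.
  - by move: Gj; exact/subsetPset/ndG/leq_maxr.
move=> k; have [mF Fk] := Foo k; have [mG Gk] := Goo k; split.
  apply: measurableI; rewrite -[X in measurable X]setTI.
    exact: (measurable_coord_rV ord0 measurableT mF).
  exact: mtl.
rewrite /cons_measure /pushforward (_ : _ @^-1` _ = F k `*` G k).
  by rewrite product_measure1E// lte_mul_pinfty// ge0_fin_numE.
have tlE z : tl (cons_rV z) = z.2 by apply/rowP => i; rewrite !mxE liftK.
by apply/seteqP; split=> z /=; rewrite mxE unlift_none/= tlE.
Qed.

HB.instance Definition _ := Measure_isSigmaFinite.Build _ _ _ cons_measure
  cons_measure_sigma_finite.

End cons_rV.

(* Lebesgue measure on R^n, as the n-fold product of Lebesgue measure on R. *)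
Fixpoint lebesgue_rV {R : realType} {n : nat} :
    {sigma_finite_measure set 'rV[R]_n -> \bar R} :=
  match n with
  | 0%N => \d_(0 : 'rV[R]_0)
  | m.+1 => cons_measure (@lebesgue_rV R m)
  end.

Section euclidean.
Context {R : realType} {d : nat}.
Implicit Types x y v : 'rV[R]_d.

Definition dot x y : R := \sum_(i < d) x ord0 i * y ord0 i.

Definition enorm x : R := Num.sqrt (dot x x).

Definition cube : set 'rV[R]_d := [set x | forall i, 0 <= x ord0 i <= 1].

Definition open_cube : set 'rV[R]_d := [set x | forall i, 0 < x ord0 i < 1].

Fixpoint partials (s : seq 'I_d) (f : 'rV[R]_d -> R) : 'rV[R]_d -> R :=
  if s is i :: s' then 'D_(delta_mx ord0 i) (partials s' f) else f.

(* C^oo: all iterated partial derivatives exist and are continuous. *)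
Definition smooth (f : 'rV[R]_d -> R) : Prop := forall s : seq 'I_d,
  continuous (partials s f) /\
  forall i x, derivable (partials s f) x (delta_mx ord0 i).

(* Not 0.-support: the closure is taken. *)
Definition closed_support (f : 'rV[R]_d -> R) : set 'rV[R]_d :=
  closure [set x | f x != 0].

End euclidean.

(* e ^ (i t) *)
Definition expi {R : realType} (t : R) : R[i] := (cos t +i* sin t)%C.

(* Sequences are indexed from 1; the value at 0 is irrelevant. *)
Definition uniformly_distributed {R : realType} {d : nat} (gamma : R)
    (v : nat -> 'rV[R]_d) : Prop :=
  (forall n, (0 < n)%N -> cube (v n)) /\
  forall eps : R, 0 < eps -> exists C : R,
    forall (k : 'rV[int]_d) (N : nat), k != 0 -> (0 < N)%N ->
      let kR := map_mx intr k in
      complex.ComplexField.Normc.normc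
        (N%:R^-1 * \sum_(1 <= n < N.+1) expi (2 * pi * dot kR (v n)))
      <= C * enorm kR `^ eps * N%:R `^ (- gamma).

Section incidences.
Context {R : realType} {d : nat}.

(* Since x.y <= d on the cube, the measure of Omega a b vanishes for a > d and
   is o(b - a) as a tends to d with b = d: it is comparable to b - a only when
   a stays away from d and b stays bounded. *)
Definition Omega (a b : R) : set ('rV[R]_d * 'rV[R]_d) :=
  [set z | [/\ cube z.1, cube z.2 & a <= dot z.1 z.2 <= b]].

(* 'I_N enumerates 0, ..., N - 1, hence the shift. *)
Definition incidences (v w : nat -> 'rV[R]_d) (a b : R) (N : nat) :
    {set 'I_N * 'I_N} :=
  [set p : 'I_N * 'I_N | a <= dot (v p.1.+1) (w p.2.+1) <= b]%SET.

End incidences.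

(* Main.v *)
Require Import Defs.
From mathcomp Require Import all_boot all_order all_algebra.
From mathcomp Require Import complex ring lra zify.
From mathcomp Require Import all_classical all_reals all_analysis.
From mathcomp Require Import measurable_realfun.

Set Implicit Arguments.
Unset Strict Implicit.
Unset Printing Implicit Defensive.

Import Order.TTheory GRing.Theory Num.Theory.
Import numFieldNormedType.Exports.
Import complex.ComplexField.Normc.

Local Open Scope classical_set_scope.
Local Open Scope ring_scope.

(** Fix a normal [y] in the cube and consider the slab [a <= dot x y <= b]. For
    [a >= 1 / 100] the slab either misses the cube or has a normal with a coordinate
    bounded below, so that its volume is [O (b - a)]. The main estimate
    ([slab_discrepancy]) compares, for a cut-off [g], the mean of [g] times the
    indicator of the slab over the points [v n] with its integral over the cube, with
    an error [O (N ^ (eps - gamma))] that is uniform in [y], [a] and [b].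

    To prove it, replace the indicator by a trapezoid with ramps of width [delta].
    As a function of one variable, the trapezoid has Fourier coefficients bounded both
    by [1 / |tau|] and by [1 / (delta tau ^ 2)]; interpolating between the two, the sum
    of the coefficients weighted by a small power of the frequency is [O (delta ^ - eps)]
    ([trapezoid_approx]). So [g] times the trapezoid is a superposition, with small
    total mass, of functions [g x * ec (tau * dot x y)] whose frequency [tau * y] is real.
    Uniform distribution gives information on integer frequencies only, so each of these
    is interpolated on a fine grid by a trigonometric polynomial with integer
    frequencies. As [g] vanishes on the boundary of the cube, summation by parts makes
    the coefficients decay like [1 / (1 + (k_i - tau y_i) ^ 2)] in every coordinate,
    uniformly in the real frequency ([trig_approx_modulated]). Hence the smoothed
    function belongs to a class for which the exponential sums bound the discrepancy
    directly ([trig_approx_discrepancy]). Smoothing costs only [delta ^ - eps], and the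
    ramps have volume [O (delta)], so [delta = 1 / N] is admissible.

    The sum over pairs follows by using this twice ([pair_discrepancy]): for the points
    [v n] with the normals [w m], then, after exchanging the sum over [m] with the
    integral over [x], for the points [w m] with the normal [x].

    For the number of incidences, the lower bound compares it with the sum weighted by
    a product bump, whose main term is at least a multiple of [b - a] because one can
    choose both points close to the diagonal point with coordinates [sqrt (a / d)]
    ([bumps_volume_ge]). For the upper bound, a bump misses the points close to the
    boundary; but uniform distribution is invariant under translations of the torus
    [(R / Z) ^ d], and each point is moved to the middle of the cube by one of [3 ^ d]
    translations ([slab_count_le]). As [b - a >= c N ^ (eps - gamma)], taking [eps / 2]
    in the error terms makes them negligible for large [N]. *)

(** * Characters of the circle *)

Section exponential.
Context {R : realType}.
Implicit Types s t : R.

(** [e (t) = exp (2 i pi t)] of analytic number theory. *)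
Definition ec t : R[i] := expi (2 * pi * t).

Lemma ecD s t : ec (s + t) = ec s * ec t.
Proof.
rewrite /ec /expi mulrDr cosD sinD; simpc; congr (_ +i* _)%C; ring.
Qed.

Lemma ec0 : ec 0 = 1.
Proof. by rewrite /ec /expi mulr0 cos0 sin0. Qed.

Lemma ec_sum (I : Type) (r : seq I) (P : pred I) (f : I -> R) :
  ec (\sum_(i <- r | P i) f i) = \prod_(i <- r | P i) ec (f i).
Proof. by apply: (big_morph ec); [exact: ecD|exact: ec0]. Qed.

Lemma ec_nat (n : nat) : ec n%:R = 1.
Proof.
elim: n => [|n IH]; first exact: ec0.
by rewrite -natr1 ecD IH mul1r /ec /expi mulr1 mulr_natl cos2pi sin2pi.
Qed.

Lemma ecNK t : ec t * ec (- t) = 1.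
Proof. by rewrite -ecD subrr ec0. Qed.

Lemma ec_int (z : int) : ec z%:~R = 1.
Proof.
case: z => n; first exact: ec_nat.
have := ecNK n.+1%:R; rewrite ec_nat mul1r => <-.
by rewrite NegzE mulrNz.
Qed.

Lemma ec_mulrn t (n : nat) : ec (t * n%:R) = ec t ^+ n.
Proof.
elim: n => [|n IH]; first by rewrite mulr0 ec0.
by rewrite exprS -IH -ecD -natr1 mulrDr mulr1 addrC.
Qed.

Lemma normc_ec t : normc (ec t) = 1.
Proof. by rewrite /= cos2Dsin2 sqrtr1. Qed.

Lemma normc_ge0 (z : R[i]) : 0 <= normc z.
Proof. by case: z => a b; exact: sqrtr_ge0. Qed.

Lemma normc_real t : normc t%:C%C = `|t|.
Proof. by rewrite /= expr0n addr0 sqrtr_sqr. Qed.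

Lemma normc_distC (x y : R[i]) : normc (x - y) = normc (y - x).
Proof. by rewrite -opprB normcN. Qed.

Lemma normc_sum (I : Type) (r : seq I) (P : pred I) (f : I -> R[i]) :
  normc (\sum_(i <- r | P i) f i) <= \sum_(i <- r | P i) normc (f i).
Proof.
elim/big_ind2 : _ => //; first by rewrite normc0.
by move=> x a y b h1 h2; apply: le_trans (le_normcD _ _) _; apply: lerD.
Qed.

Lemma Re_le_normc (z : R[i]) : `|complex.Re z| <= normc z.
Proof.
by case: z => a b /=; rewrite -sqrtr_sqr ler_wsqrtr// lerDl sqr_ge0.
Qed.

Lemma Re_sum (I : Type) (r : seq I) (P : pred I) (f : I -> R[i]) :
  complex.Re (\sum_(i <- r | P i) f i) = \sum_(i <- r | P i) complex.Re (f i).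
Proof. by apply: (big_morph _ _ (erefl : complex.Re 0 = 0)) => -[? ?] []. Qed.

Lemma sin_mvt (t : R) : 0 < t -> exists2 c, 0 < c < t & sin t = cos c * t.
Proof.
move=> t0; have [|c] := @MVT R sin cos 0 t t0 (fun x _ => is_derive_sin x).
  by apply: continuous_subspaceT => x; exact: continuous_sin.
by rewrite in_itv/= sin0 !subr0 => ? ->; exists c.
Qed.

Lemma sin_le (t : R) : `|sin t| <= `|t|.
Proof.
wlog t0 : t / 0 < t => [H|].
  have [t0|t0|t0] := ltgtP 0 t; [exact: H| |by rewrite -t0 sin0].
  by rewrite -normrN -sinN -[leRHS]normrN; apply: H; rewrite oppr_gt0.
have [c _ ->] := sin_mvt t0.
by rewrite normrM ler_piMl// cos_max.
Qed.

(** Write [sin t = 2 sin (t / 2) cos (t / 2)], estimate [sin (t / 2)] by the mean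
    value theorem, and use that [cos ^ 2 >= 1 / 2] on [[0, pi / 4]]. *)
Lemma sin_ge_half (t : R) : 0 <= t <= pi / 2 -> t / 2 <= sin t.
Proof.
case/andP; rewrite le_eqVlt => /orP[/eqP<-|t0] tpi; first by rewrite sin0 mul0r.
set u := t / 2; have u0 : 0 < u by rewrite divr_gt0.
have -> : t = u *+ 2 by rewrite /u -mulr_natr divfK.
rewrite sin_mulr2n -mulr_natr.
have pi0 := @pi_gt0 R.
have upi : u <= pi / 4 by rewrite /u; lra.
have [c /andP[c0 cu] ->] := sin_mvt u0.
have h1 : cos u <= cos c.
  by apply/ltW; rewrite ltr_cos ?in_itv/=//; apply/andP; split; lra.
have cu0 : 0 <= cos u by apply: cos_ge0_pihalf; apply/andP; split; lra.
have h2 : 2^-1 <= cos u ^+ 2.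
  have : 0 <= cos (u *+ 2).
    by apply: cos_ge0_pihalf; rewrite -mulr_natr; apply/andP; split; lra.
  rewrite cos_mulr2n -mulr_natr; lra.
have : cos u ^+ 2 <= cos u * cos c by rewrite expr2 ler_wpM2l.
move=> h3; have h4 : 2^-1 <= cos u * cos c by exact: le_trans h3.
rewrite mulrA -mulrA -[leLHS]mulr1.
have -> : cos u * cos c * (u * 2) = u * (cos u * cos c * 2) by ring.
by rewrite ler_pM2l//; lra.
Qed.

Lemma normc_ec_sub1 t : normc (ec t - 1) = 2 * `|sin (pi * t)|.
Proof.
rewrite /ec /expi; set u := pi * t.
have -> : 2 * pi * t = u *+ 2 by rewrite /u; ring.
have -> : ((cos (u *+ 2) +i* sin (u *+ 2))%C - 1 : R[i]) =
    ((cos (u *+ 2) - 1) +i* sin (u *+ 2))%C.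
  by apply/eqP; rewrite eq_complex /= subr0 !eqxx.
rewrite /=.
have -> : 2 * `|sin u| = Num.sqrt ((2 * sin u) ^+ 2).
  by rewrite sqrtr_sqr normrM ger0_norm.
congr Num.sqrt.
rewrite sin_mulr2n cos_mulr2n; have := sin2cos2 u.
set c := cos u; set z := sin u => zc.
have -> : ((c * z) *+ 2) ^+ 2 = 4 * c ^+ 2 * z ^+ 2 by ring.
have -> : (2 * z) ^+ 2 = 4 * z ^+ 2 by ring.
by rewrite zc; ring.
Qed.

Lemma normc_ec_sub s t : normc (ec s - ec t) = 2 * `|sin (pi * (s - t))|.
Proof.
rewrite -normc_ec_sub1.
have -> : ec s - ec t = ec t * (ec (s - t) - 1).
  by rewrite mulrBr mulr1 -ecD addrCA subrr addr0.
by rewrite normcM normc_ec mul1r.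
Qed.

Lemma normc_ec_sub_le s t : normc (ec s - ec t) <= 2 * pi * `|s - t|.
Proof.
rewrite normc_ec_sub -mulrA ler_pM2l//.
by rewrite (le_trans (sin_le _))// normrM ger0_norm// pi_ge0.
Qed.

Lemma normc_ec_sub_le2 s t : normc (ec s - ec t) <= 2.
Proof. by rewrite normc_ec_sub ler_piMr// sin_max. Qed.

(** The chord of the unit circle cut by an angle at most [pi] is at least
    a fixed proportion of the arc. *)
Lemma sin_pi_ge t : `|t| <= 2^-1 -> `|t| <= `|sin (pi * t)|.
Proof.
move=> t2; have pi0 := @pi_gt0 R; have pi2 := @pi_ge2 R.
have -> : `|sin (pi * t)| = `|sin (pi * `|t|)|.
  have [//|_] := ger0P t; by rewrite mulrN sinN normrN.
have h : pi * `|t| / 2 <= sin (pi * `|t|).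
  by apply: sin_ge_half; rewrite mulr_ge0//= ?ler_pM2l// ltW.
apply: le_trans (ler_norm _); apply: le_trans h.
by rewrite mulrAC ler_peMl//; lra.
Qed.

End exponential.

(** * Dot products and grid sums *)

Section dot.
Context {R : realType} {d : nat}.
Implicit Types x y z : 'rV[R]_d.

Lemma dotC x y : dot x y = dot y x.
Proof. by apply: eq_bigr => i _; rewrite mulrC. Qed.

Lemma dotDr x y z : dot x (y + z) = dot x y + dot x z.
Proof. by rewrite -big_split/=; apply: eq_bigr => i _; rewrite mxE mulrDr. Qed.

Lemma dot0r x : dot x 0 = 0.
Proof. by rewrite /dot big1// => i _; rewrite mxE mulr0. Qed.

Lemma dotZr (c : R) x y : dot x (c *: y) = c * dot x y.
Proof. by rewrite mulr_sumr; apply: eq_bigr => i _; rewrite mxE mulrCA. Qed.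

Lemma dotNr x y : dot x (- y) = - dot x y.
Proof. by rewrite -scaleN1r dotZr mulN1r. Qed.

Lemma dotBr x y z : dot x (y - z) = dot x y - dot x z.
Proof. by rewrite dotDr dotNr. Qed.

Lemma dotDl x y z : dot (x + y) z = dot x z + dot y z.
Proof. by rewrite dotC dotDr !(dotC z). Qed.

Lemma dotBl x y z : dot (x - y) z = dot x z - dot y z.
Proof. by rewrite dotC dotBr !(dotC z). Qed.

Lemma dot_delta x i : dot x (delta_mx ord0 i) = x ord0 i.
Proof.
rewrite /dot (bigD1 i)//= mxE !eqxx mulr1 big1 ?addr0// => j ji.
by rewrite mxE eqxx (negbTE ji) mulr0.
Qed.

Lemma dot_shift x y (c : R) i :
  dot x (y + c *: delta_mx ord0 i) = dot x y + c * x ord0 i.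
Proof. by rewrite dotDr dotZr dot_delta. Qed.

End dot.

Section grid.
Context {R : realType} {d : nat}.
Variable M : nat.
Hypothesis M0 : (0 < M)%N.
Local Notation K := M.+2.
Local Notation h := (M%:R^-1 : R).
Local Notation "'e_ i" := (delta_mx ord0 i : 'rV[R]_d) (at level 8).
Implicit Types (g : 'rV[R]_d -> R) (p : {ffun 'I_d -> 'I_K}) (eta : 'rV[R]_d).

(** The index [0] stands for the coordinate [- 1 / M] and the index [M.+1]
    for the coordinate [1]: one layer outside of the open cube on each side,
    so that a function supported in the open cube can be shifted by one step
    with no wrap-around term. *)
Definition gridpt p : 'rV[R]_d := \row_i (((p i)%:R - 1) / M%:R).

Definition gridsum g eta : R[i] :=
  \sum_p (g (gridpt p))%:C%C * ec (dot eta (gridpt p)).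

Definition vanish_at (i : 'I_d) g := forall x : 'rV[R]_d, ~~ (0 < x ord0 i < 1) -> g x = 0.

Definition gridshift i p : {ffun 'I_d -> 'I_K} :=
  [ffun j => if j == i then ordS (p j) else p j].

Lemma gridshift_inj i : injective (gridshift i).
Proof.
move=> p q /ffunP pq; apply/ffunP => j; have := pq j.
by rewrite !ffunE; case: ifP => // _ /ordS_inj.
Qed.

Let MR0 : 0 < M%:R :> R. Proof. by rewrite ltr0n. Qed.

Lemma gridpt_shift i p : (p i < M.+1)%N ->
  gridpt (gridshift i p) = gridpt p + h *: 'e_i.
Proof.
move=> pM; apply/rowP => j; rewrite !mxE !ffunE eqxx/=.
case: eqVneq => [->|ji]; last by rewrite mulr0 addr0.
by rewrite /= modn_small// mulr1 -natr1; field; exact: lt0r_neq0.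
Qed.

Lemma gridpt_wrap i p : (M.+1 <= p i)%N ->
  gridpt p ord0 i = 1 /\ gridpt (gridshift i p) ord0 i = - h.
Proof.
move=> pM; have pE : p i = M.+1 :> nat.
  by apply/eqP; rewrite eqn_leq pM -ltnS ltn_ord.
rewrite !mxE !ffunE eqxx /= pE modnn sub0r mulN1r; split => //.
by rewrite -natr1 addrK divff// lt0r_neq0.
Qed.

(** Summation by parts. The only grid points that [gridshift] moves wrongly lie on
    the hyperplanes [x_i = 1] and [x_i = - 1 / M], where [g] vanishes. *)
Lemma gridsum_shift g eta i : vanish_at i g ->
  gridsum (fun x => g (x + h *: 'e_i)) eta =
  ec (- (h * eta ord0 i)) * gridsum g eta.
Proof.
move=> gi; rewrite [in RHS]/gridsum (reindex_inj (@gridshift_inj i)) mulr_sumr.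
apply: eq_bigr => p _; have [pM|pM] := ltnP (p i) M.+1.
  rewrite gridpt_shift// dot_shift ecD mulrCA; congr (_ * _).
  by rewrite mulrCA -ecD addNr ec0 mulr1.
have [p1 p2] := gridpt_wrap pM.
have h0 : 0 < h by rewrite invr_gt0.
rewrite gi ?gi ?mul0r ?mulr0//.
  by rewrite p2 oppr_gt0 ltNge ltW.
by rewrite !mxE !eqxx /= mulr1; move: p1; rewrite mxE => ->; rewrite negb_and -!leNgt lerDl (ltW h0) orbT.
Qed.

Lemma gridsum_shiftN g eta i : vanish_at i g ->
  gridsum (fun x => g (x - h *: 'e_i)) eta =
  ec (h * eta ord0 i) * gridsum g eta.
Proof.
move=> gi; rewrite [in LHS]/gridsum (reindex_inj (@gridshift_inj i)) mulr_sumr.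
apply: eq_bigr => p _; have [pM|pM] := ltnP (p i) M.+1.
  by rewrite gridpt_shift// addrK dot_shift ecD mulrA mulrC.
have [p1 p2] := gridpt_wrap pM.
have h0 : 0 < h by rewrite invr_gt0.
rewrite gi ?gi ?mul0r ?mulr0//.
  by rewrite p1 ltxx andbF.
by rewrite !mxE !eqxx /= mulr1; move: p2; rewrite mxE => ->; rewrite negb_and -!leNgt subr_le0 (le_trans _ (ltW h0))// oppr_le0 ltW.
Qed.

Lemma gridsumD g1 g2 eta :
  gridsum (fun x => g1 x + g2 x) eta = gridsum g1 eta + gridsum g2 eta.
Proof.
by rewrite -big_split; apply: eq_bigr => p _; rewrite rmorphD mulrDl.
Qed.

Lemma gridsumZ (c : R) g eta :
  gridsum (fun x => c * g x) eta = c%:C%C * gridsum g eta.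
Proof.
by rewrite mulr_sumr; apply: eq_bigr => p _; rewrite rmorphM mulrA.
Qed.

(** [1 - Laplacian] in the direction [i], discretised at scale [M^-1]. *)
Definition Lop i g : 'rV[R]_d -> R := fun x =>
  g x - M%:R ^+ 2 * (g (x + h *: 'e_i) + g (x - h *: 'e_i) - 2 * g x).

Definition Lops (s : seq 'I_d) g := foldr Lop g s.

(** The Fourier multiplier of [Lop]. *)
Definition Lmul (t : R) : R := 1 + M%:R ^+ 2 * (4 * sin (pi * (t / M%:R)) ^+ 2).

Lemma gridsum_Lop i g eta : vanish_at i g ->
  gridsum (Lop i g) eta = (Lmul (eta ord0 i))%:C%C * gridsum g eta.
Proof.
move=> gi.
have -> : Lop i g = fun x => (1 + 2 * M%:R ^+ 2) * g x +
    (- M%:R ^+ 2 * g (x + h *: 'e_i) + - M%:R ^+ 2 * g (x - h *: 'e_i)).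
  by apply/funext => x; rewrite /Lop; ring.
rewrite !gridsumD !gridsumZ gridsum_shift// gridsum_shiftN//.
rewrite !mulrA -!mulrDl; congr (_ * _).
set u := h * eta ord0 i.
have -> : Lmul (eta ord0 i) = 1 + M%:R ^+ 2 * (2 - 2 * cos (2 * pi * u)).
  rewrite /Lmul (_ : pi * _ = pi * u); last by rewrite /u mulrC [h * _]mulrC mulrC.
  rewrite (_ : 2 * pi * u = (pi * u) *+ 2); last by ring.
  by rewrite cos_mulr2n sin2cos2 -mulr_natr; ring.
rewrite /ec /expi mulrN cosN sinN; simpc.
apply/eqP; rewrite eq_complex /=; apply/andP; split; apply/eqP; ring.
Qed.

(** A difference operator in direction [j] translates along [j] only, so the other
    coordinates keep their vanishing condition. This is why each direction is used
    at most once in [Lops]. *)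
Lemma vanish_Lop i j g : i != j -> vanish_at i g -> vanish_at i (Lop j g).
Proof.
move=> ij gi x xi; rewrite /Lop !gi//; first by rewrite mulr0 subr0 addr0 mulr0 subr0.
  by rewrite !mxE (negbTE ij) /= mulr0 subr0.
by rewrite !mxE (negbTE ij) /= mulr0 addr0.
Qed.

Lemma vanish_Lops i s g : i \notin s -> vanish_at i g -> vanish_at i (Lops s g).
Proof.
elim: s => //= j s IH; rewrite inE negb_or => /andP[ij js] gi.
by apply: vanish_Lop => //; exact: IH.
Qed.

Lemma gridsum_Lops s g eta : uniq s -> (forall i, vanish_at i g) ->
  gridsum (Lops s g) eta =
  (\prod_(i <- s) Lmul (eta ord0 i))%:C%C * gridsum g eta.
Proof.
move=> + gv; elim: s => [|i s IH] /=; first by rewrite big_nil mul1r.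
move=> /andP[si us]; rewrite gridsum_Lop ?IH// ?big_cons ?rmorphM ?mulrA//.
exact: vanish_Lops.
Qed.

(** The multiplier of the discrete Laplacian is as large as the continuous one, up to
    a constant, for frequencies below the Nyquist bound [M / 2]. *)
Lemma Lmul_ge t : `|t / M%:R| <= 2^-1 -> 1 + 4 * t ^+ 2 <= Lmul t.
Proof.
move=> tM; rewrite /Lmul lerD2l [leRHS]mulrCA ler_pM2l//.
have H : `|t / M%:R| ^+ 2 <= `|sin (pi * (t / M%:R))| ^+ 2.
  by rewrite ler_pXn2r ?nnegrE//; exact: sin_pi_ge.
rewrite !real_normK ?num_real// in H.
apply: le_trans (ler_wpM2l _ H); last exact: sqr_ge0.
by rewrite expr_div_n mulrCA divff ?mulr1// expf_neq0// lt0r_neq0.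
Qed.

Lemma normc_gridsum_le g eta :
  normc (gridsum g eta) <= \sum_p `|g (gridpt p)|.
Proof.
apply: le_trans (normc_sum _ _ _) _; apply: ler_sum => p _.
by rewrite normcM normc_ec mulr1 normc_real.
Qed.

Definition gridcoef g eta : R[i] := (M%:R^-1 ^+ d)%:C%C * gridsum g eta.

Lemma normc_gridcoef_le g eta :
  normc (gridcoef g eta) <= M%:R^-1 ^+ d * \sum_p `|g (gridpt p)|.
Proof.
rewrite normcM normc_real ger0_norm ?exprn_ge0 ?invr_ge0//.
by apply: ler_wpM2l; rewrite ?exprn_ge0 ?invr_ge0 ?normc_gridsum_le.
Qed.

End grid.

(** * Interpolation by integer frequencies *)

Section weight.
Context {R : realType} {d : nat}.
Implicit Types x y : 'rV[R]_d.

(** A submultiplicative substitute for powers of [1 + |x|] that factors over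
    the coordinates. *)
Definition wt (kappa : R) x : R := (\prod_i (1 + `|x ord0 i|)) `^ kappa.

Lemma sum_le_prod (I : Type) (s : seq I) (f : I -> R) : (forall i, 0 <= f i) ->
  1 + \sum_(i <- s) f i <= \prod_(i <- s) (1 + f i).
Proof.
move=> f0; elim: s => [|i s IH]; first by rewrite !big_nil addr0.
rewrite !big_cons; have s0 : 0 <= \sum_(j <- s) f j by exact: sumr_ge0.
apply: le_trans (ler_wpM2l _ IH); last by rewrite addr_ge0.
rewrite mulrDl mul1r mulrDr mulr1; have := f0 i; have := mulr_ge0 (f0 i) s0; lra.
Qed.

Lemma wt_ge0 kappa x : 0 <= wt kappa x. Proof. exact: powR_ge0. Qed.

Lemma wtD kappa x y : 0 <= kappa -> wt kappa (x + y) <= wt kappa x * wt kappa y.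
Proof.
move=> k0; rewrite -powRM; last 2 first.
- by apply: prodr_ge0 => i _; rewrite addr_ge0.
- by apply: prodr_ge0 => i _; rewrite addr_ge0.
apply: ge0_ler_powR => //; rewrite ?nnegrE.
- by apply: prodr_ge0 => i _; rewrite addr_ge0.
- by rewrite mulr_ge0//; apply: prodr_ge0 => i _; rewrite addr_ge0.
rewrite -big_split/=; apply: ler_prod => i _; rewrite addr_ge0//= mxE.
have := ler_normD (x ord0 i) (y ord0 i).
have := mulr_ge0 (normr_ge0 (x ord0 i)) (normr_ge0 (y ord0 i)).
move: `|_ + _| `|x _ _| `|y _ _| => a b c h1 h2.
by rewrite mulrDl mul1r mulrDr mulr1; lra.
Qed.

Lemma wtN kappa x : wt kappa (- x) = wt kappa x.
Proof. by congr (_ `^ _); apply: eq_bigr => i _; rewrite mxE normrN. Qed.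

End weight.

Section interpolation.
Context {R : realType} {d : nat}.
Variable m : nat.
Local Notation M := (m.*2.+1).
Local Notation h := (M%:R^-1 : R).
Local Notation "'e_ i" := (delta_mx ord0 i : 'rV[R]_d) (at level 8).
Implicit Types (g : 'rV[R]_d -> R) (p : {ffun 'I_d -> 'I_M.+2}).
Implicit Types (t : {ffun 'I_d -> 'I_M}) (xi : 'rV[R]_d).

Definition intR (l : 'rV[int]_d) : 'rV[R]_d := map_mx intr l.

(** The [M ^ d] frequencies closest to [xi]. *)
Definition window xi t : 'rV[int]_d :=
  \row_i (Num.floor (xi ord0 i + 2^-1) + (t i)%:Z - m%:Z).

(** Frequencies measured from the real frequency [xi]: all decay estimates depend on
    this difference only, which is what makes them uniform in [xi]. *)
Definition offset xi t : 'rV[R]_d := xi - intR (window xi t).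

Lemma offsetE xi t i : exists2 th, `|th| <= 2^-1 &
  offset xi t ord0 i = th + (m%:R - (t i)%:R).
Proof.
exists (xi ord0 i - (Num.floor (xi ord0 i + 2^-1))%:~R).
  have /andP[] := Num.Theory.floor_itv (xi ord0 i + 2^-1).
  by rewrite rmorphD /= => h1 h2; rewrite ler_norml; apply/andP; split; lra.
by rewrite !mxE rmorphB rmorphD /= -!pmulrn; ring.
Qed.

Let MR0 : 0 < M%:R :> R. Proof. by rewrite ltr0n. Qed.

Lemma offset_small xi t i : `|offset xi t ord0 i / M%:R| <= 2^-1.
Proof.
have [th th2 ->] := offsetE xi t i.
rewrite normrM [`|h|]ger0_norm ?invr_ge0// ler_pdivrMr//.
have tm : (t i)%:R <= (2 * m%:R : R).
  by rewrite -natrM ler_nat mul2n -ltnS.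
have t0 : 0 <= (t i)%:R :> R by [].
have -> : M%:R = 2 * m%:R + 1 :> R by rewrite -natr1 -mul2n natrM.
move: th2; rewrite !ler_norml => /andP[h1 h2]; apply/andP; split; lra.
Qed.

Lemma ec_neq1 (u : R) : u != 0 -> `|u| < 1 -> ec u != 1.
Proof.
move=> u0 u1; rewrite -subr_eq0; apply/eqP => /(congr1 (@normc R)).
rewrite normc0 normc_ec_sub1 => /eqP; rewrite mulf_eq0 pnatr_eq0/= normr_eq0.
have pi0 := @pi_gt0 R; apply/negP.
have h : 0 < sin (pi * `|u|).
  by apply: sin_gt0_pi; rewrite mulr_gt0 ?normr_gt0//= gtr_pMr.
have [u_ge|u_lt] := ger0P u; first by rewrite -(ger0_norm u_ge) gt_eqF.
by rewrite -[u]opprK -(ltr0_norm u_lt) mulrN sinN oppr_eq0 gt_eqF.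
Qed.

(** A geometric sum over [M] consecutive powers of an [M]-th root of unity other
    than [1]. *)
Lemma geometric_ec_eq0 (n1 n2 : nat) : n1 != n2 ->
  (n1 < n2 + M)%N -> (n2 < n1 + M)%N ->
  \sum_(t < M) ec ((n1%:R - n2%:R) / M%:R * (t : nat)%:R) = 0 :> R[i].
Proof.
move=> n12 nM1 nM2; set u := (n1%:R - n2%:R) / M%:R.
have u1 : ec u != 1.
  apply: ec_neq1.
    by rewrite mulf_eq0 negb_or invr_eq0 (lt0r_neq0 MR0) subr_eq0 eqr_nat n12.
  rewrite normrM [`|h|]ger0_norm ?invr_ge0// ltr_pdivrMr// mul1r.
  move: nM1 nM2; rewrite -!(ltr_nat R) !natrD => h1 h2.
  by rewrite ltr_norml; apply/andP; split; lra.
have := subrX1 (ec u) M; rewrite -ec_mulrn divfK ?lt0r_neq0//.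
have -> : ec (n1%:R - n2%:R) = 1 :> R[i].
  by rewrite !pmulrn -rmorphB ec_int.
rewrite subrr => /esym/eqP; rewrite mulf_eq0 subr_eq0 (negbTE u1) /= => /eqP E.
rewrite -[RHS]E; by apply: eq_bigr => t _; rewrite ec_mulrn.
Qed.

Lemma sum_window xi (y : 'rV[R]_d) :
  \sum_t ec (dot (intR (window xi t)) y) =
  \prod_i \sum_(s < M) ec ((Num.floor (xi ord0 i + 2^-1) - m%:Z)%:~R * y ord0 i)
    * ec (y ord0 i * (s : nat)%:R).
Proof.
rewrite bigA_distr_bigA; apply: eq_bigr => t _; rewrite /dot ec_sum.
apply: eq_bigr => i _; rewrite -ecD !mxE; congr ec.
by rewrite !rmorphB rmorphD /= -!pmulrn; ring.
Qed.

(** Two grid points with indices in [1 .. M] that differ in some coordinate give a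
    vanishing geometric factor in that coordinate; the remaining points of the
    padded grid are killed by [g]. *)
Lemma window_orthogonal g xi p p0 : (forall i, vanish_at i g) ->
  (forall i, 0 < p0 i)%N -> p != p0 ->
  (g (gridpt p))%:C%C *
    \sum_t ec (dot (intR (window xi t)) (gridpt p0 - gridpt p)) = 0 :> R[i].
Proof.
move=> gv p00 pp0; have [->|gp] := eqVneq (g (gridpt p)) 0; first by rewrite mul0r.
have [i pi0] : exists i, p i != p0 i.
  apply/existsP; rewrite -negb_forall; apply: contra pp0 => /forallP pE.
  by apply/eqP/ffunP => i; apply/eqP.
have : 0 < (gridpt p : 'rV[R]_d) ord0 i < 1.
  by apply: contra_neqT gp => /gv.
rewrite mxE pmulr_lgt0 ?invr_gt0// subr_gt0 ltr_pdivrMr// mul1r ltrBlDr natr1.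
rewrite ltr1n ltr_nat => /andP[p1 pM].
rewrite sum_window (bigD1 i)//= -mulr_sumr.
under [in X in _ * X * _]eq_bigr do
  rewrite !mxE -mulrBl opprD addrACA opprK addNr addr0.
rewrite geometric_ec_eq0 ?mulr0 ?mul0r ?mulr0//.
- by rewrite eq_sym.
- rewrite (leq_trans (ltn_ord (p0 i)))//.
  by apply: leq_trans (leq_add p1 (leqnn M)); rewrite add2n.
- exact: leq_trans pM (leq_add (p00 i) (leqnn M)).
Qed.

(** Orthogonality of characters on the grid: the trigonometric polynomial with
    the discrete Fourier coefficients of [g] modulated by [ec (dot xi _)]
    takes the same values as that function at the grid points. *)
Lemma interpolation g xi p0 : (forall i, vanish_at i g) ->
  (forall i, 0 < p0 i)%N ->
  \sum_t gridcoef M g (offset xi t) * ec (dot (intR (window xi t)) (gridpt p0))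
  = (g (gridpt p0))%:C%C * ec (dot xi (gridpt p0)).
Proof.
move=> gv p00.
transitivity (\sum_(p : {ffun 'I_d -> 'I_M.+2}) (M%:R^-1 ^+ d)%:C%C * ec (dot xi (gridpt p)) *
   ((g (gridpt p))%:C%C *
    \sum_t ec (dot (intR (window xi t)) (gridpt p0 - gridpt p)))).
  under [RHS]eq_bigr do rewrite !mulr_sumr.
  rewrite exchange_big /=; apply: eq_bigr => t _.
  rewrite /gridcoef /gridsum mulr_sumr mulr_suml; apply: eq_bigr => p _.
  rewrite /offset dotBl dotBr [ec (dot xi _ - _)]ecD [ec (_ - dot _ (gridpt p))]ecD.
  by ring.
rewrite (bigD1 p0)//= [X in _ + X]big1 ?addr0; last first.
  by move=> p pp0; rewrite window_orthogonal ?mulr0.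
rewrite subrr.
have -> : \sum_t ec (dot (intR (window xi t)) 0) = (M ^ d)%:R :> R[i].
  under eq_bigr do rewrite dot0r ec0.
  by rewrite sumr_const card_ffun !card_ord.
rewrite natrX -(rmorph_nat (real_complex R)) -rmorphXn /= mulrCA.
rewrite -!mulrA [X in _ * X]mulrCA -rmorphM/= -exprMn mulVf ?lt0r_neq0//.
by rewrite expr1n mulr1 mulrC.
Qed.

(** Summation by parts, two derivatives in each coordinate: the coefficient of
    [Lops g] is that of [g] times [\prod_i Lmul M (eta_i)]. *)
Lemma gridcoef_decay g (eta : 'rV[R]_d) (C : R) : (forall i, vanish_at i g) ->
  (forall x, `|Lops M (enum 'I_d) g x| <= C) ->
  (forall i, `|eta ord0 i / M%:R| <= 2^-1) ->
  normc (gridcoef M g eta) <= C * 3 ^+ d * \prod_i (1 + 4 * eta ord0 i ^+ 2)^-1.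
Proof.
move=> gv gC eta2.
have P0 : 0 < \prod_i (1 + 4 * eta ord0 i ^+ 2).
  by apply: prodr_gt0 => i _; rewrite ltr_pwDl// mulr_ge0// sqr_ge0.
rewrite prodfV ler_pdivlMr//.
have C0 : 0 <= C by apply: le_trans (gC 0).
have Lle : \prod_i (1 + 4 * eta ord0 i ^+ 2) <= \prod_i Lmul M (eta ord0 i).
  apply: ler_prod => i _; rewrite Lmul_ge// andbT addr_ge0// mulr_ge0//.
  exact: sqr_ge0.
apply: le_trans (ler_wpM2l (normc_ge0 _) Lle) _.
have -> : normc (gridcoef M g eta) * \prod_i Lmul M (eta ord0 i) =
    normc (gridcoef M (Lops M (enum 'I_d) g) eta).
  rewrite /gridcoef gridsum_Lops// ?enum_uniq// !normcM !normc_real mulrCA mulrC.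
  congr (_ * _); rewrite big_enum/= ger0_norm//; apply: prodr_ge0 => i _.
  by rewrite (le_trans _ (Lmul_ge _ (eta2 i)))// addr_ge0// mulr_ge0// sqr_ge0.
apply: le_trans (normc_gridcoef_le _ _ _) _ => //.
(* the padded grid has [(M + 2) ^ d <= (3 M) ^ d] points *)
have -> : C * 3 ^+ d = M%:R^-1 ^+ d * (C * (3 * M%:R) ^+ d).
  by rewrite mulrCA -exprMn [M%:R^-1 * _]mulrCA mulVf ?mulr1// lt0r_neq0.
apply: ler_wpM2l; first by rewrite exprn_ge0 ?invr_ge0.
apply: le_trans (ler_sum _ (fun p _ => gC (gridpt p))) _.
rewrite sumr_const card_ffun !card_ord -[leLHS]mulr_natr natrX; apply: ler_wpM2l => //.
by apply: lerXn2r; rewrite ?nnegrE// -natrM ler_nat mulnS mulnC; lia.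
Qed.

(** [min 1 u <= u ^ kappa]: the trivial bound and the Lipschitz bound together give
    a Holder bound, at which the coefficients are still summable. *)
Lemma min2_powR (kappa u z : R) : 0 < kappa <= 1 -> 0 <= u ->
  z <= u * (2 * pi) -> z <= 2 -> z <= 2 * pi * u `^ kappa.
Proof.
move=> /andP[k0 k1] u0 zu z2; have pi2 := @pi_ge2 R.
have [u1|u1] := lerP u 1; last first.
  apply: (le_trans z2); have : 1 <= u `^ kappa.
    by rewrite -(powRr0 u); apply: ler_powR => //; exact: ltW.
  move=> H; rewrite -mulrA ler_peMr// -[leLHS]mulr1 ler_pM//; lra.
apply: (le_trans zu); rewrite mulrC ler_wpM2l//; first by rewrite mulr_ge0//; lra.
move: u0; rewrite le_eqVlt => /orP[/eqP<-|u0]; first exact: powR_ge0.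
by apply: ger1_powR => //; rewrite u0 u1.
Qed.

Lemma ec_offset_near (eta x x0 : 'rV[R]_d) (kappa : R) : 0 < kappa <= 1 ->
  (forall i, `|x ord0 i - x0 ord0 i| <= h) ->
  normc (ec (- dot eta x) - ec (- dot eta x0)) <=
  2 * pi * (wt kappa eta * M%:R `^ (- kappa)).
Proof.
move=> k01 xx0; rewrite /wt.
have P0 : 0 <= \prod_i (1 + `|eta ord0 i|).
  by apply: prodr_ge0 => i _; rewrite addr_ge0.
have Mk : M%:R `^ (- kappa) = h `^ kappa by rewrite -powR_inv1// -powRrM mulN1r.
rewrite Mk -powRM ?invr_ge0//; apply: min2_powR => //.
- by rewrite mulr_ge0 ?invr_ge0.
- apply: (le_trans (normc_ec_sub_le _ _)); rewrite mulrC ler_wpM2r//.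
    by have := @pi_ge2 R; lra.
  rewrite opprK addrC -dotBr.
  apply: (@le_trans _ _ ((\sum_i `|eta ord0 i|) * h)).
    rewrite mulr_suml; apply: le_trans (ler_norm_sum _ _ _) _.
    apply: ler_sum => i _; rewrite normrM ler_wpM2l//.
    by rewrite !mxE distrC.
  rewrite ler_wpM2r ?invr_ge0//.
  by apply: le_trans (sum_le_prod _ _) => //; rewrite lerDr.
- exact: normc_ec_sub_le2.
Qed.

Lemma nearby_gridpt (x : 'rV[R]_d) : cube x ->
  exists2 p0 : {ffun 'I_d -> 'I_M.+2}, (forall i, 0 < p0 i)%N &
    forall i, `|x ord0 i - gridpt p0 ord0 i| <= h.
Proof.
move=> cx; exists [ffun i => inord (Num.truncn (x ord0 i * M%:R)).+1] => i.
  rewrite ffunE inordK// ltnS ltnS -(ler_nat R); have /andP[x0 x1] := cx i.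
  apply: (@le_trans _ _ (x ord0 i * M%:R)); last by rewrite ler_piMl.
  by rewrite Num.Theory.truncn_le mulr_ge0.
rewrite mxE ffunE inordK; last first.
  rewrite ltnS ltnS -(ler_nat R); have /andP[x0 x1] := cx i.
  by rewrite (@le_trans _ _ (x ord0 i * M%:R))// ?Num.Theory.truncn_le ?mulr_ge0// ler_piMl.
have /andP[x0 x1] := cx i.
have /Num.Theory.truncn_itv/andP[h1 h2] : 0 <= x ord0 i * M%:R by rewrite mulr_ge0.
rewrite -[in X in X - _](mulfK (lt0r_neq0 MR0) (x ord0 i)) -mulrBl normrM.
rewrite [`|h|]ger0_norm ?invr_ge0// ler_piMl ?invr_ge0//.
move: h1 h2; set y := x ord0 i * M%:R.
have -> : (Num.truncn y).+1%:R = (Num.truncn y)%:R + 1 :> R by rewrite natr1.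
by move=> h1 h2; rewrite addrK ler_norml; apply/andP; split; lra.
Qed.

(** Between grid points, compare with the nearest one: the factor
    [ec (dot xi x)] is pulled out, so that only the bounded offsets from [xi],
    and not the frequencies themselves, matter. *)
Lemma window_approx g xi (kappa B w : R) (x : 'rV[R]_d) : 0 < kappa <= 1 ->
  (forall i, vanish_at i g) ->
  (forall x x' : 'rV[R]_d, (forall i, `|x ord0 i - x' ord0 i| <= h) ->
     `|g x - g x'| <= w) ->
  \sum_t normc (gridcoef M g (offset xi t)) * wt kappa (offset xi t) <= B ->
  cube x ->
  normc ((g x)%:C%C * ec (dot xi x) -
    \sum_t gridcoef M g (offset xi t) * ec (dot (intR (window xi t)) x))
  <= w + 2 * pi * B * M%:R `^ (- kappa).
Proof.
move=> k01 gv gw gB cx; have [p0 p00 xp0] := nearby_gridpt cx.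
set x0 : 'rV[R]_d := gridpt p0.
have wE y t : ec (dot (intR (window xi t)) y) =
    ec (dot xi y) * ec (- dot (offset xi t) y).
  by rewrite -ecD /offset dotBl; congr ec; ring.
have fE y : \sum_t gridcoef M g (offset xi t) * ec (dot (intR (window xi t)) y) =
    ec (dot xi y) * \sum_t gridcoef M g (offset xi t) * ec (- dot (offset xi t) y).
  by rewrite mulr_sumr; apply: eq_bigr => t _; rewrite wE mulrCA.
have g0 : (g x0)%:C%C =
    \sum_t gridcoef M g (offset xi t) * ec (- dot (offset xi t) x0).
  have := interpolation xi gv p00; rewrite fE mulrC => /mulIf H; symmetry; apply: H.
  by apply/eqP => /(congr1 (@normc R)) /eqP; rewrite normc_ec normc0 oner_eq0.
rewrite fE mulrC -mulrBr normcM normc_ec mul1r.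
have -> : (g x)%:C%C = (g x - g x0)%:C%C + (g x0)%:C%C.
  by rewrite -rmorphD /= subrK.
rewrite -addrA; apply: le_trans (le_normcD _ _) _; apply: lerD.
  by rewrite normc_real; apply: gw.
rewrite g0 -sumrB; apply: le_trans (normc_sum _ _ _) _.
apply: (@le_trans _ _ (\sum_t normc (gridcoef M g (offset xi t)) *
    (2 * pi * (wt kappa (offset xi t) * M%:R `^ (- kappa))))).
  apply: ler_sum => t _; rewrite -mulrBr normcM ler_wpM2l ?normc_ge0//.
  by rewrite normc_distC; exact: ec_offset_near.
have pi0 := @pi_ge0 R.
rewrite (_ : \sum_t _ = 2 * pi * (\sum_t normc (gridcoef M g (offset xi t)) *
    wt kappa (offset xi t)) * M%:R `^ (- kappa)); last first.
  by rewrite mulr_sumr mulr_suml; apply: eq_bigr => t _; ring.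
by rewrite ler_wpM2r ?powR_ge0// ler_wpM2l// mulr_ge0.
Qed.

End interpolation.

(** * Sums of negative powers *)

Section summation.
Context {R : realType}.

Lemma powRN_le (a x y : R) : 0 < x -> x <= y -> 0 <= a ->
  y `^ (- a) <= x `^ (- a).
Proof.
move=> x0 xy a0; have y0 := lt_le_trans x0 xy.
rewrite !powRN lef_pV2 ?posrE ?powR_gt0//.
by apply: ge0_ler_powR => //; rewrite nnegrE ltW.
Qed.

(** Makes the sum of [x ^ (- 1 - kappa)] dominated by a telescoping one. It follows
    from [ln (x / (x + 1)) <= - 1 / (x + 1)] and [exp t >= 1 + t]. *)
Lemma powR_diff_ge (kappa x : R) : 0 < kappa -> 0 < x ->
  kappa * (x + 1) `^ (- (1 + kappa)) <= x `^ (- kappa) - (x + 1) `^ (- kappa).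
Proof.
move=> k0 x0; have x10 : 0 < x + 1 by rewrite addr_gt0.
set r := x / (x + 1); have r0 : 0 < r by rewrite divr_gt0.
have -> : x `^ (- kappa) = (x + 1) `^ (- kappa) * r `^ (- kappa).
  by rewrite -powRM ?ltW// /r mulrC divfK ?gt_eqF.
have -> : (x + 1) `^ (- (1 + kappa)) = (x + 1) `^ (- kappa) * (x + 1)^-1.
  rewrite opprD powRD; last by apply/implyP => _; rewrite gt_eqF.
  by rewrite powR_inv1 ?ltW// mulrC.
rewrite mulrCA -[X in _ - X]mulr1 -mulrBr ler_wpM2l ?powR_ge0//.
rewrite lerBrDl /powR gt_eqF//; apply: le_trans (expR_ge1Dx _).
rewrite lerD2l mulNr -mulrN ler_pM2l// lerNr.
have -> : - (x + 1)^-1 = r - 1 by rewrite /r; field; rewrite gt_eqF.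
have : ln (1 + (r - 1)) <= r - 1 by apply: le_ln1Dx; lra.
by rewrite addrCA subrr addr0.
Qed.

Lemma p_series_le (kappa : R) (n : nat) : 0 < kappa ->
  \sum_(j < n) (j.+1)%:R `^ (- (1 + kappa)) <= 1 + kappa^-1.
Proof.
move=> k0; case: n => [|n].
  by rewrite big_ord0 addr_ge0// invr_ge0 ltW.
suff H : \sum_(j < n.+1) (j.+1)%:R `^ (- (1 + kappa)) <=
    1 + kappa^-1 - kappa^-1 * n.+1%:R `^ (- kappa).
  by rewrite (le_trans H)// gerBl mulr_ge0 ?powR_ge0// invr_ge0 ltW.
elim: n => [|n IH].
  by rewrite big_ord_recr big_ord0 /= !powR1 add0r mulr1 addrK.
rewrite big_ord_recr /=; apply: (le_trans (lerD IH (lexx _))).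
have := @powR_diff_ge kappa n.+1%:R k0; rewrite natr1 ltr0n => /(_ isT).
rewrite -ler_pdivlMl// mulrBr => H; lra.
Qed.

Lemma p_series_le2 (kappa : R) (m : nat) : 0 < kappa ->
  \sum_(s < m.*2.+1) (1 + `|m%:R - (s : nat)%:R|) `^ (- (1 + kappa))
  <= 2 * (1 + kappa^-1).
Proof.
move=> k0; pose f (s : nat) : R := (1 + `|m%:R - s%:R|) `^ (- (1 + kappa)).
rewrite -(big_mkord xpredT f) -addnn -addSn (big_cat_nat (n := m.+1))//=; last first.
  by rewrite addSn ltnS leq_addr.
rewrite mulr_natl mulr2n; apply: lerD.
  rewrite big_mkord (reindex_inj rev_ord_inj) /=; apply: le_trans (p_series_le m.+1 k0).
  apply: ler_sum => s _; rewrite /f subSS natrB ?leq_ord//.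
  by rewrite opprB addrCA subrr addr0 ger0_norm// addrC natr1.
rewrite -[X in \sum_(X <= _ < _) _]add0n big_addn addSn subSS addnK big_mkord.
apply: le_trans (p_series_le m k0); apply: ler_sum => s _; rewrite /f.
have -> : `|m%:R - (s + m.+1)%:R| = s.+1%:R :> R.
  have -> : (s + m.+1)%:R = s.+1%:R + m%:R :> R by rewrite -natrD addnS addSn.
  by rewrite distrC addrK ger0_norm.
by apply: powRN_le => //; rewrite ?ltr0n ?lerDr// addr_ge0// ltW.
Qed.

End summation.

(** * Approximation by trigonometric polynomials *)

Section decay.
Context {R : realType} {d : nat}.

Lemma wtE (kappa : R) (x : 'rV[R]_d) :
  wt kappa x = \prod_i (1 + `|x ord0 i|) `^ kappa.
Proof.
rewrite /wt.
pose P (a b : R) := 0 <= a /\ a `^ kappa = b.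
suff [] : P (\prod_i (1 + `|x ord0 i|)) (\prod_i (1 + `|x ord0 i|) `^ kappa) by [].
elim/big_ind2 : _ => [|a b c e [a0 <-] [c0 <-]|i _].
- by split; rewrite ?powR1.
- by split; [exact: mulr_ge0|exact: powRM].
- by split => //; rewrite addr_ge0.
Qed.

(** Two derivatives give the decay [e ^ - 2]. The weight takes back at most half a
    power, which leaves the summable exponent [- 3 / 2]. *)
Lemma decay_weight (kappa th : R) (m s : nat) : kappa <= 2^-1 -> `|th| <= 2^-1 ->
  (1 + 4 * (th + (m%:R - s%:R)) ^+ 2)^-1 * (1 + `|th + (m%:R - s%:R)|) `^ kappa
  <= 8 * (1 + `|m%:R - s%:R|) `^ (- (1 + 2^-1)).
Proof.
move=> k2 th2; set e := th + _; set u : R := m%:R - s%:R.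
have e1 : 1 <= 1 + `|e| by rewrite lerDl.
have e0 : 0 < 1 + `|e| by rewrite ltr_pwDl.
apply: (@le_trans _ _ ((1 + 4 * e ^+ 2)^-1 * (1 + `|e|) `^ 2^-1)).
  apply: ler_wpM2l; last exact: ler_powR.
  by rewrite invr_ge0 addr_ge0// mulr_ge0// sqr_ge0.
have -> : (1 + `|e|) `^ 2^-1 = (1 + `|e|) ^+ 2 * (1 + `|e|) `^ (- (1 + 2^-1)).
  rewrite -powR_mulrn ?ltW// -powRD; last by apply/implyP => _; rewrite gt_eqF.
  by congr (_ `^ _); field.
rewrite mulrA.
have h1 : (1 + 4 * e ^+ 2)^-1 * (1 + `|e|) ^+ 2 <= 2.
  rewrite mulrC ler_pdivrMr; last by rewrite ltr_pwDl// mulr_ge0// sqr_ge0.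
  have := sqr_ge0 (1 - `|e|); have : `|e| ^+ 2 = e ^+ 2 by rewrite real_normK ?num_real.
  move: (`|e|) => a <-; have := sqr_ge0 a; rewrite !expr2; lra.
apply: (le_trans (ler_wpM2r (powR_ge0 _ _) h1)).
rewrite (_ : 8 = 2 * 4 :> R); last by rewrite -natrM.
rewrite -mulrA ler_wpM2l//.
have h2 : (1 + `|u|) / 2 <= 1 + `|e|.
  have : `|u| <= `|e| + `|th|.
    by have -> : u = e - th by [rewrite /e addrC addKr]; exact: ler_normB.
  have := normr_ge0 u; lra.
apply: (@le_trans _ _ (((1 + `|u|) / 2) `^ (- (1 + 2^-1)))).
  by apply: powRN_le => //; rewrite divr_gt0// ltr_pwDl.
rewrite powRM ?invr_ge0// ?addr_ge0// mulrC ler_wpM2r ?powR_ge0//.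
rewrite -[X in X `^ _]powR_inv1// -powRrM mulN1r opprK.
apply: (@le_trans _ _ (2 `^ 2%:R)); first by apply: ler_powR => //; lra.
by rewrite powR_mulrn// -natrX.
Qed.

Lemma window_sum_le (m : nat) (xi : 'rV[R]_d) (kappa : R) :
  0 < kappa <= 2^-1 ->
  \sum_(t : {ffun 'I_d -> 'I_m.*2.+1})
    (\prod_i (1 + 4 * offset xi t ord0 i ^+ 2)^-1) * wt kappa (offset xi t)
  <= 48 ^+ d.
Proof.
move=> /andP[k0 k2].
pose th i : R := xi ord0 i - (Num.floor (xi ord0 i + 2^-1))%:~R.
have offE t i : @offset R d m xi t ord0 i = th i + (m%:R - (t i : nat)%:R).
  by rewrite !mxE /th rmorphB rmorphD /= -!pmulrn; ring.
have th2 i : `|th i| <= 2^-1.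
  have /andP[] := Num.Theory.floor_itv (xi ord0 i + 2^-1).
  by rewrite rmorphD /= /th => h1 h2; rewrite ler_norml; apply/andP; split; lra.
(* each coordinate contributes [8] times a sum bounded by [2 * (1 + 2)] *)
pose F (i : 'I_d) (s : 'I_m.*2.+1) : R := 8 * (1 + `|m%:R - (s : nat)%:R|) `^ (- (1 + 2^-1)).
apply: (@le_trans _ _ (\sum_(t : {ffun 'I_d -> 'I_m.*2.+1}) \prod_i F i (t i))).
  apply: ler_sum => t _; rewrite wtE -big_split/=; apply: ler_prod => i _.
  rewrite !offE decay_weight// andbT mulr_ge0 ?powR_ge0// invr_ge0.
  by rewrite addr_ge0// mulr_ge0// sqr_ge0.
rewrite -bigA_distr_bigA.
apply: (@le_trans _ _ (\prod_(i < d) 48)); last by rewrite prodr_const card_ord.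
apply: ler_prod => i _; rewrite sumr_ge0 => [/=|s _]; last by rewrite mulr_ge0// powR_ge0.
rewrite -mulr_sumr.
have := @p_series_le2 R 2^-1 m; rewrite invr_gt0 ltr0n => /(_ isT) H.
apply: (le_trans (ler_wpM2l _ H)) => //; rewrite invrK; lra.
Qed.

End decay.

Section trig_approx.
Context {R : realType} {d : nat}.
Implicit Types (F : 'rV[R]_d -> R[i]) (s : seq (R[i] * 'rV[int]_d)).

Definition tpoly s (x : 'rV[R]_d) : R[i] :=
  \sum_(q <- s) q.1 * ec (dot (intR q.2) x).

Definition tnorm (kappa : R) s : R :=
  \sum_(q <- s) normc q.1 * wt kappa (@intR R d q.2).

(** Uniform distribution speaks of integer frequencies only, and allows a factor
    [|k| ^ kappa] there; functions of this class inherit its rate with constant [B].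
    A uniform limit of finite sums replaces an absolutely convergent Fourier
    series. *)
Definition trig_approx (kappa B : R) F := forall eta : R, 0 < eta ->
  exists2 s, tnorm kappa s <= B &
    forall x, cube x -> normc (F x - tpoly s x) <= eta.

Lemma trig_approx_ge0 kappa B F : trig_approx kappa B F -> 0 <= B.
Proof.
move=> /(_ 1 ltr01)[s + _]; apply: le_trans; apply: sumr_ge0 => q _.
by rewrite mulr_ge0 ?normc_ge0 ?wt_ge0.
Qed.

Lemma trig_approx_le kappa B B' F : B <= B' -> trig_approx kappa B F ->
  trig_approx kappa B' F.
Proof.
by move=> BB' FB eta /FB[s sB Fs]; exists s => //; exact: le_trans BB'.
Qed.

Lemma trig_approx_cst0 kappa : trig_approx kappa 0 (fun=> 0).
Proof.
move=> eta eta0; exists [::]; first by rewrite /tnorm big_nil.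
by move=> x _; rewrite /tpoly big_nil subr0 normc0 ltW.
Qed.

Lemma trig_approxD kappa B1 B2 F1 F2 : trig_approx kappa B1 F1 ->
  trig_approx kappa B2 F2 -> trig_approx kappa (B1 + B2) (fun x => F1 x + F2 x).
Proof.
move=> F1B F2B eta eta0; have e2 : 0 < eta / 2 by rewrite divr_gt0.
have [s1 s1B F1s] := F1B _ e2; have [s2 s2B F2s] := F2B _ e2.
exists (s1 ++ s2); first by rewrite /tnorm big_cat lerD.
move=> x cx; rewrite /tpoly big_cat/= opprD addrACA.
apply: (le_trans (le_normcD _ _)).
by have := F1s x cx; have := F2s x cx; rewrite /tpoly; lra.
Qed.

Lemma trig_approxZ kappa B (c : R[i]) F : trig_approx kappa B F ->
  trig_approx kappa (normc c * B) (fun x => c * F x).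
Proof.
move=> FB eta eta0; have c1 : 0 < 1 + normc c by rewrite ltr_pwDl ?normc_ge0.
have e2 : 0 < eta / (1 + normc c) by rewrite divr_gt0.
have [s sB Fs] := FB _ e2; exists [seq (c * q.1, q.2) | q <- s].
  rewrite /tnorm big_map /= (eq_bigr (fun q => normc c * (normc q.1 * wt kappa (intR q.2)))).
    by rewrite -mulr_sumr ler_wpM2l ?normc_ge0.
  by move=> q _; rewrite normcM mulrA.
move=> x cx; rewrite /tpoly big_map /=.
under eq_bigr do rewrite -mulrA.
rewrite -mulr_sumr -mulrBr normcM.
apply: (le_trans (ler_wpM2l (normc_ge0 _) (Fs x cx))).
rewrite mulrC mulrAC ler_pdivrMr// ler_pM2l// lerDr//.
Qed.

Lemma trig_approx_sum kappa (I : Type) (r : seq I) (a : I -> R[i])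
    (B : I -> R) (F : I -> 'rV[R]_d -> R[i]) :
  (forall i, trig_approx kappa (B i) (F i)) ->
  trig_approx kappa (\sum_(i <- r) normc (a i) * B i)
    (fun x => \sum_(i <- r) a i * F i x).
Proof.
move=> FB; elim: r => [|i r IH].
  rewrite (_ : (fun x => _) = fun=> 0); last by apply/funext => x; rewrite big_nil.
  by rewrite big_nil; exact: trig_approx_cst0.
rewrite (_ : (fun x => _) = fun x => a i * F i x + \sum_(j <- r) a j * F j x).
  by rewrite big_cons; apply: trig_approxD IH; exact: trig_approxZ.
by apply/funext => x; rewrite big_cons.
Qed.

Lemma trig_approx_lim kappa B F :
  (forall eta, 0 < eta -> exists2 G, trig_approx kappa B G &
     forall x, cube x -> normc (F x - G x) <= eta) ->
  trig_approx kappa B F.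
Proof.
move=> FG eta eta0; have e2 : 0 < eta / 2 by rewrite divr_gt0.
have [G GB FGe] := FG _ e2; have [s sB Gs] := GB _ e2; exists s => // x cx.
rewrite -(subrK (G x) (F x)) -addrA; apply: (le_trans (le_normcD _ _)).
by have := FGe x cx; have := Gs x cx; lra.
Qed.

End trig_approx.

Section modulated.
Context {R : realType} {d : nat}.
Implicit Types (g : 'rV[R]_d -> R).

(** What the proof needs of a cut-off function. Each [Lop] costs two
    derivatives in one coordinate, so the bound on [Lops] is one on the mixed
    differences of order two in every coordinate. *)
Record cutoff (C : R) g : Prop := Cutoff {
  cutoff_vanish : forall i, vanish_at i g ;
  cutoff_bound : forall x, `|g x| <= C ;
  cutoff_Lops : forall M x, (0 < M)%N -> `|Lops M (enum 'I_d) g x| <= C ;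
  cutoff_lip : forall (x x' : 'rV[R]_d) (r : R), 0 <= r ->
    (forall i, `|x ord0 i - x' ord0 i| <= r) -> `|g x - g x'| <= C * r }.

Lemma powRN_small (K kappa eta : R) : 0 < kappa -> 0 < eta ->
  exists2 n0 : nat, (0 < n0)%N &
    forall n, (n0 <= n)%N -> K * n%:R `^ (- kappa) <= eta.
Proof.
move=> k0 eta0; have [K0|K0] := lerP K 0.
  exists 1 => // n _; apply: le_trans (ltW eta0).
  by rewrite mulr_le0_ge0// powR_ge0.
have Ke : 0 < K / eta by rewrite divr_gt0.
exists (Num.truncn ((K / eta) `^ kappa^-1)).+1 => // n nn0.
have n1 : (K / eta) `^ kappa^-1 <= n%:R.
  have /Num.Theory.truncn_itv/andP[_ /ltW h] := powR_ge0 (K / eta) kappa^-1.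
  by apply: (le_trans h); rewrite ler_nat.
have n0 : 0 < n%:R :> R by apply: lt_le_trans n1; rewrite powR_gt0.
rewrite powRN ler_pdivrMr ?powR_gt0// mulrC -ler_pdivrMr//.
have -> : K / eta = ((K / eta) `^ kappa^-1) `^ kappa.
  by rewrite -powRrM mulVf ?gt_eqF// powRr1// ltW.
by apply: ge0_ler_powR; rewrite ?nnegrE ?powR_ge0// ltW.
Qed.

(** [B] is the same for all real frequencies [xi]: the integer frequencies used are
    the [xi - offset], the coefficients decay in the offset, and [wt] is
    submultiplicative. Letting the grid get finer gives the approximation. *)
Lemma trig_approx_modulated C g : cutoff C g -> exists2 B : R, 0 <= B &
  forall (kappa : R) (xi : 'rV[R]_d), 0 < kappa <= 2^-1 ->
  trig_approx kappa (B * wt kappa xi)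
    (fun x => (g x)%:C%C * ec (dot xi x)).
Proof.
case=> gv gC gL glip; have C0 : 0 <= C by apply: le_trans (gC 0).
pose B := C * 3 ^+ d * 48 ^+ d; have B0 : 0 <= B by rewrite !mulr_ge0 ?exprn_ge0.
exists B => // kappa xi /[dup] k012 /andP[k0 k2] eta eta0.
have k1 : kappa <= 1 by apply: (le_trans k2); lra.
have [n0 _ n0P] := powRN_small (C + 2 * pi * B) k0 eta0.
pose M := n0.*2.+1; pose c (t : {ffun 'I_d -> 'I_M}) := gridcoef M g (offset xi t).
have cB : \sum_t normc (c t) * wt kappa (offset xi t) <= B.
  apply: le_trans (ler_wpM2l _ (window_sum_le n0 xi k012)); last first.
    by rewrite mulr_ge0 ?exprn_ge0.
  rewrite mulr_sumr; apply: ler_sum => t _; rewrite mulrA ler_wpM2r ?wt_ge0//.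
  apply: gridcoef_decay => // [x|i]; first exact: gL.
  exact: offset_small.
exists [seq (c t, window xi t) | t <- index_enum ({ffun 'I_d -> 'I_M} : finType)].
  rewrite /tnorm big_map/=; apply: le_trans (ler_wpM2r (wt_ge0 _ _) cB).
  rewrite mulr_suml; apply: ler_sum => t _; rewrite -mulrA ler_wpM2l ?normc_ge0//.
  have -> : intR (window xi t) = - offset xi t + xi.
    by rewrite /offset opprB subrK.
  by rewrite -[X in _ <= X * _]wtN wtD// ltW.
move=> x cx; rewrite /tpoly big_map/=.
have k01 : 0 < kappa <= 1 by rewrite k0.
have M0 : 0 <= M%:R^-1 :> R by rewrite invr_ge0.
apply: (le_trans (window_approx k01 gv (fun y y' => glip y y' _ M0) cB cx)).
apply: le_trans (n0P M _); last by rewrite /M -addnn -addSn leq_addl.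
rewrite [leRHS]mulrDl lerD2r ler_wpM2l// -powR_inv1//.
by apply: ler_powR; [rewrite ler1n|rewrite lerN2].
Qed.

End modulated.

(** * The trapezoid and its Fourier decay *)

Section clamp.
Context {R : realType}.
Implicit Types s e : R.

Definition clamp01 s : R := Num.max 0 (Num.min 1 s).

Lemma clamp01_ge0 s : 0 <= clamp01 s. Proof. by rewrite le_max lexx. Qed.

Lemma clamp01_le1 s : clamp01 s <= 1.
Proof. by rewrite ge_max ler01 ge_min lexx. Qed.

Lemma clamp01_0 s : s <= 0 -> clamp01 s = 0.
Proof. by move=> s0; apply/max_idPl; rewrite ge_min s0 orbT. Qed.

Lemma clamp01_1 s : 1 <= s -> clamp01 s = 1.
Proof. by move=> s1; rewrite /clamp01 min_l// max_r. Qed.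

Lemma clamp01_id s : 0 <= s <= 1 -> clamp01 s = s.
Proof. by case/andP=> s0 s1; rewrite /clamp01 min_r// max_r. Qed.

Lemma clamp01_homo : {homo clamp01 : x y / x <= y}.
Proof. by move=> x y xy; rewrite le_max2// le_min2. Qed.

Lemma clamp01_posE s : clamp01 s = Num.max 0 s - Num.max 0 (s - 1).
Proof.
have [s0|s0] := lerP s 0.
  by rewrite clamp01_0// !max_l ?subrr//; lra.
have [s1|s1] := lerP s 1.
  by rewrite clamp01_id ?(ltW s0)// max_l ?subr0//; lra.
by rewrite clamp01_1 ?ltW// !max_r//; lra.
Qed.

Lemma clamp01_lip s s' : `|clamp01 s - clamp01 s'| <= `|s - s'|.
Proof.
wlog ss : s s' / s' <= s => [H|].
  by have [/H|/H] := orP (le_total s' s); rewrite // distrC [leRHS]distrC.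
rewrite !ger0_norm ?subr_ge0 ?clamp01_homo//.
have [s0|s0] := lerP s 0.
  by rewrite !clamp01_0 ?subrr ?subr_ge0// (le_trans ss).
have [s1|s1] := lerP 1 s'.
  by rewrite !clamp01_1 ?subrr ?subr_ge0// (le_trans s1).
rewrite /clamp01.
rewrite (_ : Num.min 1 s' = s'); last by rewrite min_r// ltW.
apply: lerB; last by rewrite le_max lexx orbT.
by rewrite ge_max ltW//= ge_min lexx orbT.
Qed.

(** First differences of a monotone function and second differences of a
    convex one have a constant sign, so their sums telescope. *)
Lemma sum_diff_clamp01 s e n : 0 <= e ->
  \sum_(k < n) `|clamp01 (s + k%:R * e + e) - clamp01 (s + k%:R * e)| <= 1.
Proof.
move=> e0; rewrite (eq_bigr (fun k : 'I_n => clamp01 (s + k.+1%:R * e) - clamp01 (s + k%:R * e))).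
  rewrite -(big_mkord xpredT (fun k => clamp01 (s + k.+1%:R * e) - clamp01 (s + k%:R * e))).
  rewrite telescope_sumr//.
  have := clamp01_le1 (s + n%:R * e); have := clamp01_ge0 (s + 0%:R * e); lra.
move=> k _; rewrite -natr1 mulrDl mul1r addrA ger0_norm// subr_ge0.
by apply: clamp01_homo; rewrite lerDl.
Qed.

Let pos s := Num.max 0 s.

Lemma pos_diff s e : 0 <= e -> 0 <= pos (s + e) - pos s <= e.
Proof.
move=> e0; rewrite /pos.
have [s0|s0] := lerP s 0.
  by have [se|se] := lerP (s + e) 0; apply/andP; split; lra.
rewrite max_r; last by lra.
by apply/andP; split; lra.
Qed.

Lemma pos_convex s e : 0 <= pos (s + e) + pos (s - e) - 2 * pos s.
Proof.
have h t : t <= pos t by rewrite le_max lexx orbT.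
have h0 t : 0 <= pos t by rewrite le_max lexx.
rewrite {3}/pos; have [s0|s0] := lerP s 0.
  by rewrite mulr0 subr0 addr_ge0.
by have := h (s + e); have := h (s - e); lra.
Qed.

Lemma sum_convex_pos s e n : 0 <= e ->
  \sum_(k < n) `|pos (s + k%:R * e + e) + pos (s + k%:R * e - e)
                 - 2 * pos (s + k%:R * e)| <= e.
Proof.
move=> e0; pose f k := pos (s + k%:R * e) - pos (s + k%:R * e - e).
rewrite (eq_bigr (fun k : 'I_n => f k.+1 - f k)).
  rewrite -(big_mkord xpredT (fun k => f k.+1 - f k)) telescope_sumr//.
  have /andP[_ h1] := pos_diff (s + n%:R * e - e) e0.
  have /andP[h2 _] := pos_diff (s + 0%:R * e - e) e0.
  by rewrite /f; move: h1 h2; rewrite !subrK; lra.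
move=> k _; rewrite ger0_norm ?pos_convex// /f.
have -> : s + k.+1%:R * e = s + k%:R * e + e.
  by rewrite -natr1 mulrDl mul1r addrA.
by rewrite addrK; ring.
Qed.

Lemma sum_convex_clamp01 s e n : 0 <= e ->
  \sum_(k < n) `|clamp01 (s + k%:R * e + e) + clamp01 (s + k%:R * e - e)
                 - 2 * clamp01 (s + k%:R * e)| <= 2 * e.
Proof.
move=> e0; apply: (@le_trans _ _ (\sum_(k < n)
  (`|pos (s + k%:R * e + e) + pos (s + k%:R * e - e) - 2 * pos (s + k%:R * e)| +
   `|pos (s - 1 + k%:R * e + e) + pos (s - 1 + k%:R * e - e) -
     2 * pos (s - 1 + k%:R * e)|))).
  apply: ler_sum => k _; rewrite !clamp01_posE -!/(pos _).
  have E u : s - 1 + u = s + u - 1 by rewrite addrAC.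
  rewrite E -[in X in _ <= _ + X](addrAC _ e) -[in X in _ <= _ + X](addrAC _ (- e)).
  rewrite -[X in _ <= _ + X]normrN; apply: le_trans (ler_normD _ _).
  by rewrite le_eqVlt; apply/orP; left; apply/eqP; congr `|_|; ring.
by rewrite big_split/= mulr_natl mulr2n; apply: lerD; exact: sum_convex_pos.
Qed.

End clamp.

Section trapezoid_decay.
Context {R : realType}.
Variables (M : nat) (al al' be : R).
Hypotheses (M0 : (0 < M)%N) (be0 : 0 <= be) (al_le : al' <= al).

(** A rise of slope [be] followed by a fall of the same slope. *)
Definition trapez (x : R) : R := clamp01 (al + be * x) - clamp01 (al' + be * x).

Let g (x : 'rV[R]_1) : R := trapez (x ord0 ord0).
Hypothesis gv : forall i, vanish_at i g.

Lemma sum_ffun1 (K : nat) (V : nmodType) (F : {ffun 'I_1 -> 'I_K} -> V) :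
  \sum_p F p = \sum_(k < K) F [ffun=> k].
Proof.
rewrite (reindex (fun k : 'I_K => [ffun=> k])) //.
exists (fun p : {ffun 'I_1 -> 'I_K} => p ord0) => [k _|p _]; first by rewrite ffunE.
by apply/ffunP => i; rewrite ffunE (ord1 i).
Qed.

Lemma trapez_ge0 x : 0 <= trapez x.
Proof. by rewrite subr_ge0 clamp01_homo// lerD2r. Qed.

Lemma trapez_le1 x : trapez x <= 1.
Proof.
rewrite /trapez; have := clamp01_le1 (al + be * x).
by have := clamp01_ge0 (al' + be * x); lra.
Qed.

Let MR0 : 0 < M%:R :> R. Proof. by rewrite ltr0n. Qed.
Let K_le : M.+2%:R <= 3 * M%:R :> R.
Proof. by rewrite -natrM ler_nat; lia. Qed.

Let h : R := M%:R^-1.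
Let e := be * h.
Let e0 : 0 <= e. Proof. by rewrite mulr_ge0// invr_ge0. Qed.

Lemma sum_norm_trapez : \sum_(p : {ffun 'I_1 -> 'I_M.+2}) `|g (gridpt p)| <= 3 * M%:R.
Proof.
rewrite sum_ffun1; apply: (@le_trans _ _ (\sum_(k < M.+2) 1)).
  by apply: ler_sum => k _; rewrite /g ger0_norm ?trapez_ge0 ?trapez_le1.
by rewrite sumr_const card_ord.
Qed.

Lemma sum_diff_trapez : \sum_(p : {ffun 'I_1 -> 'I_M.+2})
  `|g (gridpt p + h *: delta_mx ord0 ord0) - g (gridpt p)| <= 2.
Proof.
rewrite sum_ffun1 (_ : 2 = 1 + 1 :> R)//.
apply: le_trans (lerD (sum_diff_clamp01 (al - e) M.+2 e0)
                      (sum_diff_clamp01 (al' - e) M.+2 e0)).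
rewrite -big_split /=; apply: ler_sum => k _; rewrite /g /trapez !mxE !eqxx /= ffunE.
have E z : z + be * (((k : nat)%:R - 1) / M%:R + h * 1) = z - e + (k : nat)%:R * e + e.
  by rewrite /e /h; ring.
have E0 z : z + be * (((k : nat)%:R - 1) / M%:R) = z - e + (k : nat)%:R * e.
  by rewrite /e /h; ring.
rewrite !E !E0 opprB addrACA -[X in _ <= _ + X]normrN.
apply: le_trans (ler_normD _ _); rewrite le_eqVlt; apply/orP; left; apply/eqP.
by congr `|_|; ring.
Qed.

Lemma sum_Lop_trapez : \sum_(p : {ffun 'I_1 -> 'I_M.+2})
  `|Lop M ord0 g (gridpt p)| <= (3 + 4 * be) * M%:R.
Proof.
apply: (@le_trans _ _ (\sum_(p : {ffun 'I_1 -> 'I_M.+2}) (`|g (gridpt p)| +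
  M%:R ^+ 2 * `|g (gridpt p + h *: delta_mx ord0 ord0) +
                g (gridpt p - h *: delta_mx ord0 ord0) - 2 * g (gridpt p)|))).
  apply: ler_sum => p _; apply: (le_trans (ler_normB _ _)); rewrite lerD2l.
  by rewrite normrM ger0_norm// sqr_ge0.
rewrite big_split /= mulrDl; apply: lerD; first exact: sum_norm_trapez.
rewrite -mulr_sumr; have -> : 4 * be * M%:R = M%:R ^+ 2 * (4 * e).
  by rewrite /e /h; field; exact: lt0r_neq0.
rewrite ler_wpM2l ?sqr_ge0// sum_ffun1.
have -> : 4 * e = 2 * e + 2 * e by ring.
apply: le_trans (lerD (sum_convex_clamp01 (al - e) M.+2 e0)
                      (sum_convex_clamp01 (al' - e) M.+2 e0)).
rewrite -big_split /=; apply: ler_sum => k _; rewrite /g /trapez !mxE !eqxx /= ffunE.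
have E z : z + be * (((k : nat)%:R - 1) / M%:R + h * 1) = z - e + (k : nat)%:R * e + e.
  by rewrite /e /h; ring.
have E1 z : z + be * (((k : nat)%:R - 1) / M%:R - h * 1) = z - e + (k : nat)%:R * e - e.
  by rewrite /e /h; ring.
have E0 z : z + be * (((k : nat)%:R - 1) / M%:R) = z - e + (k : nat)%:R * e.
  by rewrite /e /h; ring.
rewrite !E !E0 !E1 -[X in _ <= _ + X]normrN.
apply: le_trans (ler_normD _ _); rewrite le_eqVlt; apply/orP; left; apply/eqP.
by congr `|_|; ring.
Qed.

(** A first difference multiplies the coefficient by [ec (- eta / M) - 1], of modulus
    at least [2 |eta| / M], and costs the total variation, which is at most [2]
    whatever the slope. *)
Lemma gridcoef_trapez1 (eta : 'rV[R]_1) : `|eta ord0 ord0 / M%:R| <= 2^-1 ->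
  normc (gridcoef M g eta) * (1 + `|eta ord0 ord0|) <= 4.
Proof.
move=> eta2; rewrite mulrDr mulr1 (_ : 4 = 3 + 1 :> R); last by rewrite natr1.
apply: lerD.
  apply: (le_trans (normc_gridcoef_le _ _ _)) => //.
  by rewrite expr1 mulrC ler_pdivrMr// sum_norm_trapez.
have : normc (gridsum M (fun x => g (x + h *: delta_mx ord0 ord0) + - 1 * g x) eta) <= 2.
  apply: (le_trans (normc_gridsum_le _ _ _)) => //; apply: le_trans sum_diff_trapez.
  by apply: ler_sum => p _; rewrite mulN1r.
rewrite gridsumD gridsumZ gridsum_shift// -/h rmorphN rmorph1 -mulrDl normcM.
rewrite normc_ec_sub1 mulrN sinN normrN.
move=> H; rewrite /gridcoef normcM normc_real expr1 ger0_norm ?invr_ge0//.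
have h1 := sin_pi_ge eta2.
have -> : M%:R^-1 * normc (gridsum M g eta) * `|eta ord0 ord0| =
    `|eta ord0 ord0 / M%:R| * normc (gridsum M g eta).
  by rewrite normrM normfV (ger0_norm (ltW MR0)); ring.
have h3 : `|eta ord0 ord0 / M%:R| <= `|sin (pi * (h * eta ord0 ord0))|.
  by rewrite [h * _]mulrC.
have := ler_wpM2r (normc_ge0 (gridsum M g eta)) h3; lra.
Qed.

(** A second difference gains [eta ^ 2] and costs the variation of the slope, which
    is proportional to [be]. *)
Lemma gridcoef_trapez2 (eta : 'rV[R]_1) : `|eta ord0 ord0 / M%:R| <= 2^-1 ->
  normc (gridcoef M g eta) * (1 + `|eta ord0 ord0|) ^+ 2 <= 2 * (3 + 4 * be).
Proof.
move=> eta2; set u := eta ord0 ord0.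
have u0 : 0 <= 1 + 4 * u ^+ 2 by rewrite addr_ge0// mulr_ge0// sqr_ge0.
have h1 : (1 + `|u|) ^+ 2 <= 2 * (1 + 4 * u ^+ 2).
  have := sqr_ge0 (1 - `|u|); have : `|u| ^+ 2 = u ^+ 2 by rewrite real_normK ?num_real.
  by move: (`|u|) => a <-; have := sqr_ge0 a; rewrite !expr2; lra.
apply: (le_trans (ler_wpM2l (normc_ge0 _) h1)); rewrite mulrCA ler_wpM2l//.
have h2 := Lmul_ge M0 eta2.
apply: (le_trans (ler_wpM2l (normc_ge0 _) h2)).
have -> : normc (gridcoef M g eta) * Lmul M u =
    M%:R^-1 * normc (gridsum M (Lop M ord0 g) eta).
  rewrite /gridcoef normcM normc_real expr1 ger0_norm ?invr_ge0//.
  rewrite gridsum_Lop// normcM normc_real ger0_norm 1?mulrAC ?mulrA//.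
  exact: le_trans h2.
rewrite mulrC ler_pdivrMr//; apply: le_trans sum_Lop_trapez.
exact: normc_gridsum_le.
Qed.

End trapezoid_decay.

Section trapezoid_approx.
Context {R : realType}.

Lemma powRV (x r : R) : 0 <= x -> x^-1 `^ r = x `^ (- r).
Proof. by move=> x0; rewrite -powR_inv1// -powRrM mulN1r. Qed.

(** The hypotheses say [z * u <= K1 * min 1 (K2 / u)], and the minimum is at most
    [(K2 / u) ^ (2 kappa)] since [2 kappa <= 1]. *)
Lemma min_interpolation (kappa z u : R) (K1 K2 : R) : 0 < kappa <= 2^-1 ->
  0 < u -> 0 <= K1 -> 0 < K2 -> 0 <= z ->
  z * u <= K1 -> z * u ^+ 2 <= K1 * K2 ->
  z * u `^ kappa <= K1 * K2 `^ (2 * kappa) * u `^ (- (1 + kappa)).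
Proof.
move=> /andP[k0 k2] u0 K10 K20 z0 zu zu2.
suff H : z * u <= K1 * (K2 / u) `^ (2 * kappa).
  have -> : u `^ kappa = u * (u `^ (2 * kappa) * u `^ (- (1 + kappa))).
    rewrite -powRD; last by apply/implyP => _; rewrite gt_eqF.
    rewrite -[X in X * _]powRr1 ?ltW// -powRD; last by apply/implyP => _; rewrite gt_eqF.
    by congr (_ `^ _); ring.
  rewrite mulrA; apply: (le_trans (ler_wpM2r _ H)).
    by rewrite mulr_ge0// powR_ge0.
  have E : (K2 / u) `^ (2 * kappa) * u `^ (2 * kappa) = K2 `^ (2 * kappa).
    by rewrite -powRM ?(ltW u0) ?divr_ge0 ?(ltW u0) ?(ltW K20)// divfK ?gt_eqF.
  by rewrite mulrA -[K1 * (K2 / u) `^ _ * _]mulrA E.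
have r0 : 0 < K2 / u by rewrite divr_gt0.
have [r1|r1] := lerP (K2 / u) 1; last first.
  apply: (le_trans zu); rewrite ler_peMr//.
  rewrite -[leLHS](powRr0 (K2 / u)); apply: ler_powR; first exact: ltW.
  by rewrite mulr_ge0// ltW.
apply: (@le_trans _ _ (K1 * (K2 / u))).
  by rewrite mulrA ler_pdivlMr// -mulrA -expr2.
rewrite ler_wpM2l//; apply: ger1_powR; first by rewrite r0 r1.
lra.
Qed.

(** The indicator of [a, b] with linear ramps of width [delta] outside. *)
Definition trapezoid (a b delta t : R) : R :=
  clamp01 ((t - a) / delta + 1) - clamp01 ((t - b) / delta).

(** The Fourier coefficient at frequency [j] is bounded by both [1 / j] (total
    variation) and [1 / (delta j ^ 2)] (variation of the slope); interpolating
    between the two bounds makes the weighted sum converge at the cost of an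
    arbitrarily small power of [delta]. *)
Lemma trapezoid_approx (D kappa : R) : 0 <= D -> 0 < kappa <= 2^-1 ->
  exists2 C : R, 0 <= C & forall a b delta : R, 0 < delta <= 1 ->
    0 <= a -> a <= b -> b <= D ->
  forall eta : R, 0 < eta -> exists2 s : seq (R[i] * R),
    \sum_(q <- s) normc q.1 * (1 + `|q.2|) `^ kappa <= C * delta `^ (- (2 * kappa)) &
    forall t, 0 <= t <= D ->
      normc ((trapezoid a b delta t)%:C%C - \sum_(q <- s) q.1 * ec (q.2 * t)) <= eta.
Proof.
move=> D0 /[dup] k012 /andP[k0 k2].
(* [x |-> T x - 2] maps [0, 1] to [- 2, D + 2], which contains the support of the
   trapezoid with room for the ramps of width at most [1] *)
pose T := D + 4; have T1 : 1 <= T by rewrite /T; lra.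
have T0 : 0 < T by lra.
pose K0 := 2 * (3 + 4 * T); have K00 : 0 < K0 by rewrite /K0; lra.
pose C := 4 * K0 `^ (2 * kappa) * (2 * (1 + kappa^-1)).
have C0 : 0 <= C.
  by rewrite !mulr_ge0 ?powR_ge0// addr_ge0// invr_ge0 ltW.
exists C => // a b delta /andP[d0 d1] a0 ab bD eta eta0.
pose be := T / delta; pose al := (- 2 - a) / delta + 1; pose al' := (- 2 - b) / delta.
have be0 : 0 <= be by rewrite divr_ge0// ltW.
have dn0 : delta != 0 by rewrite gt_eqF.
have al_le : al' <= al.
  rewrite /al /al'; apply: ler_wpDr => //.
  by rewrite ler_wpM2r ?invr_ge0 ?(ltW d0)//; lra.
have trE x : trapez al al' be x = trapezoid a b delta (T * x - 2).
  by rewrite /trapez /trapezoid; congr (clamp01 _ - clamp01 _); rewrite /al /al' /be; field.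
pose g (x : 'rV[R]_1) := trapez al al' be (x ord0 ord0).
have gv i : vanish_at i g.
  move=> x; rewrite (ord1 i) /g trE /trapezoid negb_and -!leNgt; set y := x ord0 ord0.
  move=> /orP[y0|y1].
    have h : T * y <= 0 by rewrite mulr_ge0_le0// ltW.
    rewrite !clamp01_0 ?subrr//.
      by rewrite mulr_le0_ge0 ?invr_ge0 ?(ltW d0)//; lra.
    rewrite -lerBrDr sub0r ler_pdivrMr//; lra.
  have h : T <= T * y by rewrite ler_peMr// ltW.
  rewrite !clamp01_1 ?subrr//; first by rewrite ler_pdivlMr//; rewrite /T in h *; lra.
  rewrite lerDr divr_ge0 ?(ltW d0)//; rewrite /T in h *; lra.
have glip (x x' : 'rV[R]_1) (r : R) : (forall i, `|x ord0 i - x' ord0 i| <= r) ->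
    `|g x - g x'| <= 2 * be * r.
  move=> /(_ ord0) xr; rewrite /g /trapez.
  have br : be * `|x ord0 ord0 - x' ord0 ord0| <= be * r by rewrite ler_wpM2l.
  have h z : `|clamp01 (z + be * x ord0 ord0) - clamp01 (z + be * x' ord0 ord0)| <= be * r.
    apply: (le_trans (clamp01_lip _ _)); apply: le_trans br.
    by rewrite opprD addrACA subrr add0r -mulrBr normrM ger0_norm.
  have := h al; have := h al'.
  set A := clamp01 (al + _); set A' := clamp01 (al' + _).
  set A1 := clamp01 (al + _); set A1' := clamp01 (al' + _) => h1 h2.
  have -> : A - A' - (A1 - A1') = (A - A1) - (A' - A1') by ring.
  apply: (le_trans (ler_normB _ _)); apply: (le_trans (lerD h2 h1)).
  by rewrite le_eqVlt; apply/orP; left; apply/eqP; ring.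
pose B := C * delta `^ (- (2 * kappa)).
have B0 : 0 <= B by rewrite mulr_ge0 ?powR_ge0.
have [m0 _ m0P] := powRN_small (2 * be + 2 * pi * B) k0 eta0.
pose M := m0.*2.+1; pose off t := @offset R 1 m0 0 t.
pose l (t : {ffun 'I_1 -> 'I_M}) : R := (window (0 : 'rV[R]_1) t ord0 ord0)%:~R : R.
pose c (t : {ffun 'I_1 -> 'I_M}) := gridcoef M g (off t).
have offl t : off t ord0 ord0 = - l t by rewrite /l !mxE sub0r.
have lE t : l t = (t ord0 : nat)%:R - m0%:R.
  rewrite /l mxE (_ : Num.floor _ = 0); last first.
    by apply: Num.Theory.floor_def; rewrite mxE add0r; apply/andP; split; lra.
  by rewrite add0r rmorphB /= -!pmulrn.
have wtoff t : wt kappa (off t) = (1 + `|l t|) `^ kappa.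
  by rewrite wtE big_ord1 offl normrN.
have cB : \sum_t normc (c t) * wt kappa (off t) <= B.
  apply: (@le_trans _ _ (\sum_(t : {ffun 'I_1 -> 'I_M}) 4 * (K0 / delta) `^ (2 * kappa) *
      (1 + `|l t|) `^ (- (1 + kappa)))).
    apply: ler_sum => t _; rewrite wtoff.
    have offM : `|off t ord0 ord0 / M%:R| <= 2^-1 by exact: offset_small.
    apply: min_interpolation => //.
    - by rewrite divr_gt0.
    - exact: normc_ge0.
    - by have := gridcoef_trapez1 (ltn0Sn _) be0 al_le gv offM; rewrite offl normrN.
    - have := gridcoef_trapez2 (ltn0Sn _) be0 al_le gv offM; rewrite offl normrN.
      move=> H; apply: (le_trans H).
      apply: (@le_trans _ _ (K0 / delta)); last by rewrite ler_peMl ?divr_ge0 ?ltW//; lra.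
      rewrite /K0 /be ler_pdivlMr// -mulrA ler_wpM2l// mulrDl mulrA mulrAC.
      by rewrite mulfK//; lra.
  rewrite -mulr_sumr sum_ffun1; apply: (@le_trans _ _ (4 * (K0 / delta) `^ (2 * kappa) *
    (2 * (1 + kappa^-1)))).
    rewrite ler_wpM2l ?mulr_ge0 ?powR_ge0//; apply: le_trans (p_series_le2 m0 k0).
    by apply: ler_sum => k _; rewrite lE ffunE distrC.
  rewrite /B /C powRM ?invr_ge0 ?(ltW K00) ?(ltW d0)// powRV ?(ltW d0)//.
  by rewrite le_eqVlt; apply/orP; left; apply/eqP; ring.
exists [seq (c t * ec (2 * l t / T), l t / T) | t <- index_enum ({ffun 'I_1 -> 'I_M} : finType)].
  rewrite big_map/=; apply: le_trans cB; apply: ler_sum => t _.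
  rewrite normcM normc_ec mulr1 ler_wpM2l ?normc_ge0// wtoff.
  apply: ge0_ler_powR; rewrite ?nnegrE ?addr_ge0// ?(ltW k0)// lerD2l.
  by rewrite normrM ler_piMr// ger0_norm ?invr_ge0 ?(ltW T0)// invf_le1.
move=> t /andP[t0 tD]; pose x : 'rV[R]_1 := \row_i ((t + 2) / T).
have cx : cube x.
  move=> i; rewrite mxE divr_ge0 ?(ltW T0) ?addr_ge0//= ler_pdivrMr// mul1r /T; lra.
have k01 : 0 < kappa <= 1 by apply/andP; split; lra.
have := window_approx k01 gv (fun y y' => glip y y' _) cB cx.
rewrite dotC dot0r ec0 mulr1 big_map /=.
have -> : g x = trapezoid a b delta t.
  by rewrite /g trE mxE mulrC divfK ?gt_eqF// addrK.
under eq_bigr => j _.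
  rewrite (_ : dot _ x = 2 * l j / T + l j / T * t); last first.
    by rewrite /dot big_ord1 /x !mxE /l !mxE; ring.
  rewrite ecD mulrA; over.
move=> /le_trans; apply; apply: le_trans (m0P M _); last first.
  by rewrite /M -addnn -addSn leq_addl.
have be2 : 0 <= 2 * be by rewrite mulr_ge0.
rewrite [leRHS]mulrDl lerD2r; apply: (ler_wpM2l be2); rewrite -powR_inv1//.
by apply: ler_powR; rewrite ?ler1n// lerN2; lra.
Qed.

End trapezoid_approx.

(** * Integrals over the cube *)

Section volume.
Context {R : realType}.
Local Notation leb := (@lebesgue_measure R).

Definition mu (n : nat) : {sigma_finite_measure set 'rV[R]_n -> \bar R} :=
  @lebesgue_rV R n.

Lemma measurable_coord n (i : 'I_n) :
  measurable_fun [set: 'rV[R]_n] (fun x : 'rV[R]_n => x ord0 i).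
Proof. exact: measurable_coord_rV. Qed.

Lemma measurable_dot n (y : 'rV[R]_n) :
  measurable_fun [set: 'rV[R]_n] (fun x : 'rV[R]_n => dot x y).
Proof.
apply: measurable_sum => i; apply: measurable_funM => //.
exact: measurable_coord.
Qed.

Lemma measurable_cube n : measurable (@cube R n).
Proof.
rewrite (_ : cube = \bigcap_(i in [set: 'I_n]) (fun x : 'rV[R]_n => x ord0 i) @^-1` `[0, 1]).
  apply: fin_bigcap_measurable => [|i _]; first exact: finite_finset.
  by rewrite -[X in measurable X]setTI; exact: measurable_coord.
apply/seteqP; split=> x /= H => [i _|i]; first by rewrite /= in_itv/=; exact: H.
by have := H i I; rewrite /= in_itv.
Qed.

Lemma measurable_slab n (y : 'rV[R]_n) (a b : R) :
  measurable [set x : 'rV[R]_n | a <= dot x y <= b].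
Proof.
rewrite (_ : [set x | _] = (fun x : 'rV[R]_n => dot x y) @^-1` `[a, b]).
  by rewrite -[X in measurable X]setTI; exact: measurable_dot.
by apply/seteqP; split=> x /=; rewrite in_itv.
Qed.

Lemma tonelli_rV1 n (f : 'rV[R]_n.+1 -> \bar R) : measurable_fun [set: 'rV[R]_n.+1] f ->
  (forall x, 0 <= f x)%E ->
  (\int[mu n.+1]_x f x = \int[leb]_t \int[mu n]_x f (cons_rV (t, x)))%E.
Proof.
move=> mf f0; pose P := pushforward (leb \x mu n)%E (@cons_rV R n).
rewrite (@eq_measure_integral _ _ _ setT P)//; first exact: measurable_cons_rV.
move=> mcons; rewrite ge0_integral_pushforward//.
rewrite preimage_setT fubini_tonelli1//=.
by apply: measurableT_comp => //; exact: measurable_cons_rV.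
Qed.

Lemma tonelli_rV2 n (f : 'rV[R]_n.+1 -> \bar R) : measurable_fun [set: 'rV[R]_n.+1] f ->
  (forall x, 0 <= f x)%E ->
  (\int[mu n.+1]_x f x = \int[mu n]_x \int[leb]_t f (cons_rV (t, x)))%E.
Proof.
move=> mf f0; pose P := pushforward (leb \x mu n)%E (@cons_rV R n).
rewrite (@eq_measure_integral _ _ _ setT P)//; first exact: measurable_cons_rV.
move=> mcons; rewrite ge0_integral_pushforward//.
rewrite preimage_setT fubini_tonelli2//=.
by apply: measurableT_comp => //; exact: measurable_cons_rV.
Qed.

Definition tail_rV n (y : 'rV[R]_n.+1) : 'rV[R]_n := \row_i y ord0 (lift ord0 i).

Lemma dot_cons n t (x : 'rV[R]_n) (y : 'rV[R]_n.+1) :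
  dot (cons_rV (t, x)) y = t * y ord0 ord0 + dot x (tail_rV y).
Proof.
rewrite /dot big_ord_recl !mxE unlift_none /=; congr (_ + _).
by apply: eq_bigr => i _; rewrite !mxE liftK.
Qed.

Lemma cube_cons n t (x : 'rV[R]_n) :
  cube (cons_rV (t, x)) <-> (0 <= t <= 1) /\ cube x.
Proof.
split=> [H|[t01 cx] i].
  split=> [|i]; first by have := H ord0; rewrite mxE unlift_none.
  by have := H (lift ord0 i); rewrite mxE liftK.
by case: (unliftP ord0 i) => [j ->|->]; rewrite mxE ?liftK ?unlift_none //=; exact: cx.
Qed.

Lemma tonelli_cube1 n (f : 'rV[R]_n.+1 -> R) : measurable_fun [set: 'rV[R]_n.+1] f ->
  (forall x, 0 <= f x) ->
  (\int[mu n.+1]_(x in cube) (f x)%:E =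
   \int[leb]_(t in `[0%R, 1%R]) \int[mu n]_(x in cube) (f (cons_rV (t, x)))%:E)%E.
Proof.
move=> mf f0; rewrite integral_mkcond tonelli_rV1//; last 2 first.
- apply/(measurable_restrictT _ _).1 => //; first exact: measurable_cube.
  by apply/measurable_EFinP; exact: measurable_funTS.
- by move=> x; rewrite patchE; case: ifP => // _; rewrite lee_fin.
rewrite [RHS]integral_mkcond; apply: eq_integral => t _.
rewrite patchE; case: ifPn => t01; last first.
  apply: integral0_eq => x _; rewrite patchE; case: ifPn => //.
  rewrite inE => /cube_cons[] t01'; move: t01; rewrite notin_setE/= in_itv/=.
  by rewrite t01'.
rewrite [RHS]integral_mkcond; apply: eq_integral => x _.
move: t01; rewrite inE/= in_itv/= => t01.
rewrite !patchE; case: ifPn; rewrite ?inE ?notin_setE.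
  by move=> /cube_cons[_ cx]; rewrite mem_set.
by move=> H; case: ifPn => //; rewrite inE => cx; case: H; apply/cube_cons.
Qed.

Lemma tonelli_cube2 n (f : 'rV[R]_n.+1 -> R) : measurable_fun [set: 'rV[R]_n.+1] f ->
  (forall x, 0 <= f x) ->
  (\int[mu n.+1]_(x in cube) (f x)%:E =
   \int[mu n]_(x in cube) \int[leb]_(t in `[0%R, 1%R]) (f (cons_rV (t, x)))%:E)%E.
Proof.
move=> mf f0; rewrite integral_mkcond tonelli_rV2//; last 2 first.
- apply/(measurable_restrictT _ _).1 => //; first exact: measurable_cube.
  by apply/measurable_EFinP; exact: measurable_funTS.
- by move=> x; rewrite patchE; case: ifP => // _; rewrite lee_fin.
rewrite [RHS]integral_mkcond; apply: eq_integral => x _.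
rewrite patchE; case: ifPn => cx; last first.
  apply: integral0_eq => t _; rewrite patchE; case: ifPn => //.
  by rewrite inE => /cube_cons[_ cx']; move: cx; rewrite notin_setE.
rewrite [RHS]integral_mkcond; apply: eq_integral => t _.
move: cx; rewrite inE => cx.
rewrite !patchE; case: ifPn; rewrite ?inE ?notin_setE.
  by move=> /cube_cons[t01 _]; rewrite mem_set//= in_itv.
move=> H; case: ifPn => //; rewrite inE/= in_itv/= => t01.
by case: H; apply/cube_cons.
Qed.

Lemma measurable_inner1 n (f : 'rV[R]_n.+1 -> R) :
  measurable_fun [set: 'rV[R]_n.+1] f -> (forall x, 0 <= f x) ->
  measurable_fun [set: measurableTypeR R]
    (fun t : R => \int[mu n]_(x in cube) (f (cons_rV (t, x)))%:E)%E.
Proof.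
move=> mf f0.
pose F (z : measurableTypeR R * 'rV[R]_n) := (f (cons_rV z) * \1_(cube) z.2)%:E.
rewrite (_ : (fun t => _) = fun t => \int[mu n]_x F (t, x))%E.
  apply: (measurable_fun_fubini_tonelli_F (m2 := mu n) F) => [|z].
    apply/measurable_EFinP; apply: measurable_funM.
      by apply: measurableT_comp => //; exact: measurable_cons_rV.
    by apply: measurableT_comp => //; apply: measurable_indic; exact: measurable_cube.
  by rewrite lee_fin mulr_ge0.
apply/funext => t; rewrite integral_mkcond; apply: eq_integral => x _.
rewrite patchE /F /= indicE; case: ifP => cx; first by rewrite mulr1.
by rewrite mulr0.
Qed.

Lemma measurable_inner2 n (f : 'rV[R]_n.+1 -> R) :
  measurable_fun [set: 'rV[R]_n.+1] f -> (forall x, 0 <= f x) ->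
  measurable_fun [set: 'rV[R]_n]
    (fun x => \int[leb]_(t in `[0%R, 1%R]) (f (cons_rV (t, x)))%:E)%E.
Proof.
move=> mf f0.
pose F (z : measurableTypeR R * 'rV[R]_n) := (f (cons_rV z) * \1_(`[0, 1]) z.1)%:E.
rewrite (_ : (fun x => _) = fun x => \int[leb]_t F (t, x))%E.
  apply: (measurable_fun_fubini_tonelli_G (m1 := leb) F) => [|z].
    apply/measurable_EFinP; apply: measurable_funM.
      by apply: measurableT_comp => //; exact: measurable_cons_rV.
    by apply: measurableT_comp => //; exact: measurable_indic.
  by rewrite lee_fin mulr_ge0.
apply/funext => x; rewrite integral_mkcond; apply: eq_integral => t _.
rewrite patchE /F /= indicE; case: ifP => cx; first by rewrite mulr1.
by rewrite mulr0.
Qed.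

Lemma leb01 : leb `[0%R, 1%R] = 1%E.
Proof. by rewrite lebesgue_measure_itv/= lte_fin ltr01 oppr0 adde0. Qed.

Lemma mu_cube n : mu n cube = 1%E.
Proof.
elim: n => [|n IH].
  by rewrite /mu /= diracE mem_set//; case.
have E m : (\int[mu m]_(x in cube) 1%:E = mu m cube)%E.
  by rewrite integral_cst ?mul1e//; exact: measurable_cube.
have := @tonelli_cube1 n (cst 1) (measurable_cst _) (fun=> ler01).
rewrite /cst E => ->; under eq_integral do rewrite E IH.
by rewrite (integral_cst leb)//= leb01 mul1e.
Qed.

Lemma integral_cube_cst n (r : R) : (\int[mu n]_(x in cube) r%:E = r%:E)%E.
Proof.
rewrite integral_cst; last exact: measurable_cube.
by rewrite -[RHS]mule1 -(mu_cube n).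
Qed.

Lemma mu_cube_lty n : (mu n cube < +oo)%E.
Proof. by rewrite mu_cube ltry. Qed.

(** The slab is cut by lines in a direction along which [dot _ y] grows at
    rate at least [c]. *)
Lemma mu_slab_le n (y : 'rV[R]_n) (i : 'I_n) (c a b : R) :
  0 < c -> c <= y ord0 i -> a <= b ->
  (\int[mu n]_(x in cube) (\1_([set x : 'rV[R]_n | (a <= dot x y <= b)%R]) x)%:E
   <= ((b - a) / c)%:E)%E.
Proof.
move=> c0; elim: n y i a b => [|n IH] y i a b cy ab; first by case: i cy.
have mf : measurable_fun [set: 'rV[R]_n.+1]
    (\1_([set x : 'rV[R]_n.+1 | a <= dot x y <= b]) : 'rV[R]_n.+1 -> R).
  by apply: measurable_indic; exact: measurable_slab.
have f0 x : 0 <= (\1_([set x : 'rV[R]_n.+1 | a <= dot x y <= b]) x : R) by [].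
have ba0 : 0 <= (b - a) / c by rewrite divr_ge0 ?subr_ge0 ?(ltW c0).
case: (unliftP ord0 i) cy => [j ->|->] cy.
  rewrite tonelli_cube1//.
  apply: (@le_trans _ _ (\int[leb]_(t in `[0%R, 1%R]) ((b - a) / c)%:E)%E); last first.
    by rewrite (integral_cst leb)//= leb01 mule1.
  apply: ge0_le_integral => //=.
  - by move=> t _; apply: integral_ge0.
  - by apply: measurable_funTS; exact: measurable_inner1.
  move=> t _.
  have := IH (tail_rV y) j (a - t * y ord0 ord0) (b - t * y ord0 ord0).
  rewrite mxE => /(_ cy); rewrite lerD2r => /(_ ab).
  rewrite opprD addrACA opprK addNr addr0.
  apply: le_trans; rewrite le_eqVlt; apply/orP; left; apply/eqP.
  apply: eq_integral => x _; rewrite !indicE; congr (_%:R)%:E; congr (nat_of_bool _).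
  by apply/idP/idP; rewrite !inE/= dot_cons lerBlDl lerBrDl.
rewrite tonelli_cube2//.
apply: (@le_trans _ _ (\int[mu n]_(x in cube) ((b - a) / c)%:E)%E); last first.
  by rewrite integral_cube_cst.
apply: ge0_le_integral => //=; first exact: measurable_cube.
- by move=> t _; apply: integral_ge0.
- by apply: measurable_funTS; exact: measurable_inner2.
move=> x _; set s := dot x (tail_rV y).
have y0 : 0 < y ord0 ord0 by exact: lt_le_trans cy.
have -> : (\int[leb]_(t in `[0%R, 1%R])
      (\1_([set x0 : 'rV[R]_n.+1 | (a <= dot x0 y <= b)%R]) (cons_rV (t, x)))%:E =
    \int[leb]_(t in `[0%R, 1%R])
      (\1_(`[(a - s) / y ord0 ord0, (b - s) / y ord0 ord0]) t)%:E)%E.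
  apply: eq_integral => t _; rewrite !indicE; congr (_%:R)%:E; congr (nat_of_bool _).
  by apply/idP/idP; rewrite !inE/= in_itv/= dot_cons ler_pdivrMr// ler_pdivlMr// lerBlDr lerBrDr.
rewrite (integral_indic leb)//; apply: (@le_trans _ _ (leb `[(a - s) / y ord0 ord0, (b - s) / y ord0 ord0])).
  by apply: le_measure; rewrite ?inE; [exact: measurableI|exact: measurable_itv|exact: subIsetl].
rewrite lebesgue_measure_itv/= lte_fin; case: ifPn => _; last by rewrite lee_fin.
rewrite -EFinB lee_fin -mulrBl opprB addrA subrK ler_wpM2l ?subr_ge0//.
by rewrite lef_pV2.
Qed.

(** A nonzero integer frequency has mean zero. The constant [1] is added to
    make the integrand nonnegative, so that Tonelli's theorem applies. *)
Lemma integral_1Dcos01 (k : int) (phi : R) : k != 0 ->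
  (\int[leb]_(t in `[0%R, 1%R]) (1 + cos (2 * pi * (k%:~R * t) + phi))%:E = 1)%E.
Proof.
move=> k0; have pi0 := @pi_gt0 R.
have K0 : 2 * pi * k%:~R != 0 :> R.
  by rewrite mulf_neq0 ?intr_eq0// gt_eqF// mulr_gt0.
pose G (t : R) : R := 2 * pi * (k%:~R * t) + phi.
pose F (t : R) : R := t + (2 * pi * k%:~R)^-1 * sin (G t).
have dG (t : R) : is_derive t (1 : R) G (2 * pi * k%:~R).
  rewrite (_ : G = (2 * pi * k%:~R) \*: id + cst phi); last first.
    by apply/funext => x; rewrite /G !fctE /= /GRing.scale/=; ring.
  by apply: is_derive_eq; rewrite addr0 /GRing.scale/= mulr1.
have dF (t : R) : is_derive t (1 : R) F (1 + cos (G t)).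
  rewrite (_ : F = id + (2 * pi * k%:~R)^-1 \*: (sin \o G)); last first.
    by apply/funext => x; rewrite /F !fctE.
  have := is_derive1_comp (is_derive_sin (G t)) (dG t) => dsin.
  by apply: is_derive_eq; rewrite /GRing.scale/= mulrCA mulVf ?mulr1.
have cF : continuous F.
  by move=> t; apply/differentiable_continuous/derivable1_diffP; have [] := dF t.
rewrite (@continuous_FTC2 R _ F 0 1)//.
- rewrite -EFinB /F /G mulr0 mulr0 add0r mulr1.
  have -> : sin (2 * pi * k%:~R + phi) = sin phi.
    have := ec_int k : ec (k%:~R : R) = 1.
    by rewrite /ec /expi => -[c1 s1]; rewrite sinD c1 s1 mul0r mul1r add0r.
  by rewrite add0r addrK.
- apply: continuous_subspaceT => t; apply: continuousD; first exact: cvg_cst.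
  apply: continuous_comp; last exact: continuous_cos.
  by apply/differentiable_continuous/derivable1_diffP; have [] := dG t.
- split.
  + by move=> t _; have [] := dF t.
  + by apply: cvg_at_right_filter; exact: cF.
  + by apply: cvg_at_left_filter; exact: cF.
- by move=> t _; rewrite derive1E; have [_] := dF t.
Qed.

Lemma integral_1Dcos n (l : 'rV[int]_n) (phi : R) : l != 0 ->
  (\int[mu n]_(x in cube) (1 + cos (2 * pi * dot x (intR l) + phi))%:E = 1)%E.
Proof.
elim: n l phi => [|n IH] l phi l0.
  by move: l0; rewrite (_ : l = 0) ?eqxx//; apply/rowP; case.
have mf : measurable_fun [set: 'rV[R]_n.+1]
    (fun x => 1 + cos (2 * pi * dot x (intR l) + phi)).
  apply: measurable_funD => //; apply: (measurableT_comp (f := cos)).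
    by apply: continuous_measurable_fun; exact: continuous_cos.
  apply: measurable_funD => //; apply: measurable_funM => //.
  exact: measurable_dot.
have f0 (t : R) : 0 <= 1 + cos t by rewrite -lerBlDl sub0r cos_geN1.
have [l00|l00] := eqVneq (l ord0 ord0) 0.
  rewrite tonelli_cube1//.
  rewrite (eq_integral (cst 1%E)) => [|t _]; first by rewrite (integral_cst leb)//= leb01 mule1.
  have tl0 : (\row_i l ord0 (lift ord0 i)) != 0.
    apply: contra_neq l0 => /rowP tl; apply/rowP => i.
    case: (unliftP ord0 i) => [j ->|->]; last by rewrite l00 mxE.
    by have := tl j; rewrite !mxE.
  rewrite /= -(IH _ phi tl0); apply: eq_integral => x _.
  rewrite dot_cons [intR l _ _]mxE l00 mulr0 add0r; congr (1 + cos (_ * dot _ _ + _))%:E.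
  by apply/rowP => i; rewrite !mxE.
rewrite tonelli_cube2//.
rewrite (eq_integral (cst 1%E)) => [|x _].
  by rewrite integral_cube_cst.
rewrite -(integral_1Dcos01 (2 * pi * dot x (tail_rV (intR l)) + phi) l00).
apply: eq_integral => t _; rewrite dot_cons [intR l _ _]mxE; congr (1 + cos _)%:E.
by ring.
Qed.

End volume.

(** * Discrepancy of trigonometric approximations *)

Section integration.
Context {R : realType} {d : nat}.
Local Notation mu := (@mu R d).
Implicit Types (f g : 'rV[R]_d -> R).

Lemma cube_integrable f (C : R) : measurable_fun cube f ->
  (forall x, cube x -> `|f x| <= C) -> mu.-integrable cube (EFin \o f).
Proof.
move=> mf fC; apply: measurable_bounded_integrable => //.
- exact: measurable_cube.
- exact: mu_cube_lty.
- exists C; split; first exact: num_real.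
  by move=> M /ltW CM x cx; apply: le_trans CM; exact: fC.
Qed.

Lemma Rintegral_cube_cst (r : R) : \int[mu]_(x in cube) r = r.
Proof. by rewrite /Rintegral integral_cube_cst. Qed.

Lemma cube_integrableD f g : mu.-integrable cube (EFin \o f) ->
  mu.-integrable cube (EFin \o g) ->
  mu.-integrable cube (EFin \o (fun x => f x + g x)).
Proof.
move=> i1 i2; have := integrableD (@measurable_cube R d) i1 i2.
by apply: eq_integrable => //; exact: measurable_cube.
Qed.

Lemma Rintegral_cube_norm_le f (C : R) : measurable_fun cube f ->
  (forall x, cube x -> `|f x| <= C) -> `|\int[mu]_(x in cube) f x| <= C.
Proof.
move=> mf fC; have mc := @measurable_cube R d.
apply: (le_trans (le_normr_Rintegral mc (cube_integrable mf fC))).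
rewrite -[leRHS]Rintegral_cube_cst; apply: le_Rintegral => //.
- apply: (@cube_integrable _ C) => [|x cx]; last by rewrite normr_id; exact: fC.
  exact: measurableT_comp.
- by apply: (@cube_integrable _ `|C|).
Qed.

Let wave (c : R[i]) (l : 'rV[int]_d) (x : 'rV[R]_d) : R :=
  complex.Re (c * ec (dot (intR l) x)).

Let waveE c l x : wave c l x =
  complex.Re c * cos (2 * pi * dot x (intR l)) -
  complex.Im c * sin (2 * pi * dot x (intR l)).
Proof. by rewrite /wave dotC; case: c. Qed.

Lemma measurable_cos_dot (phi : R) (l : 'rV[R]_d) :
  measurable_fun [set: 'rV[R]_d] (fun x => cos (2 * pi * dot x l + phi)).
Proof.
apply: (measurableT_comp (f := cos)).
  by apply: continuous_measurable_fun; exact: continuous_cos.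
apply: measurable_funD => //; apply: measurable_funM => //.
exact: measurable_dot.
Qed.

Lemma sin_cos_dot (t : R) : sin t = cos (t + - (pi / 2)).
Proof. by rewrite cosBpihalf. Qed.

Let measurable_wave c l : measurable_fun [set: 'rV[R]_d] (wave c l).
Proof.
rewrite (_ : wave c l = fun x => complex.Re c * cos (2 * pi * dot x (intR l) + 0) -
  complex.Im c * cos (2 * pi * dot x (intR l) + - (pi / 2))); last first.
  by apply/funext => x; rewrite waveE addr0 sin_cos_dot.
by apply: measurable_funB; apply: measurable_funM => //; exact: measurable_cos_dot.
Qed.

Let wave_le c l x : `|wave c l x| <= normc c.
Proof. by apply: (le_trans (Re_le_normc _)); rewrite normcM normc_ec mulr1. Qed.

Let integrable_wave c l : mu.-integrable cube (EFin \o wave c l).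
Proof.
apply: (@cube_integrable _ (normc c)) => [|x _]; last exact: wave_le.
by apply: measurable_funTS; exact: measurable_wave.
Qed.

Lemma Rintegral_cos_dot (phi : R) (l : 'rV[int]_d) : l != 0 ->
  \int[mu]_(x in cube) cos (2 * pi * dot x (intR l) + phi) = 0.
Proof.
move=> l0; have : \int[mu]_(x in cube) (1 + cos (2 * pi * dot x (intR l) + phi)) = 1.
  by rewrite /Rintegral integral_1Dcos.
rewrite RintegralD ?Rintegral_cube_cst; last 3 first.
- exact: measurable_cube.
- by apply: (@cube_integrable _ 1) => // x _; rewrite normr1.
- apply: (@cube_integrable _ 1) => [|x _]; last exact: cos_max.
  by apply: measurable_funTS; exact: measurable_cos_dot.
by move=> H; apply: (addrI 1); rewrite H addr0.
Qed.

Let Rintegral_wave c l :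
  \int[mu]_(x in cube) wave c l x = if l == 0 then complex.Re c else 0.
Proof.
case: eqVneq => [->|l0].
  rewrite (eq_Rintegral _ (g := fun=> complex.Re c)) ?Rintegral_cube_cst// => x _.
  rewrite waveE (_ : dot x _ = 0); first by rewrite mulr0 cos0 sin0 mulr1 mulr0 subr0.
  by rewrite (_ : intR 0 = 0) ?dot0r//; apply/rowP => i; rewrite !mxE.
rewrite (eq_Rintegral _ (g := fun x => complex.Re c * cos (2 * pi * dot x (intR l) + 0) -
    complex.Im c * cos (2 * pi * dot x (intR l) + - (pi / 2)))); last first.
  by move=> x _; rewrite waveE addr0 sin_cos_dot.
have intcos phi : mu.-integrable cube (EFin \o (fun x => cos (2 * pi * dot x (intR l) + phi))).
  apply: (@cube_integrable _ 1) => [|x _]; last exact: cos_max.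
  by apply: measurable_funTS; exact: measurable_cos_dot.
have intZ (r phi : R) : mu.-integrable cube (EFin \o (fun x => r * cos (2 * pi * dot x (intR l) + phi))).
  apply: (@cube_integrable _ `|r|) => [|x _]; last by rewrite normrM ler_piMr ?cos_max.
  apply: measurable_funTS; apply: measurable_funM => //; exact: measurable_cos_dot.
have mc := @measurable_cube R d.
by rewrite RintegralB// !RintegralZl// !Rintegral_cos_dot// !mulr0 subr0.
Qed.

Definition re_tpoly s (x : 'rV[R]_d) : R := complex.Re (tpoly s x).

Lemma re_tpolyE s x : re_tpoly s x = \sum_(q <- s) wave q.1 q.2 x.
Proof. by rewrite /re_tpoly Re_sum. Qed.

Lemma measurable_re_tpoly s : measurable_fun [set: 'rV[R]_d] (re_tpoly s).
Proof.
rewrite (_ : re_tpoly s = fun x => \sum_(q <- s) wave q.1 q.2 x).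
  by apply: measurable_sum => q; exact: measurable_wave.
by apply/funext => x; rewrite re_tpolyE.
Qed.

Lemma Rintegral_re_tpoly s : \int[mu]_(x in cube) re_tpoly s x =
  \sum_(q <- s) if q.2 == 0 then complex.Re q.1 else 0.
Proof.
rewrite (eq_Rintegral _ (g := fun x => \sum_(q <- s) wave q.1 q.2 x)); last first.
  by move=> x _; rewrite re_tpolyE.
elim: s => [|q s IH].
  rewrite big_nil (eq_Rintegral _ (g := fun=> 0)) ?Rintegral_cube_cst// => x _.
  by rewrite big_nil.
rewrite big_cons -IH -Rintegral_wave -RintegralD//; last 2 first.
- exact: measurable_cube.
- apply: (@cube_integrable _ (\sum_(q <- s) normc q.1)) => [|x _].
    by apply: measurable_funTS; apply: measurable_sum => ?; exact: measurable_wave.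
  by apply: le_trans (ler_norm_sum _ _ _) _; apply: ler_sum => ? _; exact: wave_le.
by apply: eq_Rintegral => x _; rewrite big_cons.
Qed.

Lemma trig_approx_re kappa B f : trig_approx kappa B (fun x => (f x)%:C%C) ->
  forall eta : R, 0 < eta -> exists2 s, tnorm kappa s <= B &
    forall x, cube x -> `|f x - re_tpoly s x| <= eta.
Proof.
move=> fB eta /fB[s sB fs]; exists s => // x /fs; apply: le_trans.
have -> : f x - re_tpoly s x = complex.Re ((f x)%:C%C - tpoly s x).
  by rewrite /re_tpoly; case: (tpoly s x).
exact: Re_le_normc.
Qed.

(** A pointwise limit of trigonometric polynomials. *)
Lemma trig_approx_measurable kappa B f :
  trig_approx kappa B (fun x => (f x)%:C%C) -> measurable_fun cube f.
Proof.
move=> /trig_approx_re fB.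
have /choice[s fs] : forall n : nat, exists s, forall x, cube x ->
    `|f x - re_tpoly s x| <= n.+1%:R^-1.
  by move=> n; have [|s _ H] := fB n.+1%:R^-1; [rewrite invr_gt0|exists s].
apply: (@measurable_fun_cvg _ _ _ cube (fun n => re_tpoly (s n)) f).
- by move=> n; apply: measurable_funTS; exact: measurable_re_tpoly.
move=> x cx; apply/cvgrPdist_le => e e0; near=> n.
apply: (le_trans (fs n x cx)).
have : n.+1%:R^-1 < e.
  near: n; exact: near_infty_natSinv_lt (PosNum e0).
exact: ltW.
Unshelve. all: by end_near.
Qed.

End integration.

Section discrepancy.
Context {R : realType} {d : nat}.
Local Notation mu := (@mu R d).

Lemma enorm_le (x : 'rV[R]_d) : enorm x <= \prod_i (1 + `|x ord0 i|).
Proof.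
have S0 : 0 <= \sum_i `|x ord0 i| by exact: sumr_ge0.
have P0 : 0 <= \prod_i (1 + `|x ord0 i|) by apply: prodr_ge0 => i _; rewrite addr_ge0.
rewrite -(ger0_norm P0) -sqrtr_sqr; apply: ler_wsqrtr.
apply: (@le_trans _ _ ((\sum_i `|x ord0 i|) ^+ 2)); last first.
  rewrite ler_pXn2r ?nnegrE//; apply: le_trans (sum_le_prod _ _) => //.
  by rewrite lerDr.
rewrite expr2 /dot mulr_suml; apply: ler_sum => i _.
apply: (@le_trans _ _ (`|x ord0 i| * `|x ord0 i|)).
  by rewrite -normrM ler_norm.
by apply: ler_wpM2l => //; rewrite (bigD1 i)//= lerDl; exact: sumr_ge0.
Qed.

Lemma intR0 : intR 0 = 0 :> 'rV[R]_d.
Proof. by apply/rowP => i; rewrite !mxE. Qed.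

Lemma Re_realM (r : R) (z : R[i]) : complex.Re (r%:C%C * z) = r * complex.Re z.
Proof. by case: z => a b /=; rewrite mul0r subr0. Qed.

Lemma sum_shift1 (V : nmodType) (F : nat -> V) (N : nat) :
  \sum_(1 <= n < N.+1) F n = \sum_(n < N) F n.+1.
Proof. by rewrite big_add1 big_mkord. Qed.

(** For functions with absolutely summable Fourier coefficients the
    exponential sums bound the discrepancy directly. *)
Lemma trig_approx_discrepancy (gamma : R) (v : nat -> 'rV[R]_d) (kappa : R) :
  0 < kappa -> uniformly_distributed gamma v -> exists2 C : R, 0 <= C &
  forall B (f : 'rV[R]_d -> R) N, trig_approx kappa B (fun x => (f x)%:C%C) ->
  (0 < N)%N ->
  `|N%:R^-1 * (\sum_(n < N) f (v n.+1)) - \int[mu]_(x in cube) f x|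
  <= C * B * N%:R `^ (- gamma).
Proof.
move=> k0 [cv ud]; have [C CP] := ud kappa k0; have C0 : 0 <= `|C| by []; exists `|C| => // B f N fB N0.
have NR0 : 0 < N%:R :> R by rewrite ltr0n.
have cvn (n : nat) : cube (v n.+1) by exact: cv.
pose E (l : 'rV[int]_d) : R[i] :=
  N%:R^-1 * (\sum_(n < N) ec (dot (intR l) (v n.+1))) - (l == 0)%:R.
have EP l : normc (E l) <= `|C| * wt kappa (@intR R d l) * N%:R `^ (- gamma).
  rewrite /E; case: eqVneq => [->|l0].
    under eq_bigr do rewrite intR0 dotC dot0r ec0.
    rewrite sumr_const card_ord mulVf ?pnatr_eq0 -?lt0n// subrr normc0.
    by rewrite !mulr_ge0 ?powR_ge0 ?wt_ge0.
  rewrite subr0 -(sum_shift1 (fun n => ec (dot (intR l) (v n)))).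
  apply: (le_trans (CP l N l0 N0)); rewrite ler_wpM2r ?powR_ge0//.
  apply: (@le_trans _ _ (`|C| * enorm (intR l : 'rV[R]_d) `^ kappa)).
    by rewrite ler_wpM2r ?powR_ge0 ?ler_norm.
  rewrite ler_wpM2l//; apply: ge0_ler_powR; rewrite ?nnegrE ?(ltW k0) ?sqrtr_ge0//.
    by apply: prodr_ge0 => i _; rewrite addr_ge0.
  exact: enorm_le.
have B0 : 0 <= B := trig_approx_ge0 fB.
apply/ler_addgt0Pr => e e0; have e2 : 0 < e / 2 by rewrite divr_gt0.
have [s sB fs] := trig_approx_re fB e2.
pose S := N%:R^-1 * (\sum_(n < N) re_tpoly s (v n.+1)).
have h1 : `|N%:R^-1 * (\sum_(n < N) f (v n.+1)) - S| <= e / 2.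
  rewrite /S -mulrBr -sumrB normrM ger0_norm ?invr_ge0// mulrC ler_pdivrMr//.
  apply: (le_trans (ler_norm_sum _ _ _)).
  apply: (@le_trans _ _ (\sum_(n < N) e / 2)); last by rewrite sumr_const card_ord mulr_natr.
  by apply: ler_sum => n _; exact: fs.
have mc := @measurable_cube R d.
have mf := trig_approx_measurable fB.
have ms : measurable_fun cube (re_tpoly s) by apply: measurable_funTS; exact: measurable_re_tpoly.
have sle x : cube x -> `|re_tpoly s x| <= \sum_(q <- s) normc q.1.
  move=> _; apply: (le_trans (Re_le_normc _)); apply: (le_trans (normc_sum _ _ _)).
  by apply: ler_sum => q _; rewrite normcM normc_ec mulr1.
have is_ : mu.-integrable cube (EFin \o re_tpoly s) by exact: (cube_integrable ms sle).
have if_ : mu.-integrable cube (EFin \o f).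
  apply: (@cube_integrable _ _ _ (\sum_(q <- s) normc q.1 + e / 2)) => // x cx.
  have := fs x cx; have := sle x cx.
  have := ler_normD (re_tpoly s x) (f x - re_tpoly s x).
  rewrite addrC subrK; lra.
have h2 : `|\int[mu]_(x in cube) f x - \int[mu]_(x in cube) re_tpoly s x| <= e / 2.
  rewrite -RintegralB//; apply: Rintegral_cube_norm_le => //.
  exact: measurable_funB.
(* the mean over the cube is the coefficient of frequency [0], which cancels the
   contribution of that frequency to the sample mean *)
have h3 : `|S - \int[mu]_(x in cube) re_tpoly s x| <= `|C| * B * N%:R `^ (- gamma).
  rewrite Rintegral_re_tpoly.
  have -> : S = \sum_(q <- s) complex.Re (q.1 * (N%:R^-1 *
      (\sum_(n < N) ec (dot (intR q.2) (v n.+1))))).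
    rewrite /S /re_tpoly /tpoly; under eq_bigr do rewrite Re_sum.
    rewrite exchange_big/= mulr_sumr; apply: eq_bigr => q _.
    rewrite mulrCA -(rmorph_nat (real_complex R)) -fmorphV Re_realM.
    by rewrite [in RHS]mulr_sumr Re_sum.
  rewrite -sumrB; apply: (le_trans (ler_norm_sum _ _ _)).
  apply: (@le_trans _ _ (\sum_(q <- s) normc q.1 * (`|C| * wt kappa (@intR R d q.2) * N%:R `^ (- gamma)))).
    apply: ler_sum => q _.
    have -> : complex.Re (q.1 * (N%:R^-1 * (\sum_(n < N) ec (dot (intR q.2) (v n.+1))))) -
        (if q.2 == 0 then complex.Re q.1 else 0) = complex.Re (q.1 * E q.2).
      rewrite /E mulrBr; case: eqVneq => _; rewrite ?mulr1 ?mulr0 ?subr0//.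
      by case: (q.1 * _) => a b; case: (q.1).
    apply: (le_trans (Re_le_normc _)); rewrite normcM.
    by rewrite ler_wpM2l ?normc_ge0.
  rewrite (eq_bigr (fun q => (`|C| * N%:R `^ (- gamma)) * (normc q.1 * wt kappa (intR q.2)))).
    by rewrite -mulr_sumr [leRHS]mulrAC ler_wpM2l// mulr_ge0 ?powR_ge0.
  by move=> q _; ring.
set I1 := \int[mu]_(x in cube) f x in h2 *.
set I2 := \int[mu]_(x in cube) re_tpoly s x in h2 h3 *.
have -> : N%:R^-1 * (\sum_(n < N) f (v n.+1)) - I1 =
  (N%:R^-1 * (\sum_(n < N) f (v n.+1)) - S) + (S - I2) - (I1 - I2) by ring.
apply: (le_trans (ler_normB _ _)); have := ler_normD (N%:R^-1 * (\sum_(n < N) f (v n.+1)) - S) (S - I2).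
by lra.
Qed.

End discrepancy.

(** * Slabs with a fixed normal *)

Section slab.
Context {R : realType} {d : nat}.
Local Notation mu := (@mu R d).
Implicit Types (g : 'rV[R]_d -> R) (y : 'rV[R]_d) (a b delta t : R).

Lemma wt_scale (kappa tau : R) y : 0 <= kappa -> cube y ->
  wt kappa (tau *: y) <= (1 + `|tau|) `^ (d%:R * kappa).
Proof.
move=> k0 cy; rewrite wtE powRrM powR_mulrn ?addr_ge0//.
apply: (@le_trans _ _ (\prod_(i < d) (1 + `|tau|) `^ kappa)).
  apply: ler_prod => i _; rewrite powR_ge0/=; apply: ge0_ler_powR; rewrite ?nnegrE ?addr_ge0//.
  rewrite lerD2l mxE normrM; have /andP[y0 y1] := cy i.
  by rewrite ler_piMr// ger0_norm.
rewrite prodr_const card_ord -!powR_mulrn ?addr_ge0 ?powR_ge0//.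
by rewrite -!powRrM mulrC.
Qed.

Lemma dot_cube_ge0 x y : cube x -> cube y -> 0 <= dot x y.
Proof.
move=> cx cy; apply: sumr_ge0 => i _.
by have /andP[? _] := cx i; have /andP[? _] := cy i; rewrite mulr_ge0.
Qed.

Lemma dot_cube_le x y : cube x -> cube y -> dot x y <= d%:R.
Proof.
move=> cx cy; apply: (@le_trans _ _ (\sum_(i < d) 1)).
  apply: ler_sum => i _; have /andP[? ?] := cx i; have /andP[? ?] := cy i.
  by rewrite mulr_ile1.
by rewrite sumr_const card_ord.
Qed.

(** Expand the trapezoid in the variable [dot x y] with real frequencies [tau]. Each
    term [g x * ec (tau * dot x y)] is [g] modulated by the real frequency [tau * y],
    and the weight of that frequency is at most [(1 + |tau|) ^ (d kappa)]. *)
Lemma trig_approx_trapezoid C g (eps : R) : (0 < d)%N -> cutoff C g -> 0 < eps ->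
  exists kappa K : R, [/\ 0 < kappa, 0 <= K & forall y a b delta, cube y ->
    0 < delta <= 1 -> 0 <= a -> a <= b -> b <= d%:R ->
    trig_approx kappa (K * delta `^ (- eps))
      (fun x => (g x * trapezoid a b delta (dot x y))%:C%C)].
Proof.
move=> d0 cg eps0; have dR0 : 0 < d%:R :> R by rewrite ltr0n.
have dR1 : 1 <= d%:R :> R by rewrite ler1n.
(* the exponent [2 * k'] of [delta] must not exceed [eps] *)
pose k' := Num.min 2^-1 (eps / 2).
have k'0 : 0 < k' by rewrite lt_min invr_gt0 ltr0n divr_gt0.
have k'2 : k' <= 2^-1 by rewrite ge_min lexx.
have k'e : 2 * k' <= eps by rewrite mulrC -ler_pdivlMr// ge_min lexx orbT.
pose kappa := k' / d%:R; have kappa0 : 0 < kappa by rewrite divr_gt0.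
have dk : d%:R * kappa = k' by rewrite /kappa mulrC divfK// gt_eqF.
have kappa2 : kappa <= 2^-1.
  by apply: le_trans k'2; rewrite ler_pdivrMr// ler_peMr// ltW.
have k012 : 0 < kappa <= 2^-1 by rewrite kappa0.
have [B B0 BP] := trig_approx_modulated cg.
have [C1 C10 C1P] := @trapezoid_approx R d%:R k' (ltW dR0) (introT andP (conj k'0 k'2)).
have C0 : 0 <= C by apply: le_trans (cutoff_bound cg 0).
exists kappa, (B * C1); split => //; first by rewrite mulr_ge0.
move=> y a b delta cy /andP[de0 de1] a0 ab bd.
apply: trig_approx_lim => eta eta0.
have eta1 : 0 < eta / (C + 1) by rewrite divr_gt0// ltr_wpDl.
have [s sC1 st] := C1P a b delta (introT andP (conj de0 de1)) a0 ab bd _ eta1.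
exists (fun x => \sum_(q <- s) q.1 * ((g x)%:C%C * ec (dot (q.2 *: y) x))).
  apply: (@trig_approx_le _ _ _ (\sum_(q <- s) normc q.1 * (B * wt kappa (q.2 *: y)))); last first.
    by apply: trig_approx_sum => q; exact: BP.
  apply: (@le_trans _ _ (B * \sum_(q <- s) normc q.1 * (1 + `|q.2|) `^ k')).
    rewrite mulr_sumr; apply: ler_sum => q _; rewrite mulrCA ler_wpM2l//.
    by rewrite ler_wpM2l ?normc_ge0// -dk wt_scale// ltW.
  rewrite -mulrA ler_wpM2l//; apply: (le_trans sC1); rewrite ler_wpM2l//.
  rewrite !powRN lef_pV2 ?posrE ?powR_gt0//.
  by apply: ger_powR => //; rewrite de0 de1.
move=> x cx.
have -> : \sum_(q <- s) q.1 * ((g x)%:C%C * ec (dot (q.2 *: y) x)) =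
    (g x)%:C%C * \sum_(q <- s) q.1 * ec (q.2 * dot x y).
  by rewrite mulr_sumr; apply: eq_bigr => q _; rewrite mulrCA dotC dotZr.
rewrite rmorphM -mulrBr normcM normc_real.
have t0d : 0 <= dot x y <= d%:R by rewrite dot_cube_ge0 ?dot_cube_le.
apply: (le_trans (ler_pM _ _ (cutoff_bound cg x) (st _ t0d))) => //.
  exact: normc_ge0.
rewrite mulrCA ler_piMr ?(ltW eta0)// ler_pdivrMr ?mul1r ?lerDl//.
by rewrite ltr_wpDl.
Qed.

Definition ind (a b t : R) : R := ((a <= t <= b)%R : bool)%:R.

Lemma ind_ge0 a b t : 0 <= ind a b t. Proof. by rewrite /ind; case: (_ <= _ <= _). Qed.

Lemma ind_le1 a b t : ind a b t <= 1. Proof. by rewrite /ind; case: (_ <= _ <= _). Qed.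

Lemma measurable_ind a b y : measurable_fun [set: 'rV[R]_d] (fun x => ind a b (dot x y)).
Proof.
rewrite (_ : (fun x => _) = \1_([set x : 'rV[R]_d | a <= dot x y <= b])).
  by apply: measurable_indic; exact: measurable_slab.
apply/funext => x; rewrite indicE /ind; congr (_%:R); congr (nat_of_bool _).
by apply/idP/idP; rewrite inE.
Qed.

Lemma Rintegral_ind_le y i (c a b : R) : 0 < c -> c <= y ord0 i -> a <= b ->
  \int[mu]_(x in cube) ind a b (dot x y) <= (b - a) / c.
Proof.
move=> c0 cy ab; rewrite /Rintegral -lee_fin fineK.
  apply: le_trans (mu_slab_le c0 cy ab); rewrite le_eqVlt; apply/orP; left; apply/eqP.
  apply: eq_integral => x _; rewrite indicE /ind; congr (_%:R)%:E; congr (nat_of_bool _).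
  by apply/idP/idP; rewrite inE.
apply: integrable_fin_num; first exact: measurable_cube.
apply: (@cube_integrable _ _ _ 1) => [|x _].
  by apply: measurable_funTS; exact: measurable_ind.
by rewrite ger0_norm ?ind_ge0 ?ind_le1.
Qed.

Lemma trapezoid_itv a b delta t : 0 < delta -> a <= t <= b -> trapezoid a b delta t = 1.
Proof.
move=> de0 /andP[at_ tb]; rewrite /trapezoid clamp01_1 ?clamp01_0 ?subr0//.
  by rewrite pmulr_lle0 ?invr_gt0// subr_le0.
by rewrite lerDr divr_ge0 ?subr_ge0// ltW.
Qed.

Lemma trapezoid_ge0 a b delta t : 0 < delta -> a <= b -> 0 <= trapezoid a b delta t.
Proof.
move=> de0 ab; rewrite subr_ge0; apply: clamp01_homo; apply: ler_wpDr => //.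
by rewrite ler_wpM2r ?invr_ge0 ?(ltW de0)// lerB.
Qed.

Lemma trapezoid_le1 a b delta t : trapezoid a b delta t <= 1.
Proof.
rewrite /trapezoid; have := clamp01_le1 ((t - a) / delta + 1).
by have := clamp01_ge0 ((t - b) / delta); lra.
Qed.

Lemma trapezoid_out a b delta t : 0 < delta -> a <= b -> t <= a - delta \/ b + delta <= t ->
  trapezoid a b delta t = 0.
Proof.
move=> de0 ab [h|h]; rewrite /trapezoid.
  rewrite !clamp01_0 ?subrr//.
    by rewrite pmulr_lle0 ?invr_gt0//; lra.
  by rewrite -lerBrDr sub0r ler_pdivrMr//; lra.
rewrite !clamp01_1 ?subrr//; first by rewrite ler_pdivlMr//; lra.
by rewrite lerDr divr_ge0 ?(ltW de0)//; lra.
Qed.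

Lemma trapezoid_le_ind a b delta t : 0 < delta -> a <= b ->
  trapezoid a b delta t <= ind a b t + (ind (a - delta) a t + ind b (b + delta) t).
Proof.
move=> de0 ab; have [h1|h1] := lerP t (a - delta).
  by rewrite trapezoid_out//; [rewrite !addr_ge0 ?ind_ge0|left].
have [h2|h2] := lerP (b + delta) t.
  by rewrite trapezoid_out//; [rewrite !addr_ge0 ?ind_ge0|right].
apply: (le_trans (trapezoid_le1 _ _ _ _)).
have := ind_ge0 a b t; have := ind_ge0 (a - delta) a t; have := ind_ge0 b (b + delta) t.
have [ta|ta] := lerP t a.
  by have -> : ind (a - delta) a t = 1 by [rewrite /ind ta (ltW h1)]; lra.
have [bt|bt] := lerP b t.
  by have -> : ind b (b + delta) t = 1 by [rewrite /ind bt (ltW h2)]; lra.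
by have -> : ind a b t = 1 by [rewrite /ind (ltW ta) (ltW bt)]; lra.
Qed.

Lemma ind_le_trapezoid a b delta t : 0 < delta -> a + delta <= b - delta ->
  ind a b t <= trapezoid (a + delta) (b - delta) delta t +
    (ind a (a + delta) t + ind (b - delta) b t).
Proof.
move=> de0 ab; have T0 := trapezoid_ge0 t de0 ab.
have [h|h] := boolP (a <= t <= b); last first.
  have -> : ind a b t = 0 by rewrite /ind (negbTE h).
  have := ind_ge0 a (a + delta) t; have := ind_ge0 (b - delta) b t; lra.
have {h}/andP[at_ tb] := h; apply: (le_trans (ind_le1 _ _ _)).
have I1 := ind_ge0 a (a + delta) t; have I2 := ind_ge0 (b - delta) b t.
have [ta|ta] := lerP t (a + delta).
  by have -> : ind a (a + delta) t = 1 by [rewrite /ind ta at_]; lra.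
have [bt|bt] := lerP (b - delta) t.
  by have -> : ind (b - delta) b t = 1 by [rewrite /ind bt tb]; lra.
by rewrite trapezoid_itv ?(ltW ta) ?(ltW bt)//; lra.
Qed.

Lemma trapezoid_le_ind' a b delta t : 0 < delta -> a + delta <= b - delta ->
  trapezoid (a + delta) (b - delta) delta t <= ind a b t.
Proof.
move=> de0 ab; have [h|h] := boolP (a <= t <= b).
  by rewrite /ind h/=; exact: trapezoid_le1.
rewrite trapezoid_out ?ind_ge0//; rewrite addrK subrK.
by move: h; rewrite negb_and -!ltNge => /orP[/ltW|/ltW]; [left|right].
Qed.

Lemma ind_le_trapezoid' a b delta t : 0 < delta -> a <= b ->
  ind a b t <= trapezoid a b delta t.
Proof.
move=> de0 ab; have [h|h] := boolP (a <= t <= b).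
  by rewrite trapezoid_itv// ind_le1.
by rewrite /ind (negbTE h); exact: trapezoid_ge0.
Qed.

Lemma ind_clamp a b t : 0 <= t <= d%:R ->
  ind a b t = ind (Num.max a 0) (Num.min b d%:R) t.
Proof.
move=> /andP[t0 td]; rewrite /ind; congr (nat_of_bool _)%:R.
by rewrite ge_max le_min t0 td !andbT.
Qed.

(** Sandwich the indicator of the slab between two trapezoids with ramps of width
    [delta]. The ramps cover slabs of volume [O (delta)], as the [i]-th coordinate of
    the normal is bounded below, and smoothing costs only the factor [delta ^ - eps]
    in the coefficient sums; so [delta] can be taken as small as [1 / N]. *)
Lemma slab_discrepancy C g (gamma eps c0 : R) (v : nat -> 'rV[R]_d) :
  (0 < d)%N -> cutoff C g -> (forall x, 0 <= g x) -> gamma <= 1 -> 0 < eps ->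
  0 < c0 -> uniformly_distributed gamma v ->
  exists2 K : R, 0 <= K & forall y i a b N, cube y -> c0 <= y ord0 i -> (0 < N)%N ->
    `|N%:R^-1 * (\sum_(n < N) g (v n.+1) * ind a b (dot (v n.+1) y)) -
      \int[mu]_(x in cube) (g x * ind a b (dot x y))| <= K * N%:R `^ (eps - gamma).
Proof.
move=> d0 cg g0 gamma1 eps0 c00 ud.
have [kappa [K1 [kappa0 K10 K1P]]] := trig_approx_trapezoid d0 cg eps0.
have [K2 K20 K2P] := trig_approx_discrepancy kappa0 ud.
have C0 : 0 <= C by apply: le_trans (cutoff_bound cg 0).
have gC x : g x <= C by apply: le_trans (ler_norm _) (cutoff_bound cg x).
have mg : measurable_fun cube g.
  have [B B0 BP] := trig_approx_modulated cg.
  have := BP 2^-1 0; rewrite invr_gt0 ltr0n lexx => /(_ isT) H.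
  apply: (@trig_approx_measurable _ _ 2^-1 (B * wt 2^-1 (0 : 'rV[R]_d))).
  by move: H; congr trig_approx; apply/funext => x; rewrite dotC dot0r ec0 mulr1.
pose K := K2 * K1 + 4 * C / c0.
have K0 : 0 <= K by rewrite addr_ge0 ?mulr_ge0// ?invr_ge0 ltW.
exists K => // y i a b N cy ciy N0.
have NR0 : 0 < N%:R :> R by rewrite ltr0n.
have NR1 : 1 <= N%:R :> R by rewrite ler1n.
have [cv _] := ud; have cvn n : cube (v n.+1) by exact: cv.
have dotd x : cube x -> 0 <= dot x y <= d%:R.
  by move=> cx; rewrite dot_cube_ge0 ?dot_cube_le.
(* [dot x y] ranges over [0, d], and the trapezoids are controlled for slabs with
   end points there *)
pose a' := Num.max a 0; pose b' := Num.min b d%:R.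
have -> : \sum_(n < N) g (v n.+1) * ind a b (dot (v n.+1) y) =
    \sum_(n < N) g (v n.+1) * ind a' b' (dot (v n.+1) y).
  by apply: eq_bigr => n _; rewrite ind_clamp// dotd.
rewrite (eq_Rintegral _ (g := fun x => g x * ind a' b' (dot x y))); last first.
  by move=> x; rewrite inE => cx; rewrite ind_clamp// dotd.
have a'0 : 0 <= a' by rewrite le_max lexx orbT.
have b'd : b' <= d%:R by rewrite ge_min lexx orbT.
move: a' b' a'0 b'd => {}a {}b a0 bd.
have [ab|ba] := lerP a b; last first.
  have ind0 t : ind a b t = 0.
    rewrite /ind; case: andP => // -[h1 h2].
    by have := lt_le_trans ba (le_trans h1 h2); rewrite ltxx.
  rewrite big1 => [|n _]; last by rewrite ind0 mulr0.
  rewrite (eq_Rintegral _ (g := fun=> 0)) => [|x _]; last by rewrite ind0 mulr0.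
  by rewrite Rintegral_cube_cst mulr0 subrr normr0 mulr_ge0 ?powR_ge0.
pose delta : R := N%:R^-1; have de0 : 0 < delta by rewrite invr_gt0.
have de1 : delta <= 1 by rewrite invf_le1.
pose avg (f : R -> R) := N%:R^-1 * (\sum_(n < N) g (v n.+1) * f (dot (v n.+1) y)).
pose I (f : R -> R) := \int[mu]_(x in cube) (g x * f (dot x y)).
pose P := N%:R `^ (eps - gamma).
have PE : delta `^ (- eps) * N%:R `^ (- gamma) = P.
  rewrite /delta powRV ?(ltW NR0)// opprK -powRD//.
  by apply/implyP => _; rewrite gt_eqF.
have deP : delta <= P.
  by rewrite /delta -powR_inv1 ?(ltW NR0)//; apply: ler_powR => //; lra.
have P0 : 0 <= P by exact: powR_ge0.
have trapP a1 b1 : 0 <= a1 -> a1 <= b1 -> b1 <= d%:R ->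
    `|avg (trapezoid a1 b1 delta) - I (trapezoid a1 b1 delta)| <= K2 * K1 * P.
  move=> a10 ab1 b1d; have de01 : 0 < delta <= 1 by rewrite de0 de1.
  have := K2P _ _ N (K1P y a1 b1 delta cy de01 a10 ab1 b1d) N0.
  rewrite (_ : K2 * (K1 * delta `^ (- eps)) * N%:R `^ (- gamma) = K2 * K1 * P)//.
  by rewrite -PE; ring.
have mc := @measurable_cube R d.
have bnd (f : R -> R) : (forall t, 0 <= f t) -> (forall t, f t <= 1) ->
    forall x, cube x -> `|g x * f (dot x y)| <= C.
  move=> f0 f1 x _; rewrite ger0_norm ?mulr_ge0//.
  by apply: le_trans (gC x); rewrite ler_piMr.
have intind u w : mu.-integrable cube (EFin \o (fun x => g x * ind u w (dot x y))).
  apply: (@cube_integrable _ _ _ C); last by apply: bnd => t; [exact: ind_ge0|exact: ind_le1].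
  by apply: measurable_funM => //; apply: measurable_funTS; exact: measurable_ind.
have inttr a1 b1 : 0 <= a1 -> a1 <= b1 -> b1 <= d%:R ->
    mu.-integrable cube (EFin \o (fun x => g x * trapezoid a1 b1 delta (dot x y))).
  move=> a10 ab1 b1d; have de01 : 0 < delta <= 1 by rewrite de0 de1.
  apply: (@cube_integrable _ _ _ C).
    exact: trig_approx_measurable (K1P y a1 b1 delta cy de01 a10 ab1 b1d).
  by apply: bnd => t; [exact: trapezoid_ge0|exact: trapezoid_le1].
have Iind u w : u <= w -> I (ind u w) <= C / c0 * (w - u).
  move=> uw; rewrite mulrAC -mulrA.
  apply: (@le_trans _ _ (\int[mu]_(x in cube) (C * ind u w (dot x y)))).
    apply: le_Rintegral => //.
      apply: (@cube_integrable _ _ _ C) => [|x _].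
        by apply: measurable_funM => //; apply: measurable_funTS; exact: measurable_ind.
      by rewrite ger0_norm ?mulr_ge0 ?ind_ge0// ler_piMr ?ind_le1.
    by move=> x _; rewrite ler_wpM2r ?ind_ge0.
  rewrite RintegralZl//; first by rewrite ler_wpM2l// (Rintegral_ind_le c00 ciy).
  apply: (@cube_integrable _ _ _ 1) => [|x _].
    by apply: measurable_funTS; exact: measurable_ind.
  by rewrite ger0_norm ?ind_ge0 ?ind_le1.
have avgle (f1 f2 : R -> R) : (forall t, f1 t <= f2 t) -> avg f1 <= avg f2.
  move=> f12; rewrite ler_wpM2l ?invr_ge0//; apply: ler_sum => n _.
  by rewrite ler_wpM2l.
have Ile3 (f f1 f2 f3 : R -> R) : (forall t, f t <= f1 t + (f2 t + f3 t)) ->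
    mu.-integrable cube (EFin \o (fun x => g x * f (dot x y))) ->
    mu.-integrable cube (EFin \o (fun x => g x * f1 (dot x y))) ->
    mu.-integrable cube (EFin \o (fun x => g x * f2 (dot x y))) ->
    mu.-integrable cube (EFin \o (fun x => g x * f3 (dot x y))) ->
    I f <= I f1 + (I f2 + I f3).
  move=> ff i0 i1 i2 i3; rewrite /I -(RintegralD mc i2 i3) -RintegralD//.
    apply: le_Rintegral => //.
      by apply: (cube_integrableD i1); exact: cube_integrableD.
    by move=> x _; rewrite -!mulrDr ler_wpM2l.
  exact: cube_integrableD.
pose E := C / c0 * delta; have E0 : 0 <= E by rewrite mulr_ge0 ?divr_ge0 ?(ltW c00) ?(ltW de0).
have KP : K2 * K1 * P + 2 * E <= K * P.
  rewrite /K [leRHS]mulrDl lerD2l /E.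
  apply: (@le_trans _ _ (4 * C / c0 * delta)).
    by rewrite mulrA [2 * _]mulrA ler_wpM2r ?(ltW de0)// ler_wpM2r ?invr_ge0 ?(ltW c00)// ler_wpM2r// ler_nat.
  by rewrite ler_wpM2l// divr_ge0 ?mulr_ge0// ltW.
rewrite -/(avg (ind a b)) -/(I (ind a b)) -/P.
have up : avg (ind a b) <= I (ind a b) + 2 * E + K2 * K1 * P.
  apply: le_trans (avgle _ _ (fun t => ind_le_trapezoid' t de0 ab)) _.
  have /ler_normlP[_ h1] := trapP a b a0 ab bd.
  have h2 := Ile3 _ _ _ _ (fun t => trapezoid_le_ind t de0 ab) (inttr a b a0 ab bd)
    (intind a b) (intind (a - delta) a) (intind b (b + delta)).
  have h3 : I (ind (a - delta) a) <= E.
    by apply: le_trans (Iind _ _ _) _; rewrite ?gerBl ?(ltW de0)// opprB addrCA subrr addr0.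
  have h4 : I (ind b (b + delta)) <= E.
    by apply: le_trans (Iind _ _ _) _; rewrite ?lerDl ?(ltW de0)// addrAC subrr add0r.
  lra.
have lo : I (ind a b) - 2 * E - K2 * K1 * P <= avg (ind a b).
  have [ab'|ab'] := lerP (a + delta) (b - delta).
    apply: le_trans (avgle _ _ (fun t => trapezoid_le_ind' t de0 ab')).
    have a0' : 0 <= a + delta by rewrite addr_ge0 ?(ltW de0).
    have bd' : b - delta <= d%:R by rewrite (le_trans _ bd)// gerBl ltW.
    have /ler_normlP[h1 _] := trapP _ _ a0' ab' bd'.
    have h2 := Ile3 _ _ _ _ (fun t => ind_le_trapezoid t de0 ab') (intind a b)
      (inttr _ _ a0' ab' bd') (intind a (a + delta)) (intind (b - delta) b).
    have h3 : I (ind a (a + delta)) <= E.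
      by apply: le_trans (Iind _ _ _) _; rewrite ?lerDl ?(ltW de0)// addrAC subrr add0r.
    have h4 : I (ind (b - delta) b) <= E.
      by apply: le_trans (Iind _ _ _) _; rewrite ?gerBl ?(ltW de0)// opprB addrCA subrr addr0.
    lra.
  (* the slab is too thin to contain a trapezoid, but then its volume is [O (delta)] *)
  have h1 : 0 <= avg (ind a b).
    by rewrite mulr_ge0 ?invr_ge0//; apply: sumr_ge0 => n _; rewrite mulr_ge0 ?ind_ge0.
  have h2 : I (ind a b) <= 2 * E.
    apply: le_trans (Iind _ _ ab) _; rewrite /E mulrCA ler_wpM2l ?divr_ge0 ?(ltW c00)//; lra.
  have h3 : 0 <= K2 * K1 * P by rewrite !mulr_ge0.
  lra.
by rewrite ler_norml; apply/andP; split; lra.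
Qed.

End slab.

(** * Cut-off functions *)

Section coordinate_lipschitz.
Context {R : realType} {d : nat}.
Local Notation "'e_ i" := (delta_mx ord0 i : 'rV[R]_d) (at level 8).

Lemma lipschitz_of_coord (g : 'rV[R]_d -> R) (C : R) :
  (forall x i (t : R), `|g (x + t *: 'e_ i) - g x| <= C * `|t|) -> 0 <= C ->
  forall (x x' : 'rV[R]_d) (r : R), (forall i, `|x ord0 i - x' ord0 i| <= r) ->
  `|g x - g x'| <= d%:R * C * r.
Proof.
move=> gC C0 x x' r xr.
pose z (k : nat) : 'rV[R]_d := \row_i (if (i < k)%N then x' ord0 i else x ord0 i).
have zP k : (k <= d)%N -> `|g x - g (z k)| <= k%:R * C * r.
  elim: k => [_|k IH kd].
    rewrite (_ : z 0%N = x) ?subrr ?normr0 ?mul0r//.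
    by apply/rowP => i; rewrite mxE ltn0.
  pose i := Ordinal kd.
  have -> : z k.+1 = z k + (x' ord0 i - x ord0 i) *: 'e_ i.
    apply/rowP => j; rewrite !mxE ltnS; case: (ltngtP j k) => jk.
    - by rewrite (_ : j == i = false) ?andbF ?mulr0 ?addr0// -val_eqE/= ltn_eqF.
    - by rewrite (_ : j == i = false) ?andbF ?mulr0 ?addr0// -val_eqE/= gtn_eqF.
    - have -> : j = i by apply/val_inj.
      by rewrite !eqxx mulr1 addrC subrK.
  set w := z k; set t := x' ord0 i - x ord0 i.
  have -> : g x - g (w + t *: 'e_ i) = (g x - g w) - (g (w + t *: 'e_ i) - g w) by ring.
  apply: (le_trans (ler_normB _ _)); rewrite -natr1 !mulrDl mul1r; apply: lerD.
    by apply: IH; exact: ltnW.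
  apply: (le_trans (gC _ _ _)); rewrite ler_wpM2l//.
  by rewrite /t distrC; exact: xr.
have := zP d (leqnn d); rewrite (_ : z d = x')//.
by apply/rowP => i; rewrite mxE ltn_ord.
Qed.

End coordinate_lipschitz.

Section smooth_cutoff.
Context {R : realType} {d : nat}.
Local Notation V := ('rV[R]_d).
Local Notation "'e_ i" := (delta_mx ord0 i : 'rV[R]_d) (at level 8).
Implicit Types (g : V -> R) (s : seq 'I_d).

Lemma partials_support g s x : smooth g -> ~ closed_support g x -> partials s g x = 0.
Proof.
move=> sg; elim: s x => [|i s IH] x gx /=.
  apply/eqP/negPn/negP => gx0; apply: gx; exact: subset_closure.
rewrite (near_eq_derive (g := cst 0)); first exact: derive_cst.
have : open (~` closed_support g) by apply: closed_openC; exact: closed_closure.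
move=> /(_ x gx); apply: filterS => y gy; exact: IH.
Qed.

Lemma cube_compact : compact (@cube R d).
Proof.
rewrite (_ : cube = [set v : V | forall i, `[0, 1]%classic (v ord0 i)]).
  by apply: (@rV_compact R d (fun=> `[0, 1]%classic)) => i; exact: segment_compact.
by apply/seteqP; split=> x /= cx i; have := cx i; rewrite /= in_itv.
Qed.

Lemma partials_bounded g s : smooth g -> closed_support g `<=` open_cube ->
  exists C, forall x, `|partials s g x| <= C.
Proof.
move=> sg gc; have [cs _] := sg s.
have : bounded_set (partials s g @` cube).
  apply: compact_bounded; apply: continuous_compact; last exact: cube_compact.
  by apply: continuous_subspaceT => x; exact: cs.
move=> [M [_ MP]]; exists (`|M| + 1) => x.
have M1 : M < `|M| + 1 by rewrite (le_lt_trans (ler_norm M))// ltrDl.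
have [cx|ncx] := pselect (cube x); first by apply: (MP _ M1); exists x.
rewrite partials_support ?normr0 ?addr_ge0// => /gc ox; apply: ncx => i.
by have /andP[/ltW -> /ltW ->] := ox i.
Qed.

(** Closed under partial derivatives, so that one can induct on the number of second
    differences. *)
Definition bounded_smooth g := forall s,
  (exists C, forall x, `|partials s g x| <= C) /\
  forall i x, derivable (partials s g) x 'e_ i.

Lemma bounded_smooth_partials g s : bounded_smooth g -> bounded_smooth (partials s g).
Proof.
move=> bg s'; suff -> : partials s' (partials s g) = partials (s' ++ s) g by exact: bg.
by elim: s' => //= i s' ->.
Qed.

Lemma is_derive_shift g (a x v : V) (l : R) : is_derive (x + a) v g l ->
  is_derive x v (fun y => g (y + a)) l.
Proof.
have E : (fun h : R => h^-1 *: (((fun y => g (y + a)) \o shift x) (h *: v) - g (x + a))) =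
    (fun h : R => h^-1 *: ((g \o shift (x + a)) (h *: v) - g (x + a))).
  by apply/funext => h /=; rewrite addrA.
by case=> dg <-; apply: DeriveDef; rewrite ?/derivable /derive /= E.
Qed.

Lemma is_derive_line g (x v : V) (t l : R) : is_derive (x + t *: v) v g l ->
  is_derive t (1 : R) (fun t : R => g (x + t *: v)) l.
Proof.
have E : (fun h : R => h^-1 *: (((fun t : R => g (x + t *: v)) \o shift t) (h *: (1 : R)) - g (x + t *: v))) =
    (fun h : R => h^-1 *: ((g \o shift (x + t *: v)) (h *: v) - g (x + t *: v))).
  by apply/funext => h; rewrite /= -[h%:A]/(h * 1) mulr1 scalerDl addrCA.
by case=> dg <-; apply: DeriveDef; rewrite ?/derivable /derive /= E.
Qed.

Lemma mvt_line (f df : R -> R) (a b C : R) : (forall t, is_derive t (1 : R) f (df t)) ->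
  (forall t, `|df t| <= C) -> `|f b - f a| <= C * `|b - a|.
Proof.
move=> fd dfC; wlog ab : a b / a <= b => [H|].
  have [/H//|/H] := orP (le_total a b); by rewrite distrC (distrC a).
have cf : continuous f.
  by move=> t; apply/differentiable_continuous/derivable1_diffP; have [] := fd t.
have [c _ ->] := MVT_segment ab (fun x _ => fd x) (continuous_subspaceT cf).
by rewrite normrM ler_wpM2r.
Qed.

(** The mean value theorem, twice: a second difference is the increment over a step
    [h] of a first difference with step [h]. *)
Lemma second_difference_le g g1 g2 (v : V) (C : R) :
  (forall x, is_derive x v g (g1 x)) -> (forall x, is_derive x v g1 (g2 x)) ->
  (forall x, `|g2 x| <= C) -> forall x (h : R),
  `|g (x + h *: v) + g (x - h *: v) - 2 * g x| <= C * h ^+ 2.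
Proof.
move=> gd g1d g2C x h.
pose f (t : R) := g (x + h *: v + t *: v) - g (x + t *: v).
pose df (t : R) := g1 (x + h *: v + t *: v) - g1 (x + t *: v).
have fd t : is_derive t (1 : R) f (df t).
  by apply: is_deriveB; apply: is_derive_line.
have dfC t : `|df t| <= C * `|h|.
  rewrite /df -addrA -scalerDl.
  have := @mvt_line (fun t => g1 (x + t *: v)) (fun t => g2 (x + t *: v)) t (h + t) C.
  rewrite addrK; apply => u; last exact: g2C.
  exact: is_derive_line.
have := mvt_line (- h) 0 fd dfC; rewrite /f !scale0r !addr0 scaleNr addrK sub0r opprK.
rewrite -mulrA -expr2 real_normK ?num_real//.
by apply: le_trans; rewrite le_eqVlt; apply/orP; left; apply/eqP; congr `|_|; ring.
Qed.

Lemma is_derive_Lops M s g g1 (v : V) : (forall x, is_derive x v g (g1 x)) ->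
  forall x, is_derive x v (Lops M s g) (Lops M s g1 x).
Proof.
move=> gd; elim: s => [//|i s IH] x /=.
rewrite /Lop; set F := Lops M s g in IH *; set F1 := Lops M s g1 in IH *.
have d1 := is_derive_shift (IH (x + M%:R^-1 *: 'e_ i)).
have d2 := is_derive_shift (IH (x - M%:R^-1 *: 'e_ i)).
have d0 := IH x.
have dA := is_deriveB (is_deriveD d1 d2) (is_deriveZ 2 d0).
have := is_deriveB d0 (is_deriveZ (M%:R ^+ 2) dA).
exact.
Qed.

(** Bound the outer operator by a second derivative in its direction, which commutes
    with the remaining difference operators. *)
Lemma Lops_bounded g s : bounded_smooth g ->
  exists C, forall M x, (0 < M)%N -> `|Lops M s g x| <= C.
Proof.
elim: s g => [|i s IH] g bg.
  by have [[C gC] _] := bg [::]; exists C => M x _; exact: gC.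
have [C1 C1P] := IH g bg.
have [C2 C2P] := IH _ (bounded_smooth_partials [:: i; i] bg).
exists (C1 + C2) => M x M0 /=; rewrite /Lop.
apply: (le_trans (ler_normB _ _)); apply: lerD; first exact: C1P.
have MR0 : M%:R != 0 :> R by rewrite pnatr_eq0 -lt0n.
rewrite normrM ger0_norm ?sqr_ge0//.
have -> : C2 = M%:R ^+ 2 * (C2 * M%:R^-1 ^+ 2) by field.
rewrite ler_wpM2l ?sqr_ge0//.
apply: (@second_difference_le _ (Lops M s (partials [:: i] g))
  (Lops M s (partials [:: i; i] g))) => [y|y|y]; last exact: C2P.
  apply: is_derive_Lops => z; apply: DeriveDef => //.
  by have [_] := bg [::]; exact.
apply: is_derive_Lops => z; apply: DeriveDef => //.
by have [_] := bg [:: i]; exact.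
Qed.

Lemma smooth_cutoff g : smooth g -> closed_support g `<=` open_cube ->
  exists C, cutoff C g.
Proof.
move=> sg gc.
have bg : bounded_smooth g.
  move=> s; split; first exact: partials_bounded.
  by have [_] := sg s.
have [C0 C0P] := partials_bounded [::] sg gc.
have [C1 C1P] := Lops_bounded (enum 'I_d) bg.
have [C2 C2P] : exists C2 : R, forall i x, `|partials [:: i] g x| <= C2.
  have /choice[F FP] : forall i, exists C, forall x, `|partials [:: i] g x| <= C.
    by move=> i; exact: partials_bounded.
  exists (\sum_i `|F i|) => i x; apply: (le_trans (FP i x)).
  by rewrite (bigD1 i)//=; apply: (le_trans (ler_norm _)); rewrite lerDl sumr_ge0.
have C00 : 0 <= C0 by apply: le_trans (C0P 0).
have C10 : 0 <= C1 by apply: le_trans (C1P 1%N 0 isT).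
have C2a : 0 <= `|C2| by [].
have dC2 : 0 <= d%:R * `|C2| by rewrite mulr_ge0.
exists (C0 + C1 + d%:R * `|C2|); split.
- move=> i x xi; have := @partials_support g [::] x sg; apply => /gc /(_ i).
  by move: xi => /negP.
- by move=> x; apply: (le_trans (C0P x)); lra.
- by move=> M x M0; apply: (le_trans (C1P M x M0)); lra.
move=> x x' r r0 xr.
apply: (@le_trans _ _ (d%:R * `|C2| * r)); last by rewrite ler_wpM2r//; lra.
apply: lipschitz_of_coord => // y i t.
have := @mvt_line (fun t => g (y + t *: 'e_ i)) (fun t => partials [:: i] g (y + t *: 'e_ i)) 0 t `|C2|.
rewrite scale0r addr0 subr0; apply => u.
  apply: is_derive_line; apply: DeriveDef => //.
  by have [_] := bg [::]; exact.
exact: le_trans (C2P i _) (ler_norm _).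
Qed.

End smooth_cutoff.

Section spline_bump.
Context {R : realType}.
Implicit Types (t h c : R).

(** A [C^1] function with Lipschitz derivative, positive exactly on [(0, 1)]: this
    much smoothness bounds its second differences. *)
Definition bump01 t : R := (clamp01 t * (1 - clamp01 t)) ^+ 2.

Lemma clamp01_itv t : 0 <= clamp01 t <= 1.
Proof. by rewrite clamp01_ge0 clamp01_le1. Qed.

Lemma bump_ge0 t : 0 <= bump01 t. Proof. exact: sqr_ge0. Qed.

Lemma bump_le1 t : bump01 t <= 1.
Proof.
have /andP[c0 c1] := clamp01_itv t.
rewrite /bump01 exprn_ile1 ?mulr_ge0 ?subr_ge0// mulr_ile1 ?subr_ge0//.
by rewrite gerBl.
Qed.

Lemma bump_out t : ~~ (0 < t < 1) -> bump01 t = 0.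
Proof.
rewrite negb_and -!leNgt => /orP[t0|t1]; rewrite /bump01.
  by rewrite clamp01_0// mul0r expr0n.
by rewrite clamp01_1// subrr mulr0 expr0n.
Qed.

Lemma bump_lip t t' : `|bump01 t - bump01 t'| <= `|t - t'|.
Proof.
apply: le_trans (clamp01_lip t t'); rewrite /bump01.
have /andP[c0 c1] := clamp01_itv t; have /andP[e0 e1] := clamp01_itv t'.
move: (clamp01 t) (clamp01 t') c0 c1 e0 e1 => c e c0 c1 e0 e1.
rewrite subr_sqr (_ : c * (1 - c) - e * (1 - e) = (c - e) * (1 - c - e)); last by ring.
rewrite -mulrA normrM ler_piMr// normrM mulr_ile1//.
  by rewrite ler_norml; apply/andP; split; lra.
have h (x : R) : 0 <= x -> x <= 1 -> 0 <= x * (1 - x) <= 4^-1.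
  move=> x0 x1; rewrite mulr_ge0 ?subr_ge0//=.
  have := sqr_ge0 (x - 2^-1); rewrite sqrrB; lra.
have /andP[? ?] := h c c0 c1; have /andP[? ?] := h e e0 e1.
by rewrite ler_norml; apply/andP; split; lra.
Qed.

(** The square vanishes to second order at the corners [0] and [1] of [clamp01], so
    the remainder of the expansion stays quadratic across them. *)
Lemma bump_taylor t h : exists D,
  (forall h, `|bump01 (t + h) - bump01 t - D * h| <= 4 * h ^+ 2).
Proof.
exists (2 * (clamp01 t * (1 - clamp01 t)) * (1 - 2 * clamp01 t)) => {}h.
rewrite /bump01; set c := clamp01 t; set e := clamp01 (t + h).
have /andP[c0 c1] : 0 <= c <= 1 := clamp01_itv t.
have /andP[e0 e1] : 0 <= e <= 1 := clamp01_itv (t + h).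
have ech : `|e - c| <= `|h|.
  by have := clamp01_lip (t + h) t; rewrite addrAC subrr add0r.
have ech2 : (e - c) ^+ 2 <= h ^+ 2.
  by rewrite -[leLHS]real_normK ?num_real// -[leRHS]real_normK ?num_real// ler_pXn2r ?nnegrE.
set q := c * (1 - c).
have q0 : 0 <= q by rewrite mulr_ge0 ?subr_ge0.
have q4 : q <= 4^-1 by have := sqr_ge0 (c - 2^-1); rewrite /q sqrrB; lra.
have -> : (e * (1 - e)) ^+ 2 - q ^+ 2 - 2 * q * (1 - 2 * c) * h =
    (e - c) ^+ 2 * ((1 - c - e) ^+ 2 - 2 * q) - 2 * q * (1 - 2 * c) * (h - (e - c)).
  by rewrite /q; ring.
apply: (le_trans (ler_normB _ _)).
have -> : 4 * h ^+ 2 = 2 * h ^+ 2 + 2 * h ^+ 2 by ring.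
apply: lerD.
  rewrite normrM [`|_ ^+ 2|]ger0_norm ?sqr_ge0// mulrC.
  apply: ler_pM => //; first exact: sqr_ge0.
  have : (1 - c - e) ^+ 2 <= 1.
    rewrite -[leRHS](expr1n _ 2) -[leLHS]real_normK ?num_real//.
    by rewrite ler_pXn2r ?nnegrE// ler_norml; apply/andP; split; lra.
  have := sqr_ge0 (1 - c - e).
  by move=> ? ?; rewrite ler_norml; apply/andP; split; lra.
have c21 : `|1 - 2 * c| <= 1 by rewrite ler_norml; apply/andP; split; lra.
suff H : q * `|h - (e - c)| <= h ^+ 2.
  have -> : 2 * q * (1 - 2 * c) * (h - (e - c)) =
      2 * (q * ((1 - 2 * c) * (h - (e - c)))) by ring.
  rewrite normrM [`|2|]ger0_norm// ler_wpM2l// normrM (ger0_norm q0) normrM.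
  by apply: le_trans H; rewrite ler_wpM2l// ler_piMl.
have hh : `|h - (e - c)| <= `|h| -> q <= `|h| -> q * `|h - (e - c)| <= h ^+ 2.
  move=> h1 h2; rewrite -[leRHS]real_normK ?num_real// expr2.
  by apply: ler_pM.
have hec : `|h - (e - c)| <= `|h|.
  have [h0|h0] := lerP 0 h.
    have ec : c <= e by apply: clamp01_homo; rewrite lerDl.
    move: ech; rewrite !(ger0_norm h0) ger0_norm ?subr_ge0// => H.
    by rewrite ger0_norm ?subr_ge0//; lra.
  have ec : e <= c by apply: clamp01_homo; rewrite gerDl ltW.
  move: ech; rewrite !(ltr0_norm h0) ler0_norm ?subr_le0// => H.
  by rewrite ler0_norm ?subr_le0//; lra.
have [E|hne] := eqVneq h (e - c).
  by rewrite -E subrr normr0 mulr0 sqr_ge0.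
apply: hh => //.
have [t0|t0] := lerP t 0; first by rewrite /q /c clamp01_0// mul0r.
have [t1|t1] := lerP 1 t; first by rewrite /q /c clamp01_1// subrr mulr0.
have cE : c = t by rewrite /c clamp01_id// (ltW t0) (ltW t1).
have [s0|s0] := lerP (t + h) 0.
  apply: (@le_trans _ _ c); first by rewrite /q ler_piMr//; lra.
  by rewrite cE ler0_norm; lra.
have [s1|s1] := lerP 1 (t + h).
  apply: (@le_trans _ _ (1 - c)); first by rewrite /q ler_piMl//; lra.
  by rewrite cE ger0_norm; lra.
have eE : e = t + h by rewrite /e clamp01_id// (ltW s0) (ltW s1).
by move: hne; rewrite eE cE addrAC subrr add0r eqxx.
Qed.

Definition Lop1 (M : nat) (b : R -> R) (t : R) : R :=
  b t - M%:R ^+ 2 * (b (t + M%:R^-1) + b (t - M%:R^-1) - 2 * b t).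

Lemma Lop1_bump_le M t : (0 < M)%N -> `|Lop1 M bump01 t| <= 9.
Proof.
move=> M0; have MR0 : M%:R != 0 :> R by rewrite pnatr_eq0 -lt0n.
have [D HD] := bump_taylor t 0.
apply: (le_trans (ler_normB _ _)).
rewrite (_ : 9 = 1 + 8 :> R); last by lra.
apply: lerD; first by rewrite ger0_norm ?bump_ge0 ?bump_le1.
rewrite normrM ger0_norm ?sqr_ge0//.
have -> : 8 = M%:R ^+ 2 * (8 * M%:R^-1 ^+ 2) :> R by field.
rewrite ler_wpM2l ?sqr_ge0//.
have h1 := HD M%:R^-1; have h2 := HD (- M%:R^-1).
have -> : bump01 (t + M%:R^-1) + bump01 (t - M%:R^-1) - 2 * bump01 t =
  (bump01 (t + M%:R^-1) - bump01 t - D * M%:R^-1) +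
  (bump01 (t - M%:R^-1) - bump01 t - D * - M%:R^-1) by ring.
apply: (le_trans (ler_normD _ _)); move: h1 h2; rewrite sqrrN.
by move=> h1 h2; apply: (le_trans (lerD h1 h2)); lra.
Qed.

End spline_bump.

Section bump_cutoff.
Context {R : realType} {d : nat}.
Local Notation V := ('rV[R]_d).

Definition bumps (x : V) : R := \prod_i bump01 (x ord0 i).

Lemma Lop_prod M (i : 'I_d) (b : 'I_d -> R -> R) :
  Lop M i (fun x : V => \prod_j b j (x ord0 j)) =
  fun x => \prod_j (if j == i then Lop1 M (b j) else b j) (x ord0 j).
Proof.
apply/funext => x; rewrite /Lop.
have E (y : V) : (forall j, j != i -> y ord0 j = x ord0 j) ->
    \prod_j b j (y ord0 j) = b i (y ord0 i) * \prod_(j | j != i) b j (x ord0 j).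
  by move=> yx; rewrite (bigD1 i)//=; congr (_ * _); apply: eq_bigr => j /yx ->.
rewrite !E//; last 2 first.
- by move=> j ji; rewrite !mxE (negbTE ji) andbF mulr0 subr0.
- by move=> j ji; rewrite !mxE (negbTE ji) andbF mulr0 addr0.
rewrite [RHS](bigD1 i)//= eqxx.
rewrite [in RHS](eq_bigr (fun j => b j (x ord0 j))); last first.
  by move=> j /negbTE ->.
by rewrite !mxE !eqxx mulr1 /Lop1; ring.
Qed.

(** Each operator acts on a single factor of the product. *)
Lemma Lops_prod M (s : seq 'I_d) (b : 'I_d -> R -> R) : uniq s ->
  Lops M s (fun x : V => \prod_j b j (x ord0 j)) =
  fun x => \prod_j (if j \in s then Lop1 M (b j) else b j) (x ord0 j).
Proof.
elim: s => [//|i s IH] /= /andP[si us]; rewrite IH//.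
rewrite (Lop_prod M i (fun j => if j \in s then Lop1 M (b j) else b j)).
apply/funext => x; apply: eq_bigr => j _; rewrite inE.
by case: eqVneq => [->|]//=; rewrite (negbTE si).
Qed.

Lemma bumps_ge0 (x : V) : 0 <= bumps x.
Proof. by apply: prodr_ge0 => i _; exact: bump_ge0. Qed.

Lemma prod_le1 (I : Type) (s : seq I) (P : pred I) (F : I -> R) :
  (forall i, 0 <= F i <= 1) -> \prod_(i <- s | P i) F i <= 1.
Proof.
move=> F01; elim/big_rec : _ => // i x _ x1; have /andP[F0 F1] := F01 i.
by apply: le_trans F1; rewrite ler_piMr.
Qed.

Lemma bumps_le1 (x : V) : bumps x <= 1.
Proof. by apply: prod_le1 => i; rewrite bump_ge0 bump_le1. Qed.

Lemma bumps_cutoff : exists C, cutoff C bumps.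
Proof.
exists (1 + 9 ^+ d + d%:R); split.
- by move=> i x xi; rewrite /bumps (bigD1 i)//= bump_out// mul0r.
- move=> x; rewrite ger0_norm ?bumps_ge0//; apply: (le_trans (bumps_le1 x)).
  by rewrite -addrA lerDl addr_ge0// exprn_ge0.
- move=> M x M0; rewrite /bumps (Lops_prod M (fun=> bump01)) ?enum_uniq//.
  apply: (@le_trans _ _ (9 ^+ d)); last by rewrite addrAC lerDr.
  rewrite normr_prod; apply: (@le_trans _ _ (\prod_(i < d) 9)).
    by apply: ler_prod => i _; rewrite normr_ge0 mem_enum inE/= Lop1_bump_le.
  by rewrite prodr_const card_ord.
move=> x x' r r0 xr; apply: (@le_trans _ _ (d%:R * 1 * r)); last first.
  by rewrite mulr1 ler_wpM2r// lerDr addr_ge0// exprn_ge0.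
apply: lipschitz_of_coord => // {r r0 xr}{}x i t.
have E (y : V) : (forall j, j != i -> y ord0 j = x ord0 j) ->
    bumps y = bump01 (y ord0 i) * \prod_(j | j != i) bump01 (x ord0 j).
  by move=> yx; rewrite /bumps (bigD1 i)//=; congr (_ * _); apply: eq_bigr => j /yx ->.
rewrite !E//; last by move=> j ji; rewrite !mxE (negbTE ji) andbF mulr0 addr0.
rewrite -mulrBl !mxE !eqxx mulr1 mul1r normrM.
apply: (@le_trans _ _ `|bump01 (x ord0 i + t) - bump01 (x ord0 i)|).
  rewrite ler_piMr// ger0_norm; last by apply: prodr_ge0 => j _; exact: bump_ge0.
  by apply: prod_le1 => j; rewrite bump_ge0 bump_le1.
by apply: le_trans (bump_lip _ _) _; rewrite addrAC subrr add0r.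
Qed.

End bump_cutoff.

(** * Pairs of points *)

Section weighted_volume.
Context {R : realType} {d : nat}.
Local Notation mu := (@mu R d).
Implicit Types (x y : 'rV[R]_d).

Lemma integral_cube_supp (f : 'rV[R]_d -> R) : (forall x, ~ cube x -> f x = 0) ->
  (\int[mu]_x (f x)%:E = \int[mu]_(x in cube) (f x)%:E)%E.
Proof.
move=> f0; rewrite [RHS]integral_mkcond; apply: eq_integral => x _.
by rewrite patchE; case: ifPn => //; rewrite notin_setE => /f0 ->.
Qed.

Lemma measurable_dot2 :
  measurable_fun [set: 'rV[R]_d * 'rV[R]_d] (fun z => dot z.1 z.2).
Proof.
apply: measurable_sum => i; apply: measurable_funM.
  by apply: (measurableT_comp (f := fun x : 'rV[R]_d => x ord0 i)) => //; exact: measurable_coord.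
by apply: (measurableT_comp (f := fun x : 'rV[R]_d => x ord0 i)) => //; exact: measurable_coord.
Qed.

Lemma measurable_ind1 (a b : R) : measurable_fun [set: R] (@ind R a b).
Proof.
rewrite (_ : ind a b = \1_(`[a, b])); first exact: measurable_indic.
apply/funext => t; rewrite indicE /ind; congr (_%:R); congr (nat_of_bool _).
by apply/idP/idP; rewrite inE/= in_itv.
Qed.

Lemma measurable_Omega (a b : R) : measurable (@Omega R d a b).
Proof.
rewrite (_ : Omega a b = (cube `*` cube) `&`
  ((fun z : 'rV[R]_d * 'rV[R]_d => dot z.1 z.2) @^-1` `[a, b])).
  apply: measurableI; first by apply: measurableX; exact: measurable_cube.
  by rewrite -[X in measurable X]setTI; exact: measurable_dot2.
by apply/seteqP; split=> z /=; rewrite in_itv/=; [move=> [? ? ?]|move=> [[? ?] ?]].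
Qed.

Variables (g : 'rV[R]_d -> R) (C : R).
Hypotheses (mg : measurable_fun [set: 'rV[R]_d] g) (g0 : forall x, 0 <= g x).
Hypotheses (gC : forall x, g x <= C) (gc : forall x, ~ cube x -> g x = 0).

(** The [g]-weighted volume of a slab with normal [y]. *)
Definition slab_mean (a b : R) (y : 'rV[R]_d) : R :=
  \int[mu]_(x in cube) (g x * ind a b (dot x y)).

Let gind_ge0 a b x y : 0 <= g x * ind a b (dot x y).
Proof. by rewrite mulr_ge0 ?ind_ge0. Qed.

Let gind_le a b x y : `|g x * ind a b (dot x y)| <= C.
Proof. by rewrite ger0_norm//; apply: le_trans (gC x); rewrite ler_piMr ?ind_le1. Qed.

Let gind_integrable a b y : mu.-integrable cube (EFin \o (fun x => g x * ind a b (dot x y))).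
Proof.
apply: (@cube_integrable _ _ _ C) => [|x _]; last exact: gind_le.
by apply: measurable_funTS; apply: measurable_funM => //; exact: measurable_ind.
Qed.

Lemma slab_mean_ge0 a b y : 0 <= slab_mean a b y.
Proof. by apply: Rintegral_ge0 => x _. Qed.

Lemma slab_mean_le a b y : slab_mean a b y <= C.
Proof.
apply: le_trans (ler_norm _) _; apply: Rintegral_cube_norm_le => [|x _]; last exact: gind_le.
by apply: measurable_funTS; apply: measurable_funM => //; exact: measurable_ind.
Qed.

Lemma EFin_slab_mean a b y :
  ((slab_mean a b y)%:E = \int[mu]_x (g x * ind a b (dot x y))%:E)%E.
Proof.
rewrite integral_cube_supp; last by move=> x /gc ->; rewrite mul0r.
rewrite fineK//; apply: integrable_fin_num; first exact: measurable_cube.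
exact: gind_integrable.
Qed.

Lemma measurable_slab_mean a b : measurable_fun [set: 'rV[R]_d] (slab_mean a b).
Proof.
apply/measurable_EFinP.
pose F (z : 'rV[R]_d * 'rV[R]_d) := (g z.2 * ind a b (dot z.1 z.2))%:E.
rewrite (_ : EFin \o _ = fun y => \int[mu]_x F (y, x))%E; last first.
  by apply/funext => y /=; rewrite EFin_slab_mean; apply: eq_integral => x _; rewrite /F /= dotC.
apply: (measurable_fun_fubini_tonelli_F (m2 := mu) F) => [|z]; last first.
  by rewrite lee_fin mulr_ge0 ?ind_ge0.
apply/measurable_EFinP; apply: measurable_funM; first exact: measurableT_comp.
by apply: measurableT_comp; [exact: measurable_ind1|exact: measurable_dot2].
Qed.

Lemma integrable_slab_mean a b :
  mu.-integrable cube (EFin \o (fun x => g x * slab_mean a b x)).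
Proof.
apply: (@cube_integrable _ _ _ (C * C)) => [|x _].
  by apply: measurable_funTS; apply: measurable_funM => //; exact: measurable_slab_mean.
by rewrite ger0_norm ?mulr_ge0 ?slab_mean_ge0//; apply: ler_pM; rewrite ?slab_mean_ge0 ?slab_mean_le.
Qed.

Lemma integral_Omega a b :
  (\int[mu \x mu]_(z in Omega a b) (g z.1 * g z.2)%:E =
   (\int[mu]_(x in cube) (g x * slab_mean a b x))%:E)%E.
Proof.
rewrite integral_mkcond.
pose F (z : 'rV[R]_d * 'rV[R]_d) := (g z.1 * (g z.2 * ind a b (dot z.2 z.1)))%:E.
rewrite (_ : _ \_ _ = F); last first.
  apply/funext => z; rewrite patchE /F dotC; case: ifPn.
    by rewrite inE => -[_ _ H]; rewrite /ind H mulr1.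
  rewrite notin_setE => Oz.
  have [c1|/gc ->] := pselect (cube z.1); last by rewrite mul0r.
  have [c2|/gc ->] := pselect (cube z.2); last by rewrite mul0r mulr0.
  rewrite /ind; case: (boolP (a <= dot z.1 z.2 <= b)) => H; last by rewrite !mulr0.
  by case: Oz.
rewrite fubini_tonelli1; last 2 first.
- apply/measurable_EFinP; apply: measurable_funM; first exact: measurableT_comp.
  apply: measurable_funM; first exact: measurableT_comp.
  apply: measurableT_comp; first exact: measurable_ind1.
  rewrite (_ : (fun z => dot z.2 z.1) = fun z => dot z.1 z.2); first exact: measurable_dot2.
  by apply/funext => z; rewrite dotC.
- by move=> z; rewrite lee_fin !mulr_ge0 ?ind_ge0.
rewrite (eq_integral (fun x => (g x * slab_mean a b x)%:E)) => [|x _].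
  rewrite integral_cube_supp; last by move=> x /gc ->; rewrite mul0r.
  rewrite fineK//; apply: integrable_fin_num; first exact: measurable_cube.
  exact: integrable_slab_mean.
rewrite /fubini_F /F /= EFinM EFin_slab_mean -ge0_integralZl_EFin//.
- by move=> y _; rewrite lee_fin.
- apply/measurable_EFinP; apply: measurable_funM => //; exact: measurable_ind.
Qed.

End weighted_volume.

Section pairs.
Context {R : realType} {d : nat}.
Local Notation mu := (@mu R d).

Lemma cube_integrable_sum (I : Type) (s : seq I) (F : I -> 'rV[R]_d -> R) :
  (forall i, mu.-integrable cube (EFin \o F i)) ->
  mu.-integrable cube (EFin \o (fun x => \sum_(i <- s) F i x)).
Proof.
move=> iF; elim: s => [|i s IH].
  rewrite (_ : (fun x => _) = fun=> 0); last by apply/funext => x; rewrite big_nil.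
  by apply: (@cube_integrable _ _ _ 0) => // x _; rewrite normr0.
rewrite (_ : (fun x => _) = fun x => F i x + \sum_(j <- s) F j x).
  exact: cube_integrableD.
by apply/funext => x; rewrite big_cons.
Qed.

Lemma Rintegral_cube_sum (I : Type) (s : seq I) (F : I -> 'rV[R]_d -> R) :
  (forall i, mu.-integrable cube (EFin \o F i)) ->
  \int[mu]_(x in cube) (\sum_(i <- s) F i x) = \sum_(i <- s) \int[mu]_(x in cube) F i x.
Proof.
move=> iF; elim: s => [|i s IH].
  rewrite big_nil (eq_Rintegral _ (g := fun=> 0)) ?Rintegral_cube_cst// => x _.
  by rewrite big_nil.
rewrite big_cons -IH -RintegralD//; last 2 first.
- exact: measurable_cube.
- exact: cube_integrable_sum.
by apply: eq_Rintegral => x _; rewrite big_cons.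
Qed.

Lemma slab_coord (x y : 'rV[R]_d) : cube x -> cube y -> (0 < d)%N ->
  100^-1 <= dot x y -> exists i, (200 * d%:R)^-1 <= y ord0 i.
Proof.
move=> cx cy d0 xy; apply: contrapT => /forallNP H.
have dR0 : 0 < d%:R :> R by rewrite ltr0n.
have : dot x y <= \sum_(i < d) (200 * d%:R)^-1.
  apply: ler_sum => i _; have /negP := H i; rewrite -ltNge => /ltW yi.
  have /andP[x0 x1] := cx i; have /andP[y0 y1] := cy i.
  by apply: le_trans yi; rewrite ler_piMl.
rewrite sumr_const card_ord.
have -> : (200 * d%:R)^-1 *+ d = 200^-1 :> R.
  by rewrite -[LHS]mulr_natr; field; rewrite gt_eqF.
by move=> H2; have := le_trans xy H2; lra.
Qed.

Lemma cutoff_outside (C : R) g (x : 'rV[R]_d) : cutoff C g -> ~ cube x -> g x = 0.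
Proof.
move=> cg ncx; have [j] : exists i, ~ (0 <= x ord0 i <= 1).
  by apply: contrapT => /forallNP H; apply: ncx => i; apply: contrapT; exact: H.
move=> /negP xi; apply: (cutoff_vanish cg (i := j)); apply: contra xi.
by move=> /andP[/ltW -> /ltW ->].
Qed.

Lemma cutoff_measurable (C : R) (g : 'rV[R]_d -> R) : cutoff C g ->
  measurable_fun [set: 'rV[R]_d] g.
Proof.
move=> cg; have [B B0 BP] := trig_approx_modulated cg.
have mg : measurable_fun cube g.
  have := BP 2^-1 0; rewrite invr_gt0 ltr0n lexx => /(_ isT) H.
  apply: (@trig_approx_measurable _ _ 2^-1 (B * wt 2^-1 (0 : 'rV[R]_d))).
  by move: H; congr trig_approx; apply/funext => x; rewrite dotC dot0r ec0 mulr1.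
rewrite (_ : g = g \_ cube); first exact: (measurable_restrictT g (@measurable_cube R d)).1 mg.
apply/funext => x; rewrite patchE; case: ifPn => //; rewrite notin_setE => ncx.
exact: cutoff_outside cg ncx.
Qed.

(** When [a >= 1 / 100] every slab with normal in the cube is either empty in
    the cube or transversal to some coordinate axis. *)
Lemma slab_discrepancy100 C g (gamma eps : R) (v : nat -> 'rV[R]_d) :
  (0 < d)%N -> cutoff C g -> (forall x, 0 <= g x) -> gamma <= 1 -> 0 < eps ->
  uniformly_distributed gamma v ->
  exists2 K : R, 0 <= K & forall y a b N, cube y -> 100^-1 <= a -> (0 < N)%N ->
    `|N%:R^-1 * (\sum_(n < N) g (v n.+1) * ind a b (dot (v n.+1) y)) -
      slab_mean g a b y| <= K * N%:R `^ (eps - gamma).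
Proof.
move=> d0 cg g0 gamma1 eps0 ud.
have c0 : 0 < (200 * d%:R)^-1 :> R by rewrite invr_gt0 mulr_gt0 ?ltr0n.
have [K K0 KP] := slab_discrepancy d0 cg g0 gamma1 eps0 c0 ud.
exists K => // y a b N cy a100 N0.
have [[x [cx xy]]|H] := pselect (exists x, cube x /\ a <= dot x y).
  have [i yi] := slab_coord cx cy d0 (le_trans a100 xy).
  exact: KP yi N0.
have ind0 x : cube x -> ind a b (dot x y) = 0.
  move=> cx; rewrite /ind; case: (boolP (a <= dot x y)) => //= xy.
  by case: H; exists x.
have [cv _] := ud.
rewrite big1 => [|n _]; last by rewrite ind0 ?mulr0//; exact: cv.
rewrite /slab_mean (eq_Rintegral _ (g := fun=> 0)) => [|x].
  by rewrite Rintegral_cube_cst mulr0 subrr normr0 mulr_ge0 ?powR_ge0.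
by rewrite inE => cx; rewrite ind0 ?mulr0.
Qed.

(** Apply the slab estimate twice: to the [v n] with the normal [w m] fixed, and,
    after exchanging the sum over [m] with the integral, to the [w m] with a
    normal [x] of the cube fixed. *)
Lemma pair_discrepancy C g (gamma eps : R) (v w : nat -> 'rV[R]_d) :
  (0 < d)%N -> cutoff C g -> (forall x, 0 <= g x) -> gamma <= 1 -> 0 < eps ->
  uniformly_distributed gamma v -> uniformly_distributed gamma w ->
  exists2 K : R, 0 <= K & forall a b N, 100^-1 <= a -> (0 < N)%N ->
    `|\sum_(n < N) \sum_(m < N) g (v n.+1) * g (w m.+1) * ind a b (dot (v n.+1) (w m.+1))
      - N%:R ^+ 2 * \int[mu]_(x in cube) (g x * slab_mean g a b x)|
    <= K * N%:R `^ (2 - gamma + eps).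
Proof.
move=> d0 cg g0 gamma1 eps0 udv udw.
have [K1 K10 K1P] := slab_discrepancy100 d0 cg g0 gamma1 eps0 udv.
have [K2 K20 K2P] := slab_discrepancy100 d0 cg g0 gamma1 eps0 udw.
have C0 : 0 <= C by apply: le_trans (cutoff_bound cg 0).
have gC x : g x <= C by apply: le_trans (ler_norm _) (cutoff_bound cg x).
have mg := cutoff_measurable cg.
have gc x : ~ cube x -> g x = 0 := cutoff_outside cg.
exists (C * K1 + C * K2) => [|a b N a100 N0]; first by rewrite addr_ge0 ?mulr_ge0.
have NR0 : 0 < N%:R :> R by rewrite ltr0n.
have [cw _] := udw; have cwm m : cube (w m.+1) by exact: cw.
pose P : R := N%:R `^ (eps - gamma); have P0 : 0 <= P by exact: powR_ge0.
have -> : N%:R `^ (2 - gamma + eps) = N%:R ^+ 2 * P :> R.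
  rewrite -powR_mulrn ?(ltW NR0)// /P -powRD; last by apply/implyP => _; rewrite gt_eqF.
  by congr (_ `^ _); ring.
pose A y := N%:R^-1 * (\sum_(n < N) g (v n.+1) * ind a b (dot (v n.+1) y)).
pose B x := N%:R^-1 * (\sum_(m < N) g (w m.+1) * ind a b (dot (w m.+1) x)).
have -> : \sum_(n < N) \sum_(m < N) g (v n.+1) * g (w m.+1) * ind a b (dot (v n.+1) (w m.+1))
    = N%:R ^+ 2 * (N%:R^-1 * \sum_(m < N) g (w m.+1) * A (w m.+1)).
  rewrite exchange_big /= mulrA expr2 mulfK ?gt_eqF// mulr_sumr.
  apply: eq_bigr => m _; rewrite /A [N%:R * _]mulrCA mulVKf ?gt_eqF//.
  by rewrite mulr_sumr; apply: eq_bigr => n _; ring.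
rewrite -mulrBr normrM ger0_norm ?sqr_ge0// mulrCA ler_wpM2l ?sqr_ge0//.
pose S := N%:R^-1 * \sum_(m < N) g (w m.+1) * slab_mean g a b (w m.+1).
have h1 : `|N%:R^-1 * (\sum_(m < N) g (w m.+1) * A (w m.+1)) - S| <= C * K1 * P.
  rewrite /S -mulrBr -sumrB normrM ger0_norm ?invr_ge0// mulrC ler_pdivrMr//.
  apply: (le_trans (ler_norm_sum _ _ _)).
  apply: (@le_trans _ _ (\sum_(m < N) C * K1 * P)); last by rewrite sumr_const card_ord mulr_natr.
  apply: ler_sum => m _; rewrite -mulrBr normrM (ger0_norm (g0 _)) -mulrA.
  by apply: ler_pM => //; exact: K1P.
have mB : measurable_fun [set: 'rV[R]_d] B.
  apply: measurable_funM => //; apply: measurable_sum => m; apply: measurable_funM => //.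
  under eq_fun do rewrite dotC; exact: measurable_ind.
have KP x : cube x -> `|B x - slab_mean g a b x| <= K2 * P by move=> cx; exact: K2P.
have igJ := integrable_slab_mean mg g0 gC gc a b.
have gBle x : cube x -> `|g x * (B x - slab_mean g a b x)| <= C * (K2 * P).
  by move=> cx; rewrite normrM (ger0_norm (g0 _)); apply: ler_pM => //; exact: KP.
have igBJ : mu.-integrable cube (EFin \o (fun x => g x * (B x - slab_mean g a b x))).
  apply: (@cube_integrable _ _ _ (C * (K2 * P))) => //.
  apply: measurable_funTS; apply: measurable_funM => //; apply: measurable_funB => //.
  exact: measurable_slab_mean.
have h2 : S = \int[mu]_(x in cube) (g x * B x).
  have iF (m : 'I_N) : mu.-integrable cube
      (EFin \o (fun x => N%:R^-1 * g (w m.+1) * (g x * ind a b (dot x (w m.+1))))).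
    apply: (@cube_integrable _ _ _ (N%:R^-1 * g (w m.+1) * C)) => [|x _].
      apply: measurable_funTS; apply: measurable_funM => //.
      by apply: measurable_funM => //; exact: measurable_ind.
    have c0 : 0 <= N%:R^-1 * g (w m.+1) by rewrite mulr_ge0 ?invr_ge0.
    rewrite normrM ger0_norm// ler_wpM2l// ger0_norm ?mulr_ge0 ?ind_ge0//.
    by apply: le_trans (gC x); rewrite ler_piMr ?ind_le1.
  have ig (m : 'I_N) : mu.-integrable cube (EFin \o (fun x => g x * ind a b (dot x (w m.+1)))).
    apply: (@cube_integrable _ _ _ C) => [|x _].
      by apply: measurable_funTS; apply: measurable_funM => //; exact: measurable_ind.
    rewrite ger0_norm ?mulr_ge0 ?ind_ge0//.
    by apply: le_trans (gC x); rewrite ler_piMr ?ind_le1.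
  have mc := @measurable_cube R d.
  rewrite (eq_Rintegral _ (g := fun x => \sum_(m < N)
    (N%:R^-1 * g (w m.+1) * (g x * ind a b (dot x (w m.+1)))))); last first.
    move=> x _; rewrite /B mulrCA mulr_sumr mulr_sumr; apply: eq_bigr => m _.
    by rewrite dotC; ring.
  rewrite Rintegral_cube_sum// /S mulr_sumr; apply: eq_bigr => m _.
  by rewrite RintegralZl// mulrA.
have h3 : `|S - \int[mu]_(x in cube) (g x * slab_mean g a b x)| <= C * K2 * P.
  rewrite h2 (eq_Rintegral _ (g := fun x => g x * (B x - slab_mean g a b x) + g x * slab_mean g a b x)).
    rewrite RintegralD//; last exact: measurable_cube.
    rewrite addrK -mulrA; apply: Rintegral_cube_norm_le => //.
    by have /integrableP[/measurable_EFinP] := igBJ.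
  by move=> x _; rewrite mulrBr subrK.
rewrite -(subrK S (N%:R^-1 * _)) -addrA; apply: (le_trans (ler_normD _ _)).
rewrite mulrDl; exact: lerD.
Qed.

End pairs.

(** * Translations of the torus and unweighted counts *)

Section translation.
Context {R : realType} {d : nat}.

Definition frac (t : R) : R := t - (Num.floor t)%:~R.

Lemma frac_itv t : 0 <= frac t < 1.
Proof.
have /andP[h1 h2] := Num.Theory.floor_itv t.
by rewrite rmorphD/= in h2; rewrite /frac; apply/andP; split; lra.
Qed.

Lemma frac_id t : 0 <= t < 1 -> frac t = t.
Proof.
by move=> t01; rewrite /frac (@Num.Theory.floor_def _ t 0) ?subr0// add0r.
Qed.

(** Translation by [s] of the torus [(R / Z) ^ d], with representatives in the
    cube. *)
Definition torus_shift (s x : 'rV[R]_d) : 'rV[R]_d :=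
  \row_i frac (x ord0 i + s ord0 i).

Lemma ec_torus_shift (k : 'rV[int]_d) (s x : 'rV[R]_d) :
  ec (dot (intR k) (torus_shift s x)) = ec (dot (intR k) s) * ec (dot (intR k) x).
Proof.
pose z : int := \sum_i k ord0 i * Num.floor (x ord0 i + s ord0 i).
have -> : dot (intR k) (torus_shift s x) = dot (intR k) s + dot (intR k) x - z%:~R.
  rewrite /z rmorph_sum /= /dot -big_split /= -sumrB; apply: eq_bigr => i _.
  by rewrite !mxE /frac rmorphM /=; ring.
by rewrite ecD -rmorphN ec_int mulr1 ecD.
Qed.

(** A translation multiplies every exponential sum by a number of modulus [1]. *)
Lemma uniformly_distributed_shift (gamma : R) (v : nat -> 'rV[R]_d) (s : 'rV[R]_d) :
  uniformly_distributed gamma v ->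
  uniformly_distributed gamma (fun n => torus_shift s (v n)).
Proof.
move=> [cv ud]; split=> [n _ i|eps /ud[C CP]].
  by rewrite mxE; have /andP[-> /ltW ->] := frac_itv (v n ord0 i + s ord0 i).
exists C => k N k0 N0 /=; have /= := CP k N k0 N0; apply: le_trans.
rewrite (eq_bigr (fun n => ec (dot (intR k) s) * ec (dot (intR k) (v n)))); last first.
  by move=> n _; rewrite -ec_torus_shift.
by rewrite -mulr_sumr mulrCA normcM normc_ec mul1r.
Qed.

End translation.

Section count.
Context {R : realType} {d : nat}.
Local Notation mu := (@mu R d).

(** Any point of the cube is moved into [[1/4, 3/4] ^ d] by one of these. *)
Definition half_shift (t : {ffun 'I_d -> 'I_3}) : 'rV[R]_d :=
  \row_i (((t i : nat)%:R - 1) / 2).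

Lemma half_shift_centre (x : 'rV[R]_d) : cube x -> exists t, forall i,
  4^-1 <= x ord0 i + half_shift t ord0 i <= 3 / 4.
Proof.
move=> cx.
exists [ffun i => if x ord0 i < 4^-1 then inord 2
                  else if x ord0 i <= 3 / 4 then inord 1 else inord 0] => i.
have /andP[x0 x1] := cx i; rewrite mxE ffunE; case: ltP => h1.
  by rewrite inordK//; apply/andP; split; lra.
have [h2|h2] := lerP (x ord0 i) (3 / 4); rewrite inordK//; apply/andP; split; lra.
Qed.

Lemma bump_ge (t : R) : 4^-1 <= t <= 3 / 4 -> (3 / 16) ^+ 2 <= bump01 t.
Proof.
move=> /andP[t1 t2]; rewrite /bump01 clamp01_id; last by apply/andP; split; lra.
rewrite ler_pXn2r ?nnegrE ?mulr_ge0//; try lra.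
rewrite -subr_ge0 (_ : _ - _ = (t - 4^-1) * (3 / 4 - t)); last by field.
by rewrite mulr_ge0//; lra.
Qed.

(** Among the terms on the right is the one for a displacement [t] that moves [x] to
    the middle of the cube, where the bump is bounded below. The translated point
    is then [x + t] itself, and the slab is translated along. *)
Lemma ind_shift_le (x y : 'rV[R]_d) (a b : R) : cube x ->
  ind a b (dot x y) <= \sum_t ((3 / 16) ^+ 2) ^- d * (bumps (torus_shift (half_shift t) x) *
    ind (a + dot (half_shift t) y) (b + dot (half_shift t) y)
      (dot (torus_shift (half_shift t) x) y)).
Proof.
move=> cx; have [t tx] := half_shift_centre cx.
have k0 : 0 < (3 / 16) ^+ 2 :> R by rewrite exprn_gt0// divr_gt0.
have kd0 : 0 < ((3 / 16) ^+ 2) ^+ d :> R by rewrite exprn_gt0.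
have u0 : torus_shift (half_shift t) x = x + half_shift t.
  apply/rowP => i; rewrite !mxE frac_id//; have := tx i; rewrite mxE => /andP[? ?].
  by apply/andP; split; lra.
rewrite (bigD1 t)//= -[leLHS]addr0; apply: lerD; last first.
  apply: sumr_ge0 => t' _; rewrite mulr_ge0 ?invr_ge0 ?(ltW kd0)//.
  by rewrite mulr_ge0 ?bumps_ge0 ?ind_ge0.
rewrite u0 dotDl.
have -> : ind (a + dot (half_shift t) y) (b + dot (half_shift t) y)
    (dot x y + dot (half_shift t) y) = ind a b (dot x y) by rewrite /ind !lerD2r.
rewrite mulrA ler_peMl ?ind_ge0// mulrC ler_pdivlMr// mul1r.
rewrite /bumps -[in leLHS](card_ord d) -prodr_const; apply: ler_prod => i _.
rewrite (ltW k0)/=; apply: bump_ge; have := tx i.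
by rewrite !mxE.
Qed.

(** A bump supported in the open cube does not see the points close to the boundary,
    but after one of [3 ^ d] translations of the torus every point is well inside
    the cube. The translated sequences are uniformly distributed, and the bump gives
    a slab a weight of at most its volume. *)
Lemma slab_count_le (gamma eps : R) (v : nat -> 'rV[R]_d) :
  (0 < d)%N -> gamma <= 1 -> 0 < eps -> uniformly_distributed gamma v ->
  exists2 K : R, 0 <= K & forall y a b N, cube y -> 100^-1 <= a -> a <= b -> (0 < N)%N ->
    N%:R^-1 * (\sum_(n < N) ind a b (dot (v n.+1) y)) <=
    ((3 / 16) ^+ 2) ^- d * (3 ^ d)%:R * (200 * d%:R) * (b - a) + K * N%:R `^ (eps - gamma).
Proof.
move=> d0 gamma1 eps0 ud; have [C cb] := @bumps_cutoff R d.
have dR0 : 0 < d%:R :> R by rewrite ltr0n.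
have c0 : 0 < (200 * d%:R)^-1 :> R by rewrite invr_gt0 mulr_gt0.
have k0 : 0 <= ((3 / 16) ^+ 2) ^- d :> R.
  by rewrite invr_ge0 !exprn_ge0// divr_ge0.
set kd := ((3 / 16) ^+ 2) ^- d in k0 *.
have /choice[K KP] : forall t : {ffun 'I_d -> 'I_3}, exists K : R, 0 <= K /\
    forall y i a b N, cube y -> (200 * d%:R)^-1 <= y ord0 i -> (0 < N)%N ->
    `|N%:R^-1 * (\sum_(n < N) bumps (torus_shift (half_shift t) (v n.+1)) *
        ind a b (dot (torus_shift (half_shift t) (v n.+1)) y)) -
      \int[mu]_(x in cube) (bumps x * ind a b (dot x y))| <= K * N%:R `^ (eps - gamma).
  move=> t; have uds := uniformly_distributed_shift (half_shift t) ud.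
  have [K K0 KP] := slab_discrepancy d0 cb (@bumps_ge0 R d) gamma1 eps0 c0 uds.
  by exists K; split.
exists (\sum_t kd * K t) => [|y a b N cy a100 ab N0].
  by apply: sumr_ge0 => t _; rewrite mulr_ge0//; have [] := KP t.
have NR0 : 0 < N%:R :> R by rewrite ltr0n.
set P := N%:R `^ (eps - gamma); have P0 : 0 <= P by exact: powR_ge0.
have [cv _] := ud; have cvn n : cube (v n.+1) by exact: cv.
have [[n0 yn0]|H] := pselect (exists n, a <= dot (v n.+1) y); last first.
  rewrite big1 ?mulr0; last first.
    move=> n _; rewrite /ind; case: (boolP (a <= _)) => //= h.
    by case: H; exists n.
  rewrite addr_ge0// ?mulr_ge0 ?subr_ge0//.
  by apply: sumr_ge0 => t _; rewrite mulr_ge0//; have [] := KP t.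
have [i yi] := slab_coord (cvn n0) cy d0 (le_trans a100 yn0).
apply: (@le_trans _ _ (\sum_(t : {ffun 'I_d -> 'I_3}) kd * ((200 * d%:R) * (b - a) + K t * P))); last first.
  rewrite le_eqVlt; apply/orP; left; apply/eqP.
  under eq_bigr do rewrite mulrDr.
  rewrite big_split /= sumr_const card_ffun !card_ord mulr_suml; congr (_ + _).
    by rewrite -mulr_natr; ring.
  by apply: eq_bigr => t _; rewrite mulrA.
apply: (@le_trans _ _ (N%:R^-1 * \sum_(n < N) \sum_t kd * (bumps (torus_shift (half_shift t) (v n.+1)) *
    ind (a + dot (half_shift t) y) (b + dot (half_shift t) y)
      (dot (torus_shift (half_shift t) (v n.+1)) y)))).
  by rewrite ler_wpM2l ?invr_ge0//; apply: ler_sum => n _; exact: ind_shift_le.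
rewrite exchange_big /= mulr_sumr; apply: ler_sum => t _.
rewrite -mulr_sumr mulrCA ler_wpM2l//.
have [Kt0 KtP] := KP t.
have := KtP y i (a + dot (half_shift t) y) (b + dot (half_shift t) y) N cy yi N0.
move=> /ler_normlP[_]; rewrite lerBlDr => /le_trans; apply; rewrite addrC lerD2r.
have ab' : a + dot (half_shift t) y <= b + dot (half_shift t) y by rewrite lerD2r.
have := Rintegral_ind_le c0 yi ab'; rewrite invrK.
have -> : (b + dot (half_shift t) y - (a + dot (half_shift t) y)) = b - a by ring.
rewrite [X in _ <= X -> _]mulrC; apply: le_trans.
have mb := cutoff_measurable cb.
apply: le_Rintegral.
- exact: measurable_cube.
- apply: (@cube_integrable _ _ _ 1) => [|x _].
    by apply: measurable_funTS; apply: measurable_funM => //; exact: measurable_ind.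
  by rewrite ger0_norm ?mulr_ge0 ?bumps_ge0 ?ind_ge0// mulr_ile1 ?bumps_ge0 ?ind_ge0 ?bumps_le1 ?ind_le1.
- apply: (@cube_integrable _ _ _ 1) => [|x _].
    by apply: measurable_funTS; exact: measurable_ind.
  by rewrite ger0_norm ?ind_ge0 ?ind_le1.
- by move=> x _; rewrite ler_piMl ?ind_ge0 ?bumps_le1.
Qed.

End count.

(** * Volume of the set of pairs in a slab *)

Section box_integral.
Context {R : realType}.
Local Notation leb := (@lebesgue_measure R).

Definition box n (s r : R) (x : 'rV[R]_n) : R := \prod_i ind s (s + r) (x ord0 i).

Lemma box_ge0 n s r (x : 'rV[R]_n) : 0 <= box s r x.
Proof. by apply: prodr_ge0 => i _; exact: ind_ge0. Qed.

Lemma boxE n s r (x : 'rV[R]_n) :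
  box s r x = ([forall i, s <= x ord0 i <= s + r] : bool)%:R.
Proof.
case: (boolP [forall i, _]) => [/forallP xb|].
  by rewrite /box big1// => i _; rewrite /ind xb.
rewrite negb_forall => /existsP[i xi]; rewrite /box (bigD1 i)//= {1}/ind.
by rewrite (negbTE xi) mul0r.
Qed.

Lemma measurable_box n s r : measurable_fun [set: 'rV[R]_n] (@box n s r).
Proof.
apply: measurable_prod => i _; apply: measurableT_comp; first exact: measurable_ind1.
exact: measurable_coord.
Qed.

Lemma integral_box n (s r : R) : 0 <= s -> 0 <= r -> s + r <= 1 ->
  (\int[mu n]_(x in cube) (box s r x)%:E = (r ^+ n)%:E)%E.
Proof.
move=> s0 r0 sr1; elim: n => [|n IH].
  rewrite (eq_integral (cst 1%E)) => [|x _]; first by rewrite integral_cube_cst expr0.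
  by rewrite /box big_ord0.
rewrite tonelli_cube1; [|exact: measurable_box|exact: box_ge0].
have -> : (\int[leb]_(t in `[0%R, 1%R]) (\int[mu n]_(x in cube) (box s r (cons_rV (t, x)))%:E) =
    \int[leb]_(t in `[0%R, 1%R]) ((r ^+ n)%:E * (\1_(`[s, s + r]) t)%:E))%E.
  apply: eq_integral => t _.
  have -> : (\1_(`[s, s + r]) t : R) = ind s (s + r) t.
    by rewrite indicE /ind mem_setE in_itv.
  have mc := @measurable_cube R n.
  rewrite muleC -IH -ge0_integralZl_EFin//; last 2 first.
  - by move=> x _; rewrite lee_fin box_ge0.
  - by apply/measurable_EFinP; apply: measurable_funTS; exact: measurable_box.
  apply: eq_integral => x _; rewrite -EFinM /box big_ord_recl mxE unlift_none /=.
  by congr (_ * _)%:E; apply: eq_bigr => i _; rewrite mxE liftK.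
rewrite ge0_integralZl_EFin ?exprn_ge0//; last by apply/measurable_EFinP.
rewrite (integral_indic leb)// setIidl.
  have := lebesgue_measure_itv `[s, s + r].
  rewrite /= => ->; rewrite lte_fin ltrDl.
  have [r1|r1] := ltrP 0 r; first by rewrite -EFinB -EFinM addrAC subrr add0r exprSr.
  have -> : r = 0 by apply/eqP; rewrite eq_le r1.
  by rewrite mule0 expr0n.
by move=> t; rewrite /= !in_itv /= => /andP[? ?]; apply/andP; split; lra.
Qed.

End box_integral.

Section bumps_volume.
Context {R : realType}.
Local Notation leb := (@lebesgue_measure R).

Lemma bump01_ge_itv (k1 k2 t : R) : 0 < k1 -> k2 < 1 -> k1 <= t <= k2 ->
  (k1 * (1 - k2)) ^+ 2 <= bump01 t.
Proof.
move=> k1_gt0 k2_lt1 /andP[t1 t2].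
rewrite /bump01 clamp01_id; last by apply/andP; split; lra.
rewrite ler_pXn2r ?nnegrE ?mulr_ge0//; try lra.
by apply: ler_pM => //; lra.
Qed.

Lemma integral_ind (a b : R) : 0 <= a -> a <= b -> b <= 1 ->
  (\int[leb]_(t in `[0%R, 1%R]) (ind a b t)%:E = (b - a)%:E)%E.
Proof.
move=> a0 ab b1.
have -> : (\int[leb]_(t in `[0%R, 1%R]) (ind a b t)%:E =
    \int[leb]_(t in `[0%R, 1%R]) (\1_(`[a, b]) t)%:E)%E.
  by apply: eq_integral => t _; rewrite indicE /ind mem_setE in_itv.
rewrite (integral_indic leb)// setIidl.
  have := lebesgue_measure_itv `[a, b].
  rewrite /= => ->; rewrite lte_fin.
  have [r1|r1] := ltrP a b; first by rewrite -EFinB.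
  have -> : a = b by apply/eqP; rewrite eq_le ab.
  by rewrite subrr.
by move=> t; rewrite /= !in_itv /= => /andP[? ?]; apply/andP; split; lra.
Qed.

(** Fix the last [n] coordinates [y] of the point in the box of side [r]. The first
    coordinates that put the point in the slab form an interval contained in
    [[k1, k2]], where the bump is bounded below, and its length is
    [(b - a) / x_0 >= b - a]. *)
Lemma slab_mean_bumps_ge n (s r k1 k2 a b : R) (x : 'rV[R]_n.+1) :
  0 < k1 -> k2 < 1 -> k1 <= s -> s + r <= k2 -> 0 <= r -> a <= b ->
  s <= x ord0 ord0 <= s + r ->
  (forall y : 'rV[R]_n, (forall i, s <= y ord0 i <= s + r) ->
    k1 * x ord0 ord0 <= a - dot y (tail_rV x) /\
    b - dot y (tail_rV x) <= k2 * x ord0 ord0) ->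
  ((k1 * (1 - k2)) ^+ 2) ^+ n.+1 * (b - a) * r ^+ n <= slab_mean bumps a b x.
Proof.
move=> k1_gt0 k2_lt1 k1s srk2 r0 ab /andP[x0s x0sr] yP.
have [C cb] := @bumps_cutoff R n.+1.
have mb := cutoff_measurable cb.
have bc (z : 'rV[R]_n.+1) : ~ cube z -> bumps z = 0 by exact: cutoff_outside cb.
set be := (k1 * (1 - k2)) ^+ 2.
have be0 : 0 <= be by exact: sqr_ge0.
have bebump t : k1 <= t <= k2 -> be <= bump01 t by exact: bump01_ge_itv.
clearbody be.
have x00 : 0 < x ord0 ord0 by lra.
have x01 : x ord0 ord0 <= 1 by lra.
have f0 z : 0 <= bumps z * ind a b (dot z x) by rewrite mulr_ge0 ?bumps_ge0 ?ind_ge0.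
have mf : measurable_fun [set: 'rV[R]_n.+1] (fun z => bumps z * ind a b (dot z x)).
  by apply: measurable_funM => //; exact: measurable_ind.
have c0 : 0 <= be ^+ n.+1 * (b - a) by apply: mulr_ge0; [exact: exprn_ge0|rewrite subr_ge0].
have mc := @measurable_cube R n.
have mbox : measurable_fun cube (EFin \o @box R n s r).
  by apply/measurable_EFinP; apply: measurable_funTS; exact: measurable_box.
rewrite -lee_fin (EFin_slab_mean mb (@bumps_ge0 R n.+1) (@bumps_le1 R n.+1) bc).
rewrite integral_cube_supp; last by move=> z /bc ->; rewrite mul0r.
rewrite tonelli_cube2//.
apply: (@le_trans _ _ (\int[mu n]_(y in cube) ((be ^+ n.+1 * (b - a))%:E * (box s r y)%:E))%E).
  rewrite ge0_integralZl_EFin//; last by move=> y _; rewrite lee_fin box_ge0.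
  by rewrite integral_box//; lra.
apply: ge0_le_integral => //=.
- by move=> y _; rewrite lee_fin mulr_ge0 ?box_ge0.
- by apply: measurable_funeM.
- by apply: measurable_funTS; apply: (measurable_inner2 mf f0).
move=> y _; rewrite boxE; case: (boolP [forall i, _]) => [/forallP yb|_]; last first.
  by rewrite mule0; apply: integral_ge0 => t _; rewrite lee_fin.
have [lo hi] := yP y yb; set u := dot y (tail_rV x) in lo hi.
pose l1 := (a - u) / x ord0 ord0; pose l2 := (b - u) / x ord0 ord0.
have l1k : k1 <= l1 by rewrite /l1 ler_pdivlMr.
have l2k : l2 <= k2 by rewrite /l2 ler_pdivrMr.
have l12 : b - a <= l2 - l1.
  rewrite /l1 /l2 -mulrBl opprB addrA subrK ler_pdivlMr//.
  by rewrite ler_piMr// subr_ge0.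
rewrite mule1; apply: (@le_trans _ _ ((be ^+ n.+1)%:E * (l2 - l1)%:E)%E).
  by rewrite -EFinM lee_fin ler_wpM2l// exprn_ge0.
have H1 : 0 <= l1 by lra.
have H2 : l1 <= l2 by lra.
have H3 : l2 <= 1 by lra.
rewrite -(integral_ind H1 H2 H3) -ge0_integralZl_EFin//; last 3 first.
- by move=> t _; rewrite lee_fin ind_ge0.
- by apply/measurable_EFinP; apply: measurable_funTS; exact: measurable_ind1.
- by rewrite exprn_ge0.
apply: ge0_le_integral => //=.
- by move=> t _; apply: mule_ge0; rewrite lee_fin; [exact: exprn_ge0|exact: ind_ge0].
- apply: measurable_funeM; apply/measurable_EFinP; apply: measurable_funTS.
  exact: measurable_ind1.
- apply/measurable_EFinP; apply: measurable_funTS.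
  apply: (measurableT_comp (f := fun z => bumps z * ind a b (dot z x))) => //.
  apply: (measurableT_comp (f := @cons_rV R n)); first exact: measurable_cons_rV.
  exact: measurable_pair2.
move=> t _; rewrite lee_fin dot_cons -/u.
rewrite {1}/ind; case: (boolP (l1 <= t <= l2)) => [/andP[t1 t2]|_]; last first.
  by rewrite mulr0 mulr_ge0 ?bumps_ge0 ?ind_ge0.
have -> : ind a b (t * x ord0 ord0 + u) = 1.
  rewrite /ind; move: t1 t2; rewrite /l1 /l2 ler_pdivrMr// ler_pdivlMr// => t1 t2.
  by have -> : a <= t * x ord0 ord0 + u <= b by apply/andP; split; lra.
rewrite !mulr1 /bumps big_ord_recl mxE unlift_none /= exprS.
apply: ler_pM; rewrite ?exprn_ge0//.
  by apply: bebump; apply/andP; split; lra.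
rewrite -[in leLHS](card_ord n) -prodr_const; apply: ler_prod => i _.
rewrite be0 mxE liftK /=; apply: bebump.
by have /andP[? ?] := yb i; apply/andP; split; lra.
Qed.

Lemma slab_mean_mono n (g : 'rV[R]_n -> R) (C a b b' : R) (x : 'rV[R]_n) :
  measurable_fun [set: 'rV[R]_n] g -> (forall x, 0 <= g x) -> (forall x, g x <= C) ->
  b' <= b -> slab_mean g a b' x <= slab_mean g a b x.
Proof.
move=> mg g0 gC bb.
have ig c : (mu n).-integrable cube (EFin \o (fun z => g z * ind a c (dot z x))).
  apply: (@cube_integrable _ _ _ C) => [|z _].
    by apply: measurable_funTS; apply: measurable_funM => //; exact: measurable_ind.
  rewrite ger0_norm ?mulr_ge0 ?ind_ge0//.
  by apply: le_trans (gC z); rewrite ler_piMr ?ind_le1.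
apply: le_Rintegral => //; first exact: measurable_cube.
move=> z _; rewrite ler_wpM2l// /ind.
case: (boolP (a <= _ <= b')) => // /andP[-> zb].
by rewrite (le_trans zb bb).
Qed.

Lemma bumps_volume_box n (s r k1 k2 a b : R) :
  0 < k1 -> k2 < 1 -> k1 <= s -> s + r <= k2 -> 0 <= r -> a <= b ->
  (forall (x : 'rV[R]_n.+1) (y : 'rV[R]_n), (forall i, s <= x ord0 i <= s + r) ->
    (forall i, s <= y ord0 i <= s + r) ->
    k1 * x ord0 ord0 <= a - dot y (tail_rV x) /\
    b - dot y (tail_rV x) <= k2 * x ord0 ord0) ->
  ((k1 * (1 - k2)) ^+ 2) ^+ n.+1 * (((k1 * (1 - k2)) ^+ 2) ^+ n.+1 * (b - a) * r ^+ n) * r ^+ n.+1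
  <= \int[mu n.+1]_(x in cube) (bumps x * slab_mean bumps a b x).
Proof.
move=> k1_gt0 k2_lt1 k1s srk2 r0 ab H.
have [C cb] := @bumps_cutoff R n.+1.
have mb := cutoff_measurable cb.
have bc (z : 'rV[R]_n.+1) : ~ cube z -> bumps z = 0 by exact: cutoff_outside cb.
set be := (k1 * (1 - k2)) ^+ 2.
have be0 : 0 <= be by exact: sqr_ge0.
have bebump t : k1 <= t <= k2 -> be <= bump01 t by exact: bump01_ge_itv.
have ben : 0 <= be ^+ n.+1 by exact: exprn_ge0.
have rn : 0 <= r ^+ n by exact: exprn_ge0.
have ba : 0 <= b - a by rewrite subr_ge0.
have c0 : 0 <= be ^+ n.+1 * (b - a) * r ^+ n by rewrite !mulr_ge0.
set q := be ^+ n.+1 * (b - a) * r ^+ n in c0 *.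
have iQ := integrable_slab_mean mb (@bumps_ge0 R n.+1) (@bumps_le1 R n.+1) bc a b.
have mc := @measurable_cube R n.+1.
rewrite -lee_fin /Rintegral fineK; last exact: integrable_fin_num.
have srk : s + r <= 1 by lra.
have s0 : 0 <= s by lra.
rewrite EFinM -(integral_box n.+1 s0 r0 srk) -ge0_integralZl_EFin//; last 3 first.
- by move=> z _; rewrite lee_fin box_ge0.
- by apply/measurable_EFinP; apply: measurable_funTS; exact: measurable_box.
- exact: mulr_ge0.
apply: ge0_le_integral => //=.
- by move=> z _; apply: mule_ge0; rewrite lee_fin; [exact: mulr_ge0|exact: box_ge0].
- apply: measurable_funeM; apply/measurable_EFinP; apply: measurable_funTS.
  exact: measurable_box.
- by have /integrableP[] := iQ.
move=> x _; rewrite boxE; case: (boolP [forall i, _]) => [/forallP xb|_]; last first.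
  by rewrite mule0 lee_fin mulr_ge0 ?bumps_ge0// slab_mean_ge0//; exact: bumps_ge0.
rewrite mule1 lee_fin; apply: ler_pM => //.
  rewrite -[in leLHS](card_ord n.+1) -prodr_const; apply: ler_prod => i _.
  rewrite be0 /=; apply: bebump.
  by have /andP[? ?] := xb i; apply/andP; split; lra.
by rewrite /q ; apply: le_trans (slab_mean_bumps_ge k1_gt0 k2_lt1 k1s srk2 r0 ab (xb ord0) (fun y yb => H x y xb yb)).
Qed.

(** Both points are taken close to the diagonal point with coordinates
    [s = sqrt (a / d)], for which [dot x x = a]. Since [A < d], this point stays at a
    distance [1 - s1] from the boundary, uniformly in [a <= A], which leaves room for
    a slab of width [rho]. *)
Lemma bumps_volume_ge (d : nat) (A B : R) : (0 < d)%N -> A < d%:R ->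
  exists2 c : R, 0 < c & forall a b, 100^-1 <= a <= A -> a <= b <= B ->
    c * (b - a) <= \int[mu d]_(x in cube) (bumps x * slab_mean bumps a b x).
Proof.
case: d => // n _ Ad; set D : R := n.+1%:R in Ad.
have D1 : 1 <= D by rewrite /D ler1n.
have D0 : 0 < D by lra.
set s0 : R := Num.sqrt (100^-1 / D); set s1 : R := Num.sqrt (A / D).
have s00 : 0 < s0 by rewrite sqrtr_gt0 divr_gt0 ?invr_gt0.
have s11 : s1 < 1.
  have [A0|A0] := lerP A 0.
    by rewrite /s1 ler0_sqrtr ?ltr01// pmulr_lle0 ?invr_gt0.
  by rewrite -sqrtr1 ltr_sqrt ?ltr01// ltr_pdivrMr// mul1r.
have s10 : 0 <= s1 by exact: sqrtr_ge0.
set r : R := Num.min (s0 / (8 * D)) ((1 - s1) / 2).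
have r0 : 0 < r by rewrite lt_min !divr_gt0// ?mulr_gt0// subr_gt0.
set rho : R := s0 * (1 - s1) / 2.
have rho0 : 0 < rho by rewrite !divr_gt0 ?mulr_gt0// subr_gt0.
set k1 : R := s0 / 2; set k2 : R := (1 + s1) / 2.
have k1_gt0 : 0 < k1 by rewrite divr_gt0.
have k2_lt1 : k2 < 1 by rewrite /k2; lra.
have r1 : r <= s0 / (8 * D) by rewrite ge_min lexx.
have r2 : r <= (1 - s1) / 2 by rewrite ge_min lexx orbT.
clearbody r.
set be := (k1 * (1 - k2)) ^+ 2.
have be0 : 0 < be by rewrite exprn_gt0// mulr_gt0// subr_gt0.
set ka : R := Num.min 1 (rho / (`|B| + 1)).
have B1 : 0 < `|B| + 1 by rewrite ltr_wpDl.
have ka0 : 0 < ka by rewrite lt_min ltr01 divr_gt0.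
set T := be ^+ n.+1 * (be ^+ n.+1 * r ^+ n) * r ^+ n.+1.
have bn : 0 < be ^+ n.+1 by exact: exprn_gt0.
have T0 : 0 < T.
  by apply: mulr_gt0; [apply: mulr_gt0 => //; apply: mulr_gt0 => //|]; exact: exprn_gt0.
exists (T * ka) => [|a b /andP[a1 aA] /andP[ab bB]]; first exact: mulr_gt0.
have [C cb] := @bumps_cutoff R n.+1.
have mb := cutoff_measurable cb.
have bc (z : 'rV[R]_n.+1) : ~ cube z -> bumps z = 0 by exact: cutoff_outside cb.
(* replace a wide slab by one of width [rho], a fixed proportion of it as [b <= B] *)
pose b' := Num.min b (a + rho).
have b'b : b' <= b by rewrite ge_min lexx.
have b'r : b' <= a + rho by rewrite ge_min lexx orbT.
have ab' : a <= b' by rewrite le_min ab lerDl ltW.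
have kab : ka * (b - a) <= b' - a.
  rewrite /b'; have [h|h] := lerP b (a + rho).
    by rewrite ler_piMl ?subr_ge0// ge_min lexx.
  apply: (@le_trans _ _ (rho / (`|B| + 1) * (b - a))).
    by rewrite ler_wpM2r ?subr_ge0// ge_min lexx orbT.
  rewrite mulrAC ler_pdivrMr// [leRHS](_ : _ = rho * (`|B| + 1)); last by ring.
  by rewrite ler_wpM2l ?(ltW rho0)//; have := ler_norm B; lra.
apply: (@le_trans _ _ (\int[mu n.+1]_(x in cube) (bumps x * slab_mean bumps a b' x))); last first.
  apply: le_Rintegral.
  - exact: measurable_cube.
  - exact: (integrable_slab_mean mb (@bumps_ge0 R n.+1) (@bumps_le1 R n.+1) bc a b').
  - exact: (integrable_slab_mean mb (@bumps_ge0 R n.+1) (@bumps_le1 R n.+1) bc a b).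
  move=> x _; rewrite ler_wpM2l ?bumps_ge0//.
  by apply: (slab_mean_mono _ _ mb) => //; [exact: bumps_ge0|exact: bumps_le1].
apply: (@le_trans _ _ (T * (b' - a))).
  by rewrite -mulrA ler_wpM2l ?(ltW T0).
set s := Num.sqrt (a / D).
have ss : D * s ^+ 2 = a.
  rewrite sqr_sqrtr; first by rewrite mulrC divfK// gt_eqF.
  by rewrite divr_ge0 ?(ltW D0)//; lra.
have s0s : s0 <= s by rewrite ler_sqrt ?divr_ge0 ?(ltW D0)// ?ler_pM2r ?invr_gt0//; lra.
have ss1 : s <= s1 by rewrite ler_sqrt ?divr_ge0 ?(ltW D0)// ?ler_pM2r ?invr_gt0//; lra.
clearbody s s0 s1.
have k1s : k1 <= s by rewrite /k1; lra.
have srk2 : s + r <= k2 by rewrite /k2; lra.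
have -> : T * (b' - a) = be ^+ n.+1 * (be ^+ n.+1 * (b' - a) * r ^+ n) * r ^+ n.+1.
  by rewrite /T; ring.
have DE : D = n%:R + 1 by rewrite /D -natr1.
apply: (bumps_volume_box k1_gt0 k2_lt1 k1s srk2 (ltW r0) ab').
move=> x y xb yb; have /andP[x1 x2] := xb ord0.
have lo : n%:R * s ^+ 2 <= dot y (tail_rV x).
  rewrite mulr_natl -[in leLHS](card_ord n) -sumr_const; apply: ler_sum => i _.
  rewrite mxE expr2; have /andP[? ?] := yb i; have /andP[? ?] := xb (lift ord0 i).
  by apply: ler_pM => //; lra.
have hi : dot y (tail_rV x) <= n%:R * (s + r) ^+ 2.
  rewrite mulr_natl -[in leRHS](card_ord n) -sumr_const; apply: ler_sum => i _.
  rewrite mxE expr2; have /andP[? ?] := yb i; have /andP[? ?] := xb (lift ord0 i).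
  by apply: ler_pM => //; lra.
split.
  have h1 : dot y (tail_rV x) + k1 * x ord0 ord0 <= n%:R * (s + r) ^+ 2 + k1 * (s + r).
    by apply: lerD => //; rewrite ler_wpM2l//; exact: ltW.
  suff : n%:R * (s + r) ^+ 2 + k1 * (s + r) <= a by lra.
  (* with [s + r <= s (1 + e)] and [k1 <= s / 2], the left side is at most [s ^ 2] times
     [(D - 1) (1 + e) ^ 2 + (1 + e) / 2], which is less than [D] for this [e] *)
  pose e : R := (8 * D)^-1.
  have e0 : 0 <= e by rewrite invr_ge0 mulr_ge0 ?(ltW D0).
  have De : 8 * (D * e) = 1 by rewrite /e mulrA mulfV// gt_eqF// mulr_gt0.
  have e1 : e <= 8^-1 by rewrite /e lef_pV2 ?posrE ?mulr_gt0//; lra.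
  have rs : s + r <= s * (1 + e).
    rewrite mulrDr mulr1 lerD2l; apply: (le_trans r1).
    by rewrite -/e ler_wpM2r.
  have s_gt0 : 0 < s by lra.
  have h2 : n%:R * (s + r) ^+ 2 <= (D - 1) * (s * (1 + e)) ^+ 2.
    rewrite DE addrK ler_wpM2l// ler_pXn2r// nnegrE; first by lra.
    by apply: mulr_ge0; lra.
  have h3 : k1 * (s + r) <= s / 2 * (s * (1 + e)).
    by apply: ler_pM => //; rewrite /k1; lra.
  apply: (le_trans (lerD h2 h3)); rewrite -ss -subr_ge0.
  have -> : D * s ^+ 2 - ((D - 1) * (s * (1 + e)) ^+ 2 + s / 2 * (s * (1 + e))) =
      s ^+ 2 * (1 + 2 * e + e ^+ 2 - 2 * (D * e) - (D * e) * e - (1 + e) / 2) by field.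
  apply: mulr_ge0; first exact: sqr_ge0.
  have := sqr_ge0 e.
  have -> : D * e = 8^-1 by lra.
  by move=> ?; lra.
have : k2 * s <= k2 * x ord0 ord0 by rewrite ler_wpM2l// /k2; lra.
suff : s ^+ 2 + rho <= k2 * s by rewrite -ss DE in b'r *; lra.
rewrite /rho /k2; nra.
Qed.

Lemma volume_Omega (d : nat) (a b : R) :
  ((mu d \x mu d) (@Omega R d a b) =
  (\int[mu d]_(x in cube) (\1_cube x * slab_mean \1_cube a b x))%:E)%E.
Proof.
have g0 (x : 'rV[R]_d) : 0 <= (\1_cube x : R) by [].
have g1 (x : 'rV[R]_d) : (\1_cube x : R) <= 1 by rewrite indicE; case: (_ \in _).
have gc (x : 'rV[R]_d) : ~ cube x -> (\1_cube x : R) = 0.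
  by move=> cx; rewrite indicE memNset.
have mg : measurable_fun [set: 'rV[R]_d] (\1_cube : 'rV[R]_d -> R).
  by apply: measurable_indic; exact: measurable_cube.
rewrite -(integral_Omega mg g0 g1 gc).
rewrite (eq_integral (cst 1%E)) => [|z]; last first.
  by rewrite inE => -[c1 c2 _]; rewrite !indicE !mem_set// mulr1.
by rewrite integral_cst ?mul1e//; exact: measurable_Omega.
Qed.

End bumps_volume.

Section volume_Omega.
Context {R : realType} {d : nat}.
Local Notation mu := (@mu R d).

Let one_ge0 (x : 'rV[R]_d) : 0 <= (\1_cube x : R). Proof. by []. Qed.

Let one_le1 (x : 'rV[R]_d) : (\1_cube x : R) <= 1.
Proof. by rewrite indicE; case: (_ \in _). Qed.

Let one_out (x : 'rV[R]_d) : ~ cube x -> (\1_cube x : R) = 0.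
Proof. by move=> cx; rewrite indicE memNset. Qed.

Let one_in (x : 'rV[R]_d) : cube x -> (\1_cube x : R) = 1.
Proof. by move=> cx; rewrite indicE mem_set. Qed.

Let measurable_one : measurable_fun [set: 'rV[R]_d] (\1_cube : 'rV[R]_d -> R).
Proof. by apply: measurable_indic; exact: measurable_cube. Qed.

Lemma slab_volume_le (a b : R) (x : 'rV[R]_d) : (0 < d)%N -> 100^-1 <= a -> a <= b ->
  cube x -> slab_mean \1_cube a b x <= 200 * d%:R * (b - a).
Proof.
move=> d0 a100 ab cx.
have dR0 : 0 < d%:R :> R by rewrite ltr0n.
have c0 : 0 < (200 * d%:R)^-1 :> R by rewrite invr_gt0 mulr_gt0.
have -> : slab_mean \1_cube a b x = \int[mu]_(z in cube) ind a b (dot z x).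
  by apply: eq_Rintegral => z; rewrite inE => cz; rewrite one_in// mul1r.
have [[z [cz zx]]|H] := pselect (exists z, cube z /\ a <= dot z x).
  have [i xi] := slab_coord cz cx d0 (le_trans a100 zx).
  by have := Rintegral_ind_le c0 xi ab; rewrite invrK mulrC.
rewrite (eq_Rintegral _ (g := fun=> 0)) => [|z].
  by rewrite Rintegral_cube_cst !mulr_ge0 ?subr_ge0// ltW.
rewrite inE => cz; rewrite /ind; case: (boolP (a <= dot z x)) => //= zx.
by case: H; exists z.
Qed.

Lemma volume_Omega_le (a b : R) : (0 < d)%N -> 100^-1 <= a -> a <= b ->
  ((mu \x mu) (@Omega R d a b) <= (200 * d%:R * (b - a))%:E)%E.
Proof.
move=> d0 a100 ab; rewrite volume_Omega lee_fin.
apply: le_trans (ler_norm _) _; apply: Rintegral_cube_norm_le => [|x cx].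
  apply: measurable_funTS; apply: measurable_funM => //.
  exact: (measurable_slab_mean measurable_one one_ge0 one_le1 one_out).
rewrite one_in// mul1r ger0_norm; first exact: slab_volume_le.
exact: (slab_mean_ge0 one_ge0).
Qed.

Lemma bumps_volume_le (a b : R) :
  ((\int[mu]_(x in cube) (bumps x * slab_mean bumps a b x))%:E
   <= (mu \x mu) (@Omega R d a b))%E.
Proof.
have [C cb] := @bumps_cutoff R d.
have mb := cutoff_measurable cb.
have bc (z : 'rV[R]_d) : ~ cube z -> bumps z = 0 by exact: cutoff_outside cb.
have mc := @measurable_cube R d.
rewrite volume_Omega lee_fin; apply: le_Rintegral => //.
- exact: (integrable_slab_mean mb (@bumps_ge0 R d) (@bumps_le1 R d) bc).
- exact: (integrable_slab_mean measurable_one one_ge0 one_le1 one_out).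
move=> x cx; apply: ler_pM; rewrite ?bumps_ge0 ?one_in ?bumps_le1//.
  exact: (slab_mean_ge0 (@bumps_ge0 R d)).
apply: le_Rintegral => //.
- apply: (@cube_integrable _ _ _ 1) => [|z _].
    by apply: measurable_funTS; apply: measurable_funM => //; exact: measurable_ind.
  rewrite ger0_norm ?mulr_ge0 ?bumps_ge0 ?ind_ge0//.
  by rewrite mulr_ile1 ?bumps_ge0 ?ind_ge0 ?bumps_le1 ?ind_le1.
- apply: (@cube_integrable _ _ _ 1) => [|z _].
    by apply: measurable_funTS; apply: measurable_funM => //; exact: measurable_ind.
  by rewrite ger0_norm ?mulr_ge0 ?ind_ge0// mulr_ile1 ?ind_ge0 ?ind_le1.
by move=> z cz; rewrite ler_wpM2r ?ind_ge0// one_in// bumps_le1.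
Qed.

End volume_Omega.

(** * Incidences *)

Section incidence_sums.
Context {R : realType} {d : nat}.
Local Notation mu := (@mu R d).

Lemma sum_incidences (v w : nat -> 'rV[R]_d) (a b : R) (N : nat) (F : 'I_N -> 'I_N -> R) :
  \sum_(p in incidences v w a b N) F p.1 p.2 =
  \sum_(n < N) \sum_(m < N) F n m * ind a b (dot (v n.+1) (w m.+1)).
Proof.
rewrite big_mkcond pair_big /=; apply: eq_bigr => p _.
by rewrite inE /ind; case: (_ <= _ <= _); rewrite ?mulr1 ?mulr0.
Qed.

Lemma card_incidences (v w : nat -> 'rV[R]_d) (a b : R) (N : nat) :
  #|incidences v w a b N|%:R = \sum_(n < N) \sum_(m < N) ind a b (dot (v n.+1) (w m.+1)).
Proof.
rewrite -sum1_card natr_sum (sum_incidences v w a b (fun _ _ => 1)).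
by apply: eq_bigr => n _; apply: eq_bigr => m _; rewrite mul1r.
Qed.

Lemma incidences_le (gamma eps : R) (v w : nat -> 'rV[R]_d) :
  (0 < d)%N -> gamma <= 1 -> 0 < eps ->
  uniformly_distributed gamma v -> uniformly_distributed gamma w ->
  exists2 K : R, 0 <= K & forall a b N, 100^-1 <= a -> a <= b -> (0 < N)%N ->
    #|incidences v w a b N|%:R <= N%:R ^+ 2 *
      (((3 / 16) ^+ 2) ^- d * (3 ^ d)%:R * (200 * d%:R) * (b - a) + K * N%:R `^ (eps - gamma)).
Proof.
move=> d0 gamma1 eps0 udv [cw _].
have [K K0 KP] := slab_count_le d0 gamma1 eps0 udv.
exists K => // a b N a100 ab N0; rewrite card_incidences exchange_big /=.
have NR0 : 0 < N%:R :> R by rewrite ltr0n.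
set T := (X in _ ^+ 2 * X); apply: (@le_trans _ _ (\sum_(m < N) N%:R * T)).
  apply: ler_sum => m _; rewrite -ler_pdivrMl//; apply: KP => //; exact: cw.
by rewrite sumr_const card_ord -[_ *+ N]mulr_natl expr2 mulrA.
Qed.

Lemma incidences_ge (gamma eps : R) (v w : nat -> 'rV[R]_d) :
  (0 < d)%N -> gamma <= 1 -> 0 < eps ->
  uniformly_distributed gamma v -> uniformly_distributed gamma w ->
  exists2 K : R, 0 <= K & forall a b N, 100^-1 <= a -> (0 < N)%N ->
    N%:R ^+ 2 * (\int[mu]_(x in cube) (bumps x * slab_mean bumps a b x) -
      K * N%:R `^ (eps - gamma)) <= #|incidences v w a b N|%:R.
Proof.
move=> d0 gamma1 eps0 udv udw; have [C cb] := @bumps_cutoff R d.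
have [K K0 KP] := pair_discrepancy d0 cb (@bumps_ge0 R d) gamma1 eps0 udv udw.
exists K => // a b N a100 N0.
have NR0 : 0 < N%:R :> R by rewrite ltr0n.
have := KP a b N a100 N0.
have -> : N%:R `^ (2 - gamma + eps) = N%:R ^+ 2 * N%:R `^ (eps - gamma) :> R.
  rewrite -powR_mulrn ?(ltW NR0)// -powRD; last by apply/implyP => _; rewrite gt_eqF.
  by congr (_ `^ _); ring.
rewrite card_incidences => /ler_normlP[]; rewrite opprB lerBlDr -lerBlDl => H _.
rewrite mulrBr; apply: (@le_trans _ _ (\sum_(n < N) \sum_(m < N)
  bumps (v n.+1) * bumps (w m.+1) * ind a b (dot (v n.+1) (w m.+1)))); last first.
  apply: ler_sum => n _; apply: ler_sum => m _; rewrite ler_piMl ?ind_ge0//.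
  by rewrite mulr_ile1 ?bumps_ge0 ?bumps_le1.
by apply: le_trans H; rewrite mulrCA.
Qed.

Lemma smooth_incidences (gamma : R) (v w : nat -> 'rV[R]_d) (psi : 'rV[R]_d -> R) :
  (0 < d)%N -> gamma <= 1 ->
  uniformly_distributed gamma v -> uniformly_distributed gamma w ->
  smooth psi -> (forall x, 0 <= psi x) -> closed_support psi `<=` open_cube ->
  forall eps, 0 < eps -> exists2 C, 0 < C & forall (a b : R) (N : nat),
  100^-1 <= a -> (0 < N)%N ->
  `|\sum_(p in incidences v w a b N) psi (v p.1.+1) * psi (w p.2.+1) -
    N%:R ^+ 2 * \int[(mu \x mu)%E]_(z in Omega a b) (psi z.1 * psi z.2)|
  <= C * N%:R `^ (2 - gamma + eps).
Proof.
move=> d0 gamma1 udv udw spsi psi0 psic eps eps0.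
have [C cg] := smooth_cutoff spsi psic.
have mg := cutoff_measurable cg.
have gC x : psi x <= C by apply: le_trans (ler_norm _) (cutoff_bound cg x).
have gc x : ~ cube x -> psi x = 0 := cutoff_outside cg.
have [K K0 KP] := pair_discrepancy d0 cg psi0 gamma1 eps0 udv udw.
exists (K + 1) => [|a b N a100 N0]; first by rewrite ltr_wpDl.
have -> : \int[(mu \x mu)%E]_(z in Omega a b) (psi z.1 * psi z.2) =
    \int[mu]_(x in cube) (psi x * slab_mean psi a b x).
  by rewrite {1}/Rintegral (integral_Omega mg psi0 gC gc).
rewrite (sum_incidences v w a b (fun n m => psi (v n.+1) * psi (w m.+1))).
apply: (le_trans (KP a b N a100 N0)).
by rewrite ler_wpM2r ?powR_ge0// lerDl.
Qed.

End incidence_sums.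

Theorem theorem1p4 (R : realType) (d : nat) (gamma : R)
    (v w : nat -> 'rV[R]_d) :
  (2 <= d)%N -> 0 < gamma <= 2^-1 ->
  uniformly_distributed gamma v -> uniformly_distributed gamma w ->
  (forall psi : 'rV[R]_d -> R,
    smooth psi -> (forall x, 0 <= psi x) ->
    closed_support psi `<=` open_cube ->
    exists Rem : R -> R -> nat -> R,
      (forall (a b : R) (N : nat), 100^-1 <= a -> (0 < N)%N ->
        \sum_(p in incidences v w a b N) psi (v p.1.+1) * psi (w p.2.+1) =
        N%:R ^+ 2 *
          (\int[(lebesgue_rV \x lebesgue_rV)%E]_(z in Omega a b)
             (psi z.1 * psi z.2)) +
        Rem a b N) /\
      (forall eps : R, 0 < eps -> exists2 C : R, 0 < C &
        forall (a b : R) (N : nat), 100^-1 <= a -> (0 < N)%N ->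
          `|Rem a b N| <= C * N%:R `^ (2 - gamma + eps))) /\
  (forall A B : R, A < d%:R -> exists c1 c2 : R,
    [/\ 0 < c1, 0 < c2,
      forall a b : R, 100^-1 <= a <= A -> a <= b <= B ->
        ((c1 * (b - a))%:E <=
          (lebesgue_rV \x lebesgue_rV) (@Omega R d a b) <=
          (c2 * (b - a))%:E)%E &
      forall c eps : R, 0 < c -> 0 < eps -> exists N0 : nat,
        forall (N : nat) (a b : R), (N0 <= N)%N ->
          100^-1 <= a <= A -> b <= B ->
          c * N%:R `^ (- gamma + eps) <= b - a ->
          c1 * (N%:R ^+ 2 * (b - a)) <= #|incidences v w a b N|%:R
            <= c2 * (N%:R ^+ 2 * (b - a))]).
Proof.
move=> d2 /andP[gamma0 gamma2] udv udw.
have d0 : (0 < d)%N by exact: leq_trans d2.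
have gamma1 : gamma <= 1 by lra.
split=> [psi spsi psi0 psic|A B Ad].
  exists (fun a b N => \sum_(p in incidences v w a b N) psi (v p.1.+1) * psi (w p.2.+1) -
    N%:R ^+ 2 * \int[(lebesgue_rV \x lebesgue_rV)%E]_(z in Omega a b) (psi z.1 * psi z.2)).
  split=> [a b N _ _|eps eps0]; first by rewrite addrC subrK.
  exact: smooth_incidences.
have [cL cL0 cLP] := @bumps_volume_ge R d A B d0 Ad.
set K3 : R := ((3 / 16) ^+ 2) ^- d * (3 ^ d)%:R * (200 * d%:R).
have K30 : 0 <= K3.
  by rewrite /K3 !mulr_ge0// invr_ge0 exprn_ge0// exprn_ge0// divr_ge0.
have d200 : 0 <= 200 * d%:R :> R by rewrite mulr_ge0.
exists (cL / 2), (K3 + 1 + 200 * d%:R); split.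
- by rewrite divr_gt0.
- by lra.
- move=> a b /andP[a1 aA] /andP[ab bB].
  have ba : 0 <= b - a by rewrite subr_ge0.
  apply/andP; split.
    apply: le_trans (bumps_volume_le a b); rewrite lee_fin.
    apply: (le_trans _ (cLP a b _ _)); last 2 first.
    + by rewrite a1.
    + by rewrite ab.
    by rewrite ler_wpM2r//; lra.
  apply: le_trans (volume_Omega_le d0 a1 ab) _; rewrite lee_fin ler_wpM2r//; lra.
move=> c eps c0 eps0.
have e20 : 0 < eps / 2 by rewrite divr_gt0.
have [K K0 KP] := incidences_le d0 gamma1 e20 udv udw.
have [K' K'0 K'P] := incidences_ge d0 gamma1 e20 udv udw.
have [n1 n10 n1P] := powRN_small K e20 c0.
have e2 : 0 < cL / 2 * c by rewrite mulr_gt0// divr_gt0.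
have [n2 n20 n2P] := powRN_small K' e20 e2.
exists (maxn n1 n2) => N a b; rewrite geq_max => /andP[Nn1 Nn2] /andP[a1 aA] bB Hc.
have N0 : (0 < N)%N by exact: leq_trans Nn1.
have NR0 : 0 < N%:R :> R by rewrite ltr0n.
have P0 : 0 < N%:R `^ (- gamma + eps) :> R by rewrite powR_gt0.
have ab : a <= b by rewrite -subr_ge0 (le_trans _ Hc)// mulr_ge0// ltW.
(* the error is smaller than [b - a] by a factor [N ^ (- eps / 2)], which absorbs the
   constants *)
have PE : N%:R `^ (eps / 2 - gamma) = N%:R `^ (- (eps / 2)) * N%:R `^ (- gamma + eps) :> R.
  rewrite -powRD; last by apply/implyP => _; rewrite gt_eqF.
  by congr (_ `^ _); lra.
have N2 : 0 <= N%:R ^+ 2 :> R by exact: sqr_ge0.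
apply/andP; split.
  apply: le_trans (K'P a b N a1 N0); rewrite mulrCA ler_wpM2l//.
  have h1 : K' * N%:R `^ (eps / 2 - gamma) <= cL / 2 * (b - a).
    rewrite PE mulrA; apply: (le_trans (ler_wpM2r (ltW P0) (n2P N Nn2))).
    by rewrite -(mulrA (cL / 2)) ler_wpM2l// ltW// divr_gt0.
  have := cLP a b; rewrite a1 aA ab bB => /(_ isT isT) h2.
  by move: h1 h2; rewrite mulrAC -[cL * _]/(cL * (b - a)); lra.
apply: (le_trans (KP a b N a1 ab N0)); rewrite [leRHS]mulrCA ler_wpM2l//.
have h1 : K * N%:R `^ (eps / 2 - gamma) <= b - a.
  by rewrite PE mulrA; apply: (le_trans (ler_wpM2r (ltW P0) (n1P N Nn1))).
have h2 : 0 <= 200 * d%:R * (b - a) by rewrite mulr_ge0// subr_ge0.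
by rewrite -/K3 !mulrDl mul1r; lra.
Qed.
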